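(* Let $A=kQ/I$ be a gentle algebra and let $X$ and $Y$ be strings in $Q$. The extensions $$\epsilon_T:\ 0\to X\to Y\alpha^{-1}X\to Y\to0\qquad(T\text{ connecting})$$ and $$\epsilon_T:\ 0\to X\to F_1ED_2\oplus F_2ED_1\to Y\to0\qquad(T=((F_1,E,D_1),(F_2,E,D_2))\text{ two-sided}),$$ where $T$ runs over the connecting maps and over the two-sided graph maps $f_T\in\operatorname{Hom}_A(X,Y)$, form a basis of $\operatorname{Ext}^1_A(Y,X)$.
   Context: **Gentle algebras.** $k$ is a field. Quivers $Q=(Q_0,Q_1,s,e)$ are finite and connected; $s(\gamma),e(\gamma)$ are the source and target of an arrow $\gamma$. Paths are written right to left: $\gamma_m\cdots\gamma_1$ is a path if $s(\gamma_{j+1})=e(\gamma_j)$. $A=kQ/I$ is gentle if $I$ is an admissible ideal generated by paths of length two, every vertex has at most two incoming and two outgoing arrows, and for every arrow $\alpha$ there is at most one arrow $\beta$ with $\alpha\beta$ a path not in $I$, at most one $\gamma$ with $\gamma\alpha$ a path not in $I$, at most one $\beta$ with $\alpha\beta$ a path in $I$, and at most one $\gamma$ with $\gamma\alpha$ a path in $I$. **Strings.** To each arrow $\delta$ associate a formal inverse $\delta^{-1}$ with $s(\delta^{-1})=e(\delta)$, $e(\delta^{-1})=s(\delta)$. A string in $Q$ is either a lazy path $e_x$ at a vertex $x$ (length zero, its own inverse) or a path $C=\gamma_n\cdots\gamma_1$ whose letters are arrows (''direct'') or formal inverses (''inverse''), such that no letter is followed by its inverse and neither $C$ nor $C^{-1}$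 contains a subpath in $I$; $s(C)=s(\gamma_1)$, $e(C)=e(\gamma_n)$. The string module $M(C)$ has basis $z_0,\dots,z_n$ placed at the successive vertices of $C$; a direct $\gamma_i$ sends $z_{i-1}$ to $z_i$, and if $\gamma_i=\delta^{-1}$ then $\delta$ sends $z_i$ to $z_{i-1}$; all other actions of arrows are zero. $M(C)\cong M(C^{-1})$; strings $C$ and $C^{-1}$ are identified, and $C$ also denotes $M(C)$. **Graph maps.** A factorization $C=FED$ of a string into strings, written $(F,E,D)$, is a quotient factorization if $D$ is lazy or its last (leftmost) letter is inverse, and $F$ is lazy or its first (rightmost) letter is direct; it induces a quotient map $C\to E$. It is a submodule factorization if $D$ is lazy or its last letter is direct, and $F$ is lazy or its first letter is inverse; it induces an inclusion $E\to C$. An admissible pair $T=((F_1,E,D_1),(F_2,E,D_2))$ from $X$ to $Y$ consists of a quotient factorization of $X$ and a submodule factorization of $Y$ whose middle terms agree up to inversion; after replacing $Y$ by $Y^{-1}$ if necessary we take them equal. The composite $X\to E\to Y$ is the graph map $f_T$. **Two-sided.** $f_T$ (or $T$) is two-sided if at least one of $D_1,D_2$ has positive length and at least one of $F_1,F_2$ has positive length. If $E$ has length zero, so that the orientation of $Y$ relative to $X$ is not determined by $E$, the orientation of $Y$ is to be chosen so that $F_1ED_2$ and $F_2ED_1$ are strings, and $T$ is two-sided if, for such a choice, at least one of $D_1,D_2$ has positive length and at least one of $F_1,F_2$ has positive length. **The extension of a two-sided map.** $X\to F_1ED_2\oplus F_2ED_1$ has as components the graph maps with middle terms $F_1E$ and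 $ED_1$, respectively; $F_1ED_2\oplus F_2ED_1\to Y$ has as components the graph map with middle term $ED_2$ and minus the graph map with middle term $F_2E$, respectively. **Connecting.** $Y$ is connectable to $X$ if there is an arrow $\alpha\in Q_1$ such that, after replacing $X$ and/or $Y$ by its inverse if necessary, $Y\alpha^{-1}X$ is a string in $Q$ (equivalently, up to inversion, $X\alpha Y$ is a string). Each such occurrence of a connecting arrow $\alpha$ (joining an end of $Y$ to an end of $X$) gives a connecting map, as follows. Let $\hat A=k\hat Q/\hat I$ be the fringed gentle algebra of $A$: $\hat Q$ is obtained by adding new (fringe) vertices, each joined by one new arrow to a vertex of $Q_0$, so that every vertex of $Q_0$ has exactly two incoming and two outgoing arrows, and $\hat I$ is obtained by adding to $I$ length-two paths involving new arrows, passing through vertices of $Q_0$, so that $\hat A$ is gentle. Then $\tau_{\hat A}Y=\operatorname{cohook}(Y)=\mathcal I\beta Y\alpha^{-1}\mathcal D$, where $\mathcal D$ (respectively $\mathcal I$) is the longest direct (respectively inverse) string making this a string in $\hat Q$; the connecting map is the graph map $X\to\tau_{\hat A}Y$ whose middle term $E$ is the longest direct string at the end of $X$, where $X=ED_1$, $\mathcal D=ED_2$. The associated extension $\epsilon_T:0\to X\to Y\alpha^{-1}X\to Y\to 0$ is given by the canonical inclusion of the submodule substring $X$ and the canonical projection onto the factor $Y$. *)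

(* Defs.v *)
From HB Require Import structures.
From mathcomp Require Import all_boot all_order all_algebra generic_quotient.
From mathcomp Require Import boolp.

Set Implicit Arguments.
Unset Strict Implicit.
Unset Printing Implicit Defensive.

Import GRing.Theory.
Local Open Scope ring_scope.
Local Open Scope quotient_scope.

(* A quiver together with a set of paths of length two, generating I.  Paths *)
(* are composed from right to left: [zero_rel a b] says that the path ab,    *)
(* i.e. first b and then a, is one of the generators.                        *)
Record bound_quiver := BoundQuiver {
  vertex : finType;
  arrow : finType;
  src : arrow -> vertex;
  tgt : arrow -> vertex;
  zero_rel : rel arrow }.

Arguments src {b}.
Arguments tgt {b}.
Arguments zero_rel {b}.

(* I is generated by paths, so a path lies in I iff it has a generator as a  *)
(* subpath.  [gentle_admissible] says that I contains all paths of some      *)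
(* length n; [w] lists the arrows in the order in which they are travelled.  *)
Record gentle (Q : bound_quiver) : Prop := Gentle {
  gentle_nonempty : (0 < #|vertex Q|)%N;
  gentle_connected : forall x y : vertex Q,
    connect (fun u v => [exists a : arrow Q,
      ((src a == u) && (tgt a == v)) || ((src a == v) && (tgt a == u))]) x y;
  gentle_length2 : forall a b : arrow Q, zero_rel a b -> src a = tgt b;
  gentle_admissible : exists n, forall w : seq (arrow Q), size w = n ->
    sorted (fun b a => src a == tgt b) w ->
    ~~ sorted (fun b a => ~~ zero_rel a b) w;
  gentle_in2 : forall x : vertex Q, (#|[set a : arrow Q | tgt a == x]| <= 2)%N;
  gentle_out2 : forall x : vertex Q, (#|[set a : arrow Q | src a == x]| <= 2)%N;
  gentle_before : forall a : arrow Q,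
    (#|[set b | (src a == tgt b) && ~~ zero_rel a b]| <= 1)%N;
  gentle_after : forall a : arrow Q,
    (#|[set c | (src c == tgt a) && ~~ zero_rel c a]| <= 1)%N;
  gentle_before0 : forall a : arrow Q,
    (#|[set b | (src a == tgt b) && zero_rel a b]| <= 1)%N;
  gentle_after0 : forall a : arrow Q,
    (#|[set c | (src c == tgt a) && zero_rel c a]| <= 1)%N }.

Section Modules.

Variables (k : fieldType) (Q : bound_quiver).

(* The generators of kQ/I as an algebra: [inl x] is the idempotent at x and  *)
(* [inr a] is the arrow a.                                                   *)
Notation gen := (vertex Q + arrow Q)%type.

(* The defining relations of kQ/I.  Linear maps are matrices acting on row   *)
(* vectors from the right, so the action of the path ab of a left module is  *)
(* [act (inr b) *m act (inr a)].                                             *)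
Definition is_module n (act : gen -> 'M[k]_n) : bool :=
  [&& \sum_x act (inl x) == 1%:M,
      [forall x, forall y, act (inl x) *m act (inl y) ==
         (if x == y then act (inl x) else 0)],
      [forall a, (act (inl (src a)) *m act (inr a) == act (inr a)) &&
                 (act (inr a) *m act (inl (tgt a)) == act (inr a))] &
      [forall a, forall b, zero_rel a b ==>
         (act (inr b) *m act (inr a) == 0)]].

(* Finite-dimensional left kQ/I-modules, on the spaces k^n.  The middle term  *)
(* of an extension of such modules is again finite-dimensional, so that this  *)
(* category suffices to define Ext^1.                                         *)
Record amod := AMod {
  dim : nat;
  act : gen -> 'M[k]_dim;
  actP : is_module act }.

Definition is_hom (M N : amod) (f : 'M[k]_(dim M, dim N)) : bool :=
  [forall g, act M g *m f == f *m act N g].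

Lemma homP (M N : amod) (f : 'M_(dim M, dim N)) :
  reflect (forall g, act M g *m f = f *m act N g) (is_hom f).
Proof. exact: 'forall_eqP. Qed.

Lemma is_moduleP n (a : gen -> 'M[k]_n) :
  reflect [/\ \sum_x a (inl x) = 1%:M,
      forall x y, a (inl x) *m a (inl y) = (if x == y then a (inl x) else 0),
      forall b, a (inl (src b)) *m a (inr b) = a (inr b),
      forall b, a (inr b) *m a (inl (tgt b)) = a (inr b) &
      forall b c, zero_rel b c -> a (inr c) *m a (inr b) = 0]
    (is_module a).
Proof.
apply: (iffP and4P) => [[/eqP h1 /forallP h2 /forallP h3 /forallP h4]|].
  split=> // [x y|b|b|b c hbc].
  - by move/forallP/(_ y)/eqP: (h2 x).
  - by have /andP[/eqP] := h3 b.
  - by have /andP[_ /eqP] := h3 b.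
  - by have /forallP/(_ c)/implyP/(_ hbc)/eqP := h4 b.
case=> h1 h2 h3 h4 h5; split; first exact/eqP.
- by apply/forallP=> x; apply/forallP=> y; apply/eqP.
- by apply/forallP=> b; rewrite h3 h4 !eqxx.
- by apply/forallP=> b; apply/forallP=> c; apply/implyP=> h; apply/eqP/h5.
Qed.

Lemma sub_is_module n r (a : gen -> 'M[k]_n) (b : gen -> 'M[k]_r)
    (K : 'M[k]_(r, n)) :
  row_free K -> (forall g, b g *m K = K *m a g) -> is_module a -> is_module b.
Proof.
move=> fK hK /is_moduleP[h1 h2 h3 h4 h5].
apply/is_moduleP; split=> [|x y|c|c|c d hcd]; apply: (row_free_inj fK).
- rewrite mulmx_suml (eq_bigr (fun x => K *m a (inl x))) //.
  by rewrite -mulmx_sumr h1 mulmx1 mul1mx.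
- rewrite -mulmxA hK mulmxA hK -mulmxA h2; case: eqP => _; first by rewrite hK.
  by rewrite mulmx0 mul0mx.
- by rewrite -mulmxA hK mulmxA hK -mulmxA h3.
- by rewrite -mulmxA hK mulmxA hK -mulmxA h4.
- by rewrite -mulmxA hK mulmxA hK -mulmxA h5 // mulmx0 mul0mx.
Qed.

Lemma quo_is_module n r (a : gen -> 'M[k]_n) (b : gen -> 'M[k]_r)
    (C : 'M[k]_(n, r)) :
  row_full C -> (forall g, a g *m C = C *m b g) -> is_module a -> is_module b.
Proof.
move=> fC hC /is_moduleP[h1 h2 h3 h4 h5].
apply/is_moduleP; split=> [|x y|c|c|c d hcd]; apply: (row_full_inj fC).
- rewrite mulmx_sumr; under eq_bigr do rewrite -hC.
  by rewrite -mulmx_suml h1 mulmx1 mul1mx.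
- rewrite mulmxA -hC -mulmxA -hC mulmxA h2; case: eqP => _ //.
  by rewrite mulmx0 mul0mx.
- by rewrite mulmxA -hC -mulmxA -hC mulmxA h3.
- by rewrite mulmxA -hC -mulmxA -hC mulmxA h4.
- by rewrite mulmxA -hC -mulmxA -hC mulmxA h5 // mulmx0 mul0mx.
Qed.

Definition dsum_act (M N : amod) (g : gen) : 'M[k]_(dim M + dim N) :=
  block_mx (act M g) 0 0 (act N g).

Lemma dsum_is_module (M N : amod) : is_module (dsum_act M N).
Proof.
have /is_moduleP[h1 h2 h3 h4 h5] := actP M.
have /is_moduleP[i1 i2 i3 i4 i5] := actP N.
have E g g' : dsum_act M N g *m dsum_act M N g' =
    block_mx (act M g *m act M g') 0 0 (act N g *m act N g').
  by rewrite mulmx_block !(mulmx0, mul0mx, addr0, add0r).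
apply/is_moduleP; split=> [|x y|c|c|c d hcd]; rewrite ?E.
- rewrite scalar_mx_block -h1 -i1 /dsum_act.
  elim/big_rec3: _ => [|x u v w _ ->]; first by rewrite block_mx0.
  by rewrite add_block_mx !addr0.
- by rewrite h2 i2 /dsum_act; case: eqP => // _; rewrite -[RHS]block_mx0.
- by rewrite h3 i3.
- by rewrite h4 i4.
- by rewrite h5 // i5 // block_mx0.
Qed.

Definition dsum (M N : amod) : amod := AMod (dsum_is_module M N).

Section KerCoker.

Variables (M N : amod) (f : 'M[k]_(dim M, dim N)).

Definition ker_mx := row_base (kermx f).

Definition ker_act (g : gen) : 'M[k]_(\rank (kermx f)) :=
  ker_mx *m act M g *m pinvmx ker_mx.

Definition coker_mx := col_base (cokermx f).

Definition coker_act (g : gen) : 'M[k]_(\rank (cokermx f)) :=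
  pinvmx coker_mx *m act N g *m coker_mx.

Lemma ker_mx_free : row_free ker_mx. Proof. exact: row_base_free. Qed.

Lemma coker_mx_full : row_full coker_mx. Proof. exact: col_base_full. Qed.

Lemma ker_mxE m (v : 'M_(m, dim M)) : (v <= ker_mx)%MS = (v *m f == 0).
Proof. by rewrite eq_row_base; apply/sub_kermxP/eqP. Qed.

Lemma ker_mxf : ker_mx *m f = 0.
Proof. by apply/eqP; rewrite -ker_mxE. Qed.

Lemma coker_mxE m (v : 'M_(m, dim N)) : (v <= f)%MS = (v *m coker_mx == 0).
Proof.
rewrite submxE -{1}(mulmx_base (cokermx f)) mulmxA.
by rewrite mulmx_free_eq0 // row_base_free.
Qed.

Lemma coker_mxf : f *m coker_mx = 0.
Proof. by apply/eqP; rewrite -coker_mxE. Qed.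

Hypothesis hf : is_hom f.

Lemma ker_actE g : ker_act g *m ker_mx = ker_mx *m act M g.
Proof.
rewrite mulmxKpV // ker_mxE -mulmxA (homP _ hf) mulmxA ker_mxf mul0mx //.
Qed.

Lemma coker_actE g : act N g *m coker_mx = coker_mx *m coker_act g.
Proof.
have : ((1%:M - coker_mx *m pinvmx coker_mx) <= f)%MS.
  by rewrite coker_mxE mulmxBl mul1mx -mulmxA mulVpmx ?coker_mx_full // mulmx1 subrr.
case/submxP=> D hD; apply/eqP; rewrite -subr_eq0 /coker_act.
have -> : act N g *m coker_mx - coker_mx *m (pinvmx coker_mx *m act N g *m coker_mx)
    = (1%:M - coker_mx *m pinvmx coker_mx) *m act N g *m coker_mx.
  by rewrite !mulmxBl mul1mx !mulmxA.
by rewrite hD -(mulmxA D) -(homP _ hf) -!mulmxA coker_mxf !mulmx0.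
Qed.

Lemma ker_is_module : is_module ker_act.
Proof. exact: sub_is_module ker_mx_free ker_actE (actP M). Qed.

Lemma coker_is_module : is_module coker_act.
Proof. exact: quo_is_module coker_mx_full coker_actE (actP N). Qed.

Definition ker_mod : amod := AMod ker_is_module.
Definition coker_mod : amod := AMod coker_is_module.

End KerCoker.

(* A sequence 0 -> M -> mid -> N -> 0. *)
Record sequence (N M : amod) := Sequence {
  mid : amod;
  inc : 'M[k]_(dim M, dim mid);
  prj : 'M[k]_(dim mid, dim N) }.

Definition short_exact (N M : amod) (s : sequence N M) : bool :=
  [&& is_hom (inc s), is_hom (prj s), row_free (inc s), row_full (prj s) &
      (inc s == kermx (prj s))%MS].

Record extension (N M : amod) := Extension {
  ext_seq :> sequence N M;
  ext_exact : short_exact ext_seq }.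

HB.instance Definition _ (N M : amod) := [isSub for @ext_seq N M].
HB.instance Definition _ (N M : amod) := gen_eqMixin (extension N M).
HB.instance Definition _ (N M : amod) := gen_choiceMixin (extension N M).

Definition ext_equiv (N M : amod) (e e' : extension N M) : Prop :=
  exists f : 'M[k]_(dim (mid e), dim (mid e')),
    [/\ is_hom f, inc e *m f = inc e' & f *m prj e' = prj e].

Lemma short_exactP (N M : amod) (s : sequence N M) :
  reflect [/\ forall g, act M g *m inc s = inc s *m act (mid s) g,
     forall g, act (mid s) g *m prj s = prj s *m act N g,
     row_free (inc s) && row_full (prj s),
     inc s *m prj s = 0 &
     forall m (v : 'M_(m, dim (mid s))), v *m prj s = 0 -> (v <= inc s)%MS]
   (short_exact s).
Proof.
apply: (iffP and5P) => [[/homP h1 /homP h2 h3 h4 h5]|[h1 h2 /andP[h3 h4] h5 h6]].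
  have /andP[h6 h7] := h5; split=> //; first by rewrite h3.
    by apply/sub_kermxP.
  by move=> m v /sub_kermxP h; apply: submx_trans h7.
split=> //; first exact/homP.
  exact/homP.
apply/andP; split; first exact/sub_kermxP.
exact/h6/mulmx_ker.
Qed.

Section Split.

Variables N M : amod.

Definition split_seq : sequence N M :=
  @Sequence N M (dsum M N) (row_mx 1%:M 0) (col_mx 0 1%:M).

Lemma split_exact : short_exact split_seq.
Proof.
apply/short_exactP; split=> [g|g|||m v] /=.
- by rewrite mul_mx_row mul_row_block !(mulmx0, mul0mx, mulmx1, mul1mx, addr0).
- by rewrite /dsum_act mul_block_col mul_col_mx !(mulmx0, mul0mx, mulmx1, mul1mx, add0r).
- apply/andP; split; first by apply/row_freeP; exists (col_mx 1%:M 0);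
    rewrite mul_row_col mulmx1 mulmx0 addr0.
  by apply/row_fullP; exists (row_mx 0 1%:M);
    rewrite mul_row_col mulmx1 mulmx0 add0r.
- by rewrite mul_row_col mulmx0 mul0mx addr0.
- rewrite -[v]hsubmxK mul_row_col mulmx0 mulmx1 add0r => ->.
  by apply/submxP; exists (lsubmx v); rewrite mul_mx_row mulmx1 mulmx0.
Qed.

Definition ext_split : extension N M := Extension split_exact.

End Split.

(* The pullback of e along g : N' -> N. *)
Section Pullback.

Variables (N M N' : amod) (e : extension N M) (g : 'M[k]_(dim N', dim N)).
Hypothesis hg : is_hom g.

Definition pull_mx : 'M[k]_(dim (dsum (mid e) N'), dim N) := col_mx (prj e) (- g).

Lemma pull_hom : is_hom pull_mx.
Proof.
have /short_exactP[_ h _ _ _] := ext_exact e.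
apply/homP=> x; rewrite /pull_mx /= mul_block_col !mul0mx addr0 add0r.
by rewrite h mulmxN (homP _ hg) mul_col_mx mulNmx.
Qed.

Definition pull_mid := ker_mod pull_hom.

Definition pull_seq : sequence N' M :=
  @Sequence N' M pull_mid
    (row_mx (inc e) 0 *m pinvmx (ker_mx pull_mx))
    (ker_mx pull_mx *m col_mx 0 1%:M).

Lemma pull_act x :
  act (mid pull_seq) x *m ker_mx pull_mx =
  ker_mx pull_mx *m act (dsum (mid e) N') x.
Proof. exact: (ker_actE pull_hom). Qed.

Lemma pull_inc : inc pull_seq *m ker_mx pull_mx = row_mx (inc e) 0.
Proof.
have /short_exactP[_ _ _ h _] := ext_exact e.
apply: mulmxKpV; rewrite ker_mxE mul_row_col h.
by rewrite mul0mx addr0.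
Qed.

Lemma pull_exact : short_exact pull_seq.
Proof.
have /short_exactP[h1 h2 /andP[h3 h4] h5 h6] := ext_exact e.
have fK := ker_mx_free pull_mx.
apply/short_exactP; split=> [x|x|||m v].
- apply: (row_free_inj fK); rewrite -[LHS]mulmxA -[RHS]mulmxA.
  rewrite pull_act pull_inc [RHS]mulmxA pull_inc.
  by rewrite mul_mx_row /= mul_row_block !(mulmx0, mul0mx, addr0) h1.
- rewrite mulmxA pull_act -!mulmxA; congr (_ *m _).
  by rewrite /dsum_act mul_block_col mul_col_mx !(mulmx0, mul0mx, mulmx1, mul1mx, add0r).
- apply/andP; split.
    have [B hB] := row_freeP h3.
    apply/row_freeP; exists (ker_mx pull_mx *m col_mx B 0).
    by rewrite mulmxA pull_inc mul_row_col mul0mx addr0.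
  have [B hB] := row_fullP h4.
  have : (row_mx (g *m B) 1%:M <= ker_mx pull_mx)%MS.
    by rewrite ker_mxE mul_row_col -mulmxA hB mulmx1 mul1mx subrr.
  case/submxP=> D hD; apply/row_fullP; exists D.
  by rewrite mulmxA -hD mul_row_col mulmx0 mul1mx add0r.
- by rewrite mulmxA pull_inc mul_row_col mulmx0 mul0mx addr0.
- rewrite mulmxA -[v *m _]hsubmxK mul_row_col mulmx0 mulmx1 add0r => hr.
  have : v *m ker_mx pull_mx *m pull_mx = 0 by rewrite -mulmxA ker_mxf mulmx0.
  rewrite -[v *m _]hsubmxK hr mul_row_col mul0mx addr0 => /h6/submxP[D hD].
  apply/submxP; exists D; apply: (row_free_inj fK).
  by rewrite -mulmxA pull_inc -[LHS]hsubmxK hr hD mul_mx_row mulmx0.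
Qed.

Definition ext_pull : extension N' M := Extension pull_exact.

End Pullback.

(* The pushout of e along f : M -> M'. *)
Section Pushout.

Variables (N M M' : amod) (e : extension N M) (f : 'M[k]_(dim M, dim M')).
Hypothesis hf : is_hom f.

Definition push_mx : 'M[k]_(dim M, dim (dsum (mid e) M')) := row_mx (inc e) (- f).

Lemma push_hom : is_hom push_mx.
Proof.
have /short_exactP[h _ _ _ _] := ext_exact e.
apply/homP=> x; rewrite /push_mx /= mul_row_block !mulmx0 addr0 add0r.
by rewrite mul_mx_row h mulmxN (homP _ hf) mulNmx.
Qed.

Definition push_mid := coker_mod push_hom.

Definition push_seq : sequence N M' :=
  @Sequence N M' push_mid
    (row_mx 0 1%:M *m coker_mx push_mx)
    (pinvmx (coker_mx push_mx) *m col_mx (prj e) 0).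

Lemma push_act x :
  act (dsum (mid e) M') x *m coker_mx push_mx =
  coker_mx push_mx *m act (mid push_seq) x.
Proof. exact: (coker_actE push_hom). Qed.

Lemma push_prj : coker_mx push_mx *m prj push_seq = col_mx (prj e) 0.
Proof.
have /short_exactP[_ _ _ h _] := ext_exact e.
set C := coker_mx _; rewrite /= -/C mulmxA; apply/eqP; rewrite -subr_eq0.
rewrite -[X in _ - X]mul1mx -mulmxBl.
have /submxP[D ->] : (C *m pinvmx C - 1%:M <= push_mx)%MS.
  by rewrite coker_mxE mulmxBl mul1mx -mulmxA mulVpmx ?coker_mx_full // mulmx1 subrr.
by rewrite -mulmxA mul_row_col h mulmx0 addr0 mulmx0.
Qed.

Lemma push_exact : short_exact push_seq.
Proof.
have /short_exactP[h1 h2 /andP[h3 h4] h5 h6] := ext_exact e.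
have fC := coker_mx_full push_mx.
have pE := push_prj.
apply/short_exactP; split=> [x|x|||m v].
- rewrite /= -mulmxA -push_act !mulmxA; congr (_ *m _).
  by rewrite mul_mx_row mul_row_block !(mulmx0, mul0mx, mulmx1, mul1mx, add0r).
- apply: (row_full_inj fC); rewrite [LHS]mulmxA [RHS]mulmxA pE.
  rewrite -push_act -[LHS]mulmxA pE.
  by rewrite /= /dsum_act mul_block_col mul_col_mx !(mulmx0, mul0mx, addr0, add0r) h2.
- apply/andP; split.
    rewrite -kermx_eq0; set v := kermx _.
    have : (v *m row_mx 0 1%:M : 'M_(_, dim (dsum (mid e) M'))) *m
        coker_mx push_mx == 0 by rewrite -mulmxA; apply/eqP/mulmx_ker.
    rewrite -coker_mxE => /submxP[D].
    rewrite mul_mx_row mulmx0 mulmx1 mul_mx_row => /eq_row_mx[hD hv].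
    have D0 : D = 0 by apply: (row_free_inj h3); rewrite -hD mul0mx.
    by rewrite hv D0 mul0mx.
  have [B hB] := row_fullP h4.
  apply/row_fullP; exists (row_mx B 0 *m coker_mx push_mx).
  by rewrite -mulmxA pE mul_row_col mulmx0 addr0.
- by rewrite -mulmxA pE mul_row_col mulmx0 mul0mx addr0.
- have -> : v = v *m pinvmx (coker_mx push_mx) *m coker_mx push_mx.
    by rewrite -mulmxA mulVpmx // mulmx1.
  set w := v *m _; rewrite -mulmxA pE -[w]hsubmxK mul_row_col mulmx0 addr0.
  move=> /h6/submxP[D hD]; apply/submxP; exists (rsubmx w + D *m f).
  rewrite hsubmxK [RHS]mulmxA; apply/eqP; rewrite -subr_eq0 -mulmxBl.
  set u := (X in X *m _); suff -> : u = D *m push_mx by rewrite -mulmxA coker_mxf mulmx0.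
  rewrite /u -{1}[w]hsubmxK !mul_mx_row mulmx0 mulmx1 hD.
  by rewrite opp_row_mx add_row_mx subr0 opprD addrA subrr add0r mulmxN.
Qed.

Definition ext_push : extension N M' := Extension push_exact.

End Pushout.

Section DirectSum.

Variables (N N' M M' : amod) (e : extension N M) (e' : extension N' M').

Definition dsum_seq : sequence (dsum N N') (dsum M M') :=
  @Sequence (dsum N N') (dsum M M') (dsum (mid e) (mid e'))
    (block_mx (inc e) 0 0 (inc e')) (block_mx (prj e) 0 0 (prj e')).

Lemma dsum_exact : short_exact dsum_seq.
Proof.
have /short_exactP[h1 h2 /andP[h3 h4] h5 h6] := ext_exact e.
have /short_exactP[i1 i2 /andP[i3 i4] i5 i6] := ext_exact e'.
have E m n p m' n' p' (a : 'M[k]_(m, n)) (b : 'M[k]_(n, p)) (a' : 'M[k]_(m', n'))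
    (b' : 'M[k]_(n', p')) :
    block_mx a 0 0 a' *m block_mx b 0 0 b' = block_mx (a *m b) 0 0 (a' *m b').
  by rewrite mulmx_block !(mulmx0, mul0mx, addr0, add0r).
apply/short_exactP; split=> [x|x|||m v] /=.
- by rewrite !E h1 i1.
- by rewrite !E h2 i2.
- have [B hB] := row_freeP h3; have [B' hB'] := row_freeP i3.
  have [C hC] := row_fullP h4; have [C' hC'] := row_fullP i4.
  apply/andP; split.
    by apply/row_freeP; exists (block_mx B 0 0 B'); rewrite E hB hB' -scalar_mx_block.
  by apply/row_fullP; exists (block_mx C 0 0 C'); rewrite E hC hC' -scalar_mx_block.
- by rewrite E h5 i5 block_mx0.
- rewrite -[v]hsubmxK mul_row_block !mulmx0 addr0 add0r.
  rewrite -row_mx0 => /eq_row_mx[/h6/submxP[D hD] /i6/submxP[D' hD']].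
  apply/submxP; exists (row_mx D D').
  by rewrite mul_row_block !mulmx0 addr0 add0r -hD -hD'.
Qed.

Definition ext_dsum := Extension dsum_exact.

End DirectSum.

Lemma scalar_hom (M : amod) (c : k) : is_hom (c%:M : 'M_(dim M, dim M)).
Proof. by apply/homP=> x; rewrite scalar_mxC. Qed.

Lemma diag_hom (N : amod) : is_hom (row_mx 1%:M 1%:M : 'M_(dim N, dim (dsum N N))).
Proof.
apply/homP=> x; rewrite mul_mx_row /= mul_row_block.
by rewrite !(mulmx0, mulmx1, mul1mx, addr0, add0r).
Qed.

Lemma codiag_hom (M : amod) : is_hom (col_mx 1%:M 1%:M : 'M_(dim (dsum M M), dim M)).
Proof.
apply/homP=> x; rewrite /= mul_block_col mul_col_mx.
by rewrite !(mul0mx, mulmx1, mul1mx, addr0, add0r).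
Qed.

Definition baer_sum (N M : amod) (e e' : extension N M) : extension N M :=
  ext_push (ext_pull (ext_dsum e e') (diag_hom N)) (codiag_hom M).

Definition ext_scale (N M : amod) (c : k) (e : extension N M) : extension N M :=
  ext_push e (scalar_hom M c).

(* The cocycle of an extension with respect to a k-linear splitting; two      *)
(* extensions are equivalent iff their cocycles differ by a coboundary.  The  *)
(* splittings are locked because pinvmx unfolds to a product, which matches   *)
(* mulmxA.                                                                    *)
Section Cocycle.

Definition sect (N M : amod) (e : extension N M) := locked (pinvmx (prj e)).
Definition retr (N M : amod) (e : extension N M) :=
  locked ((1%:M - prj e *m sect e) *m pinvmx (inc e)).
Definition cocycle (N M : amod) (e : extension N M) g : 'M[k]_(dim N, dim M) :=
  sect e *m act (mid e) g *m retr e.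

Definition cobound (N M : amod) (D : gen -> 'M[k]_(dim N, dim M)) :=
  exists h, forall g, D g = h *m act M g - act N g *m h.

Lemma sect_prj (N M : amod) (e : extension N M) : sect e *m prj e = 1%:M.
Proof.
by have /short_exactP[_ _ /andP[_ ?] _ _] := ext_exact e;
  rewrite /sect -lock mulVpmx.
Qed.

Lemma splitting (N M : amod) (e : extension N M) :
  retr e *m inc e + prj e *m sect e = 1%:M.
Proof.
have /short_exactP[_ _ _ _ h] := ext_exact e.
rewrite /retr -lock mulmxKpV ?subrK //; apply: h.
by rewrite mulmxBl mul1mx -mulmxA sect_prj mulmx1 subrr.
Qed.

Lemma inc_prj (N M : amod) (e : extension N M) : inc e *m prj e = 0.
Proof. by have /short_exactP[] := ext_exact e. Qed.

Lemma inc_retr (N M : amod) (e : extension N M) : inc e *m retr e = 1%:M.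
Proof.
have /short_exactP[_ _ /andP[h _] _ _] := ext_exact e.
apply: (row_free_inj h); rewrite -mulmxA mul1mx.
have := congr1 (mulmx (inc e)) (splitting e).
by rewrite mulmxDr !mulmxA inc_prj mul0mx addr0 mulmx1 -mulmxA.
Qed.

Lemma sect_retr (N M : amod) (e : extension N M) : sect e *m retr e = 0.
Proof.
rewrite /retr -lock mulmxA mulmxBr mulmx1 [sect e *m (prj e *m _)]mulmxA.
by rewrite sect_prj mul1mx subrr mul0mx.
Qed.

Lemma prj_act (N M : amod) (e : extension N M) g :
  act (mid e) g *m prj e = prj e *m act N g.
Proof. by have /short_exactP[] := ext_exact e. Qed.

Lemma inc_act (N M : amod) (e : extension N M) g :
  act M g *m inc e = inc e *m act (mid e) g.
Proof. by have /short_exactP[] := ext_exact e. Qed.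

Lemma cobound_morph (N M N' M' : amod) (e : extension N M) (e' : extension N' M')
    (f : 'M_(dim M, dim M')) (g : 'M_(dim N, dim N'))
    (phi : 'M_(dim (mid e), dim (mid e'))) :
  is_hom phi -> inc e *m phi = f *m inc e' -> phi *m prj e' = prj e *m g ->
  cobound (fun x => cocycle e x *m f - g *m cocycle e' x).
Proof.
move=> /homP hphi hi hp; exists (sect e *m phi *m retr e') => x.
have E1 : sect e *m act (mid e) x *m phi *m retr e' =
    cocycle e x *m f + act N x *m (sect e *m phi *m retr e').
  rewrite -[sect e *m _]mulmx1 -{1}(splitting e) mulmxDr !mulmxDl.
  congr (_ + _).
    by rewrite !mulmxA -[_ *m inc e *m phi]mulmxA hi !mulmxA -[_ *m inc e' *m _]mulmxA
       inc_retr mulmx1.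
  rewrite !mulmxA -[_ *m act _ x *m prj e]mulmxA prj_act !mulmxA sect_prj mul1mx.
  by [].
have E2 : sect e *m phi *m act (mid e') x *m retr e' =
    (sect e *m phi *m retr e') *m act M' x + g *m cocycle e' x.
  rewrite -[sect e *m _]mulmx1 -{1}(splitting e') mulmxDr !mulmxDl.
  congr (_ + _).
    rewrite !mulmxA -[_ *m inc e' *m _]mulmxA -inc_act !mulmxA.
    by rewrite -[_ *m inc e' *m _]mulmxA inc_retr !mulmx1.
  rewrite !mulmxA -[_ *m phi *m prj e']mulmxA hp !mulmxA sect_prj mul1mx.
  by [].
have E : sect e *m act (mid e) x *m phi *m retr e' =
         sect e *m phi *m act (mid e') x *m retr e'.
  by rewrite -[_ *m _ *m phi]mulmxA hphi mulmxA.
move: E1; rewrite E E2 => E3; apply/eqP; rewrite subr_eq addrAC eq_sym subr_eq E3.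
by rewrite addrC.
Qed.

Lemma cobound_ext (N M : amod) (D D' : gen -> 'M[k]_(dim N, dim M)) :
  D =1 D' -> cobound D -> cobound D'.
Proof. by move=> E [h hD]; exists h => g; rewrite -E. Qed.

Lemma coboundD (N M : amod) (D D' : gen -> 'M[k]_(dim N, dim M)) :
  cobound D -> cobound D' -> cobound (fun g => D g + D' g).
Proof.
move=> [h hD] [h' hD']; exists (h + h') => g.
by rewrite hD hD' mulmxDl mulmxDr opprD addrACA.
Qed.

Lemma coboundN (N M : amod) (D : gen -> 'M[k]_(dim N, dim M)) :
  cobound D -> cobound (fun g => - D g).
Proof. by move=> [h hD]; exists (- h) => g; rewrite hD mulNmx mulmxN opprD. Qed.

Lemma coboundZ (N M : amod) c (D : gen -> 'M[k]_(dim N, dim M)) :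
  cobound D -> cobound (fun g => c *: D g).
Proof.
by move=> [h hD]; exists (c *: h) => g; rewrite hD scalerBr -scalemxAl -scalemxAr.
Qed.

Lemma cobound0 (N M : amod) : cobound (fun _ => 0 : 'M[k]_(dim N, dim M)).
Proof. by exists 0 => g; rewrite mul0mx mulmx0 subrr. Qed.

Lemma coboundMl (N N' M : amod) (f : 'M_(dim N', dim N))
    (D : gen -> 'M[k]_(dim N, dim M)) :
  is_hom f -> cobound D -> cobound (fun g => f *m D g).
Proof.
move=> /homP hf [h hD]; exists (f *m h) => g.
by rewrite hD mulmxBr !mulmxA hf.
Qed.

Lemma coboundMr (N M M' : amod) (f : 'M_(dim M, dim M'))
    (D : gen -> 'M[k]_(dim N, dim M)) :
  is_hom f -> cobound D -> cobound (fun g => D g *m f).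
Proof.
move=> /homP hf [h hD]; exists (h *m f) => g.
by rewrite hD mulmxBl -!mulmxA hf.
Qed.

Lemma ext_equivP (N M : amod) (e e' : extension N M) :
  ext_equiv e e' <-> cobound (fun g => cocycle e g - cocycle e' g).
Proof.
split=> [[f [hf hi hp]]|[h hD]].
  have := @cobound_morph _ _ _ _ e e' 1%:M 1%:M f hf.
  rewrite mul1mx mulmx1 => /(_ hi hp); apply: cobound_ext => g.
  by rewrite mulmx1 mul1mx.
have A0 (e1 : extension N M) g :
    sect e1 *m act (mid e1) g = cocycle e1 g *m inc e1 + act N g *m sect e1.
  rewrite -[LHS]mulmx1 -(splitting e1) mulmxDr !mulmxA; congr (_ + _).
  by rewrite -[_ *m _ *m prj _]mulmxA prj_act mulmxA sect_prj mul1mx.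
set t := sect e' + h *m inc e'.
pose f := retr e *m inc e' + prj e *m t.
have fi : inc e *m f = inc e'.
  by rewrite mulmxDr !mulmxA inc_retr mul1mx inc_prj mul0mx addr0.
have fs : sect e *m f = t.
  by rewrite mulmxDr !mulmxA sect_retr mul0mx sect_prj mul1mx add0r.
exists f; split=> //.
- apply/homP=> g.
  have E X Y : inc e *m X = inc e *m Y -> sect e *m X = sect e *m Y ->
      X = Y :> 'M_(dim (mid e), dim (mid e')).
    move=> E1 E2; rewrite -[X]mul1mx -[Y]mul1mx -(splitting e) !mulmxDl.
    by rewrite -!mulmxA E1 E2.
  apply: E; rewrite !mulmxA.
    by rewrite -inc_act -mulmxA !fi inc_act.
  move: (cocycle e g) (cocycle e' g) (hD g) (A0 e g) (A0 e' g) => c c' Hc -> Ac'.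
  have /eqP := Hc; rewrite subr_eq => /eqP {Hc}->.
  rewrite fs mulmxDl -[_ *m sect e *m f]mulmxA -[_ *m inc e *m f]mulmxA fi fs.
  rewrite [t *m _]mulmxDl Ac' -[h *m _ *m _]mulmxA -inc_act mulmxDr !mulmxDl mulNmx !mulmxA.
  rewrite [act N g *m sect e' + _]addrC addrA [_ + _ + act N g *m h *m _]addrAC.
  by rewrite subrK -addrA addrC.
- rewrite mulmxDl -!mulmxA inc_prj mulmx0 add0r mulmxDl sect_prj -mulmxA inc_prj.
  by rewrite mulmx0 addr0 mulmx1.
Qed.

Lemma cocycle_push (N M M' : amod) (e : extension N M) f (hf : is_hom f) :
  cobound (fun g => cocycle e g *m f - cocycle (ext_push e hf : extension N M') g).
Proof.
have [phi [h1 h2 h3]] : exists phi, [/\ is_hom phi,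
    inc e *m phi = f *m inc (ext_push e hf) &
    phi *m prj (ext_push e hf) = prj e *m 1%:M].
  exists (row_mx 1%:M 0 *m coker_mx (push_mx e f)); split.
  - apply/homP=> g; rewrite -[RHS]mulmxA -push_act !mulmxA; congr (_ *m _).
    by rewrite mul_mx_row /= mul_row_block !(mulmx0, mulmx1, mul1mx, mul0mx, addr0).
  - apply/eqP; rewrite [X in X == _]mulmxA [X in _ == X]mulmxA -subr_eq0 -mulmxBl.
    set u := (X in X *m _); suff -> : u = push_mx e f by apply/eqP; exact: coker_mxf.
    by rewrite /u !mul_mx_row !mulmx0 !mulmx1 opp_row_mx add_row_mx subr0 add0r.
  - by rewrite -mulmxA push_prj mul_row_col mul0mx addr0 mul1mx mulmx1.
apply: cobound_ext (cobound_morph h1 h2 h3) => g.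
by rewrite mul1mx.
Qed.

Lemma cocycle_pull (N M N' : amod) (e : extension N M) g (hg : is_hom g) :
  cobound (fun x => cocycle (ext_pull e hg : extension N' M) x - g *m cocycle e x).
Proof.
have [phi [h1 h2 h3]] : exists phi : 'M_(dim (mid (ext_pull e hg)), dim (mid e)),
  [/\ is_hom phi, inc (ext_pull e hg) *m phi = 1%:M *m inc e &
    phi *m prj e = prj (ext_pull e hg) *m g].
  exists (ker_mx (pull_mx e g) *m col_mx 1%:M 0); split.
  - apply/homP=> x; rewrite mulmxA pull_act -!mulmxA; congr (_ *m _).
    by rewrite /= /dsum_act mul_block_col mul_col_mx
       !(mulmx0, mulmx1, mul1mx, mul0mx, addr0).
  - by rewrite mulmxA pull_inc mul_row_col mul0mx addr0 mulmx1 mul1mx.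
  - apply/eqP; rewrite -[X in X == _]mulmxA -[X in _ == X]mulmxA -subr_eq0 -mulmxBr.
    set u := (X in _ *m X); suff -> : u = pull_mx e g by apply/eqP; exact: ker_mxf.
    by rewrite /u !mul_col_mx !mul0mx !mul1mx opp_col_mx add_col_mx subr0 add0r.
apply: cobound_ext (cobound_morph h1 h2 h3) => x.
by rewrite mulmx1.
Qed.

Lemma cocycle_baer (N M : amod) (e e' : extension N M) :
  cobound (fun g => cocycle (baer_sum e e') g - (cocycle e g + cocycle e' g)).
Proof.
have h1 := cocycle_push (ext_pull (ext_dsum e e') (diag_hom N)) (codiag_hom M).
have h2 := coboundMr (codiag_hom M) (cocycle_pull (ext_dsum e e') (diag_hom N)).
have hom1 (A B : amod) : is_hom (col_mx 1%:M 0 : 'M_(dim (dsum A B), dim A)).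
  apply/homP=> g; rewrite /= /dsum_act mul_block_col mul_col_mx.
  by rewrite !(mulmx0, mulmx1, mul1mx, mul0mx, addr0).
have hom2 (A B : amod) : is_hom (col_mx 0 1%:M : 'M_(dim (dsum A B), dim B)).
  apply/homP=> g; rewrite /= /dsum_act mul_block_col mul_col_mx.
  by rewrite !(mulmx0, mulmx1, mul1mx, mul0mx, add0r).
have h3 := @cobound_morph _ _ _ _ (ext_dsum e e') e _ _ _ (hom1 (mid e) (mid e')).
have {}h3 := h3 (col_mx 1%:M 0) (col_mx 1%:M 0).
have h4 := @cobound_morph _ _ _ _ (ext_dsum e e') e' _ _ _ (hom2 (mid e) (mid e')).
have {}h4 := h4 (col_mx 0 1%:M) (col_mx 0 1%:M).
have {}h3 := coboundMl (diag_hom N) (h3 _ _).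
have {}h4 := coboundMl (diag_hom N) (h4 _ _).
have {}h3 : cobound (fun g => row_mx 1%:M 1%:M *m
    (cocycle (ext_dsum e e') g *m col_mx 1%:M 0 - col_mx 1%:M 0 *m cocycle e g)).
  apply: h3; rewrite /= ?mul_block_col ?mul_col_mx;
  by rewrite !(mulmx0, mulmx1, mul1mx, mul0mx, addr0).
have {}h4 : cobound (fun g => row_mx 1%:M 1%:M *m
    (cocycle (ext_dsum e e') g *m col_mx 0 1%:M - col_mx 0 1%:M *m cocycle e' g)).
  apply: h4; rewrite /= ?mul_block_col ?mul_col_mx;
  by rewrite !(mulmx0, mulmx1, mul1mx, mul0mx, add0r).
have := coboundD (coboundD (coboundN h1) h2) (coboundD h3 h4).
apply: cobound_ext => g; rewrite -/(baer_sum e e').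
move: (cocycle (ext_dsum e e') g) (cocycle (ext_pull _ _) g) (cocycle (baer_sum e e') g).
move=> S P B.
have -> : col_mx 1%:M 1%:M =
    col_mx 1%:M 0 + col_mx 0 1%:M :> 'M[k]_(dim M + dim M, dim M).
  by rewrite add_col_mx addr0 add0r.
rewrite opprB mulmxBl addrA addrA subrK.
rewrite !mulmxBr mulmxDr ![row_mx _ _ *m (col_mx _ _ *m _)]mulmxA !mul_row_col.
rewrite !(mul0mx, mulmx0, mulmx1, mul1mx, addr0, add0r).
rewrite ![row_mx _ _ *m (S *m _)]mulmxA opprD !addrA.
set a := row_mx _ _ *m S *m col_mx 1%:M 0.
set b := row_mx _ _ *m S *m col_mx 0 1%:M.
by rewrite [_ - a - b + a]addrAC subrK [_ - _ + b]addrAC subrK opprD addrA.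
Qed.

Lemma cocycle_scale (N M : amod) c (e : extension N M) :
  cobound (fun g => cocycle (ext_scale c e) g - c *: cocycle e g).
Proof.
apply: cobound_ext (coboundN (cocycle_push e (scalar_hom M c))) => g.
by rewrite opprB mul_mx_scalar.
Qed.

Lemma cocycle_split (N M : amod) : cobound (cocycle (ext_split N M)).
Proof.
have h : is_hom (block_mx 0 0 0 1%:M : 'M_(dim (dsum M N), dim (dsum M N))).
  apply/homP=> g; rewrite /= /dsum_act !mulmx_block.
  by rewrite !(mulmx0, mul0mx, mulmx1, mul1mx, addr0, add0r).
have := @cobound_morph _ _ _ _ (ext_split N M) (ext_split N M) 0 1%:M _ h.
rewrite /= mul0mx mulmx1 mul_row_block mul_block_col.
rewrite !(mulmx0, mul0mx, mulmx1, mul1mx, addr0, add0r) row_mx0 => /(_ erefl erefl).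
by move/coboundN; apply: cobound_ext => g; rewrite mulmx0 mul1mx sub0r opprK.
Qed.

End Cocycle.

Section Ext.

Variables N M : amod.
Implicit Types e : extension N M.

Definition ext_equivb e e' : bool := `[< ext_equiv e e' >].

Lemma ext_equivbP e e' :
  reflect (cobound (fun g => cocycle e g - cocycle e' g)) (ext_equivb e e').
Proof. by apply: (iffP (asboolP _)) => /ext_equivP. Qed.

Lemma ext_equiv_refl : reflexive ext_equivb.
Proof.
move=> e; apply/ext_equivbP; apply: cobound_ext (cobound0 N M) => g.
by rewrite subrr.
Qed.

Lemma ext_equiv_sym : symmetric ext_equivb.
Proof.
move=> e e'; apply/ext_equivbP/ext_equivbP => /coboundN;
by apply: cobound_ext => g; rewrite opprB.
Qed.

Lemma ext_equiv_trans : transitive ext_equivb.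
Proof.
move=> e e1 e2 /ext_equivbP h1 /ext_equivbP h2; apply/ext_equivbP.
by apply: cobound_ext (coboundD h1 h2) => g; rewrite addrA subrK.
Qed.

Canonical ext_equiv_rel :=
  EquivRel ext_equivb ext_equiv_refl ext_equiv_sym ext_equiv_trans.

(* Ext^1(N, M): extensions of N by M up to equivalence, with the Baer sum.    *)
Definition Ext1 := {eq_quot ext_equivb}.

HB.instance Definition _ := Choice.on Ext1.
HB.instance Definition _ := EqQuotient.on Ext1.

Definition ext_class e : Ext1 := \pi_Ext1 e.

Definition Ext1_add (x y : Ext1) := ext_class (baer_sum (repr x) (repr y)).
Definition Ext1_scale (c : k) (x : Ext1) := ext_class (ext_scale c (repr x)).
Definition Ext1_opp (x : Ext1) := Ext1_scale (-1) x.
Definition Ext1_zero : Ext1 := ext_class (ext_split N M).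

(* [cls x D]: the class x is represented by the cocycle D.                    *)
Let cls (x : Ext1) D := cobound (fun g => cocycle (repr x) g - D g).

Lemma ext_classP e e' :
  reflect (ext_equiv e e') (ext_class e == ext_class e').
Proof. by rewrite /ext_class eqmodE; apply: asboolP. Qed.

Let clsE e : cls (ext_class e) (cocycle e).
Proof. by apply/ext_equivP/ext_classP; rewrite /ext_class reprK. Qed.

Let cls_inj x y D : cls x D -> cls y D -> x = y.
Proof.
move=> hx hy; rewrite -[x]reprK -[y]reprK; apply/eqP/ext_classP/ext_equivP.
apply: cobound_ext (coboundD hx (coboundN hy)) => g.
by rewrite opprB addrA subrK.
Qed.

Let cls_repr x : cls x (cocycle (repr x)).
Proof. by apply: cobound_ext (cobound0 N M) => g; rewrite subrr. Qed.

Let cls_trans x D D' : cls x D -> cobound (fun g => D g - D' g) -> cls x D'.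
Proof.
by move=> h h'; apply: cobound_ext (coboundD h h') => g; rewrite addrA subrK.
Qed.

Let cls_add x y D D' : cls x D -> cls y D' -> cls (Ext1_add x y) (fun g => D g + D' g).
Proof.
move=> hx hy; apply: cls_trans (clsE _) _.
apply: cobound_ext (coboundD (cocycle_baer (repr x) (repr y)) (coboundD hx hy)) => g.
by rewrite [X in _ + X = _]addrACA -opprD addrA subrK.
Qed.

Let cls_scale c x D : cls x D -> cls (Ext1_scale c x) (fun g => c *: D g).
Proof.
move=> hx; apply: cls_trans (clsE _) _.
apply: cobound_ext (coboundD (cocycle_scale c (repr x)) (coboundZ c hx)) => g.
by rewrite scalerBr addrA subrK.
Qed.

Let cls_zero : cls Ext1_zero (fun _ => 0).
Proof.
apply: cls_trans (clsE _) _.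
by apply: cobound_ext (cocycle_split N M) => g; rewrite subr0.
Qed.

Let cls_ext x D D' : D =1 D' -> cls x D -> cls x D'.
Proof. by move=> E; apply: cobound_ext => g; rewrite E. Qed.

Lemma Ext1_addA : associative Ext1_add.
Proof.
move=> x y z; apply: cls_inj (cls_add (cls_repr _) (cls_add (cls_repr _) (cls_repr _))) _.
apply: cls_ext (cls_add (cls_add (cls_repr _) (cls_repr _)) (cls_repr _)) => g.
by rewrite addrA.
Qed.

Lemma Ext1_addC : commutative Ext1_add.
Proof.
move=> x y; apply: cls_inj (cls_add (cls_repr _) (cls_repr _)) _.
by apply: cls_ext (cls_add (cls_repr _) (cls_repr _)) => g; rewrite addrC.
Qed.

Lemma Ext1_add0 : left_id Ext1_zero Ext1_add.
Proof.
move=> x; apply: cls_inj (cls_repr _).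
by apply: cls_ext (cls_add cls_zero (cls_repr _)) => g; rewrite add0r.
Qed.

Lemma Ext1_addN : left_inverse Ext1_zero Ext1_opp Ext1_add.
Proof.
move=> x; apply: cls_inj cls_zero.
apply: cls_ext (cls_add (cls_scale _ (cls_repr _)) (cls_repr _)) => g.
by rewrite scaleN1r addNr.
Qed.

HB.instance Definition _ :=
  GRing.isZmodule.Build Ext1 Ext1_addA Ext1_addC Ext1_add0 Ext1_addN.

Lemma Ext1_scaleA a b x : Ext1_scale a (Ext1_scale b x) = Ext1_scale (a * b) x.
Proof.
apply: cls_inj (cls_scale _ (cls_repr _)).
by apply: cls_ext (cls_scale _ (cls_scale _ (cls_repr _))) => g; rewrite scalerA.
Qed.

Lemma Ext1_scale1 : left_id 1 Ext1_scale.
Proof.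
move=> x; apply: cls_inj (cls_repr _).
by apply: cls_ext (cls_scale _ (cls_repr _)) => g; rewrite scale1r.
Qed.

Lemma Ext1_scaleDr : right_distributive Ext1_scale +%R.
Proof.
move=> c x y; apply: cls_inj (cls_scale _ (cls_add (cls_repr _) (cls_repr _))) _.
apply: cls_ext (cls_add (cls_scale _ (cls_repr _)) (cls_scale _ (cls_repr _))) => g.
by rewrite scalerDr.
Qed.

Lemma Ext1_scaleDl x : {morph Ext1_scale^~ x : a b / a + b}.
Proof.
move=> a b; apply: cls_inj (cls_scale _ (cls_repr _)) _.
apply: cls_ext (cls_add (cls_scale _ (cls_repr _)) (cls_scale _ (cls_repr _))) => g.
by rewrite scalerDl.
Qed.

HB.instance Definition _ :=
  GRing.Zmodule_isLmodule.Build k Ext1 Ext1_scaleA Ext1_scale1 Ext1_scaleDr Ext1_scaleDl.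

Lemma ext_classD e e' : ext_class (baer_sum e e') = ext_class e + ext_class e'.
Proof.
apply: cls_inj (cls_add (clsE _) (clsE _)).
exact: cls_trans (clsE _) (cocycle_baer _ _).
Qed.

Lemma ext_classZ c e : ext_class (ext_scale c e) = c *: ext_class e.
Proof.
apply: cls_inj (cls_scale _ (clsE _)).
exact: cls_trans (clsE _) (cocycle_scale _ _).
Qed.

End Ext.

End Modules.

Definition is_basis (k : fieldType) (V : lmodType k) (I : finType) (b : I -> V) :
    Prop :=
  forall v, exists! c : {ffun I -> k}, v = \sum_i c i *: b i.

Section Strings.

Variables (k : fieldType) (Q : bound_quiver).

(* (a, true) is the direct letter a, (a, false) its formal inverse.           *)
Definition letter := (arrow Q * bool)%type.

Definition lsrc (l : letter) : vertex Q := if l.2 then src l.1 else tgt l.1.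
Definition ltgt (l : letter) : vertex Q := if l.2 then tgt l.1 else src l.1.
Definition linv (l : letter) : letter := (l.1, ~~ l.2).

(* The walk C = l_n ... l_1 from x is the pair (x, [:: l_1; ...; l_n]):       *)
(* letters are listed from right to left.                                     *)
Definition walk := (vertex Q * seq letter)%type.

Definition wstart (C : walk) : vertex Q := C.1.
Definition wletters (C : walk) : seq letter := C.2.
Definition wdim (C : walk) : nat := (size C.2).+1.
Definition wverts (C : walk) : seq (vertex Q) := C.1 :: map ltgt C.2.
Definition wend (C : walk) : vertex Q := last C.1 (map ltgt C.2).
Definition winv (C : walk) : walk := (wend C, rev (map linv C.2)).

(* l' may follow l in a string.  For two inverse letters the relevant         *)
(* subpath is the one of the inverse walk.                                    *)
Definition string_step (l l' : letter) : bool :=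
  [&& ltgt l == lsrc l', l' != linv l &
      match l.2, l'.2 with
      | true, true => ~~ zero_rel l'.1 l.1
      | false, false => ~~ zero_rel l.1 l'.1
      | _, _ => true
      end].

Definition is_string (C : walk) : bool :=
  if C.2 is l :: w then (lsrc l == C.1) && path string_step l w else true.

Record string := String { string_walk :> walk; stringP : is_string string_walk }.

(* The string module: the i-th row of the matrix describes the image of the   *)
(* basis vector z_i, and l_{i+1} is the entry of C.2 at position i.           *)
Definition string_act (C : walk) (g : vertex Q + arrow Q) : 'M[k]_(wdim C) :=
  match g with
  | inl x => \matrix_(i, j) ((i == j) && (nth C.1 (wverts C) i == x))%:R
  | inr a => \matrix_(i, j)
      (((j == i.+1 :> nat) && (onth C.2 i == Some (a, true))) ||
       ((i == j.+1 :> nat) && (onth C.2 j == Some (a, false))))%:R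
  end.

Lemma string_step_inv l l' : string_step (linv l') (linv l) = string_step l l'.
Proof.
case: l => a b; case: l' => a' b'; rewrite /string_step /linv /ltgt /lsrc /=.
rewrite eq_sym; congr [&& _, _ & _]; [by case: b; case: b'| |by case: b; case: b'].
by rewrite -!pair_eqE /= /pair_eq /= (eq_sym a); case: b; case: b'.
Qed.

Lemma ltgt_inv l : ltgt (linv l) = lsrc l.
Proof. by rewrite /ltgt /lsrc /=; case: l.2. Qed.

Lemma lsrc_inv l : lsrc (linv l) = ltgt l.
Proof. by rewrite /ltgt /lsrc /=; case: l.2. Qed.

Lemma is_stringE (C : walk) : is_string C =
  (if C.2 is l :: _ then lsrc l == C.1 else true) && sorted string_step C.2.
Proof. by case: C => x [|l w]. Qed.

Lemma winv_string (C : walk) : is_string C -> is_string (winv C).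
Proof.
case: C => x w; rewrite !is_stringE /wend => /andP[_ hC]; apply/andP; split=> /=.
  case/lastP: w {hC} => // s l.
  by rewrite /winv /wend /= !map_rcons rev_rcons lsrc_inv last_rcons.
rewrite rev_sorted sorted_map; apply: sub_sorted hC => l l' /=.
by rewrite string_step_inv.
Qed.

Lemma string_stepP (C : walk) i l l' : is_string C ->
  onth C.2 i = Some l -> onth C.2 i.+1 = Some l' -> string_step l l'.
Proof.
rewrite is_stringE => /andP[_]; elim: C.2 i => [|m w IH] [|i] //=.
  by case: w {IH} => [|m' w] //= /andP[? _] [<-] [<-].
by move/path_sorted/IH; apply.
Qed.

Lemma string_verts (C : walk) i l : is_string C -> onth C.2 i = Some l ->
  nth C.1 (wverts C) i = lsrc l /\ nth C.1 (wverts C) i.+1 = ltgt l.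
Proof.
case: C => x w; rewrite is_stringE /wverts /= => /andP[].
have [d ->] : exists d, nth x = nth d by exists x.
elim: w x i => [|m w IH] x [|i] //=; first by move=> /eqP <- _ [->].
move=> _ h; apply: IH; last exact: path_sorted h.
by case: w h => //= m' w /andP[/and3P[/eqP->]].
Qed.

Lemma string_act_module (C : walk) : is_string C -> is_module (string_act C).
Proof.
move=> hC.
have El x (B : 'M_(wdim C)) i j : (string_act C (inl x) *m B) i j =
    (nth C.1 (wverts C) i == x)%:R * B i j.
  rewrite mxE (bigD1 i) //= big1 ?addr0 => [|l hl]; rewrite !mxE ?eqxx //.
  by rewrite eq_sym (negPf hl) mul0r.
have Er x (B : 'M_(wdim C)) i j : (B *m string_act C (inl x)) i j =
    B i j * (nth C.1 (wverts C) j == x)%:R.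
  rewrite mxE (bigD1 j) //= big1 ?addr0 => [|l hl]; rewrite !mxE ?eqxx //.
  by rewrite (negPf hl) mulr0.
apply/is_moduleP; split=> [|x y|a|a|a b hab]; apply/matrixP=> i j.
- rewrite summxE (bigD1 (nth C.1 (wverts C) i)) //= big1 ?addr0 => [|x hx].
    by rewrite !mxE eqxx andbT.
  by rewrite !mxE [_ == x]eq_sym (negPf hx) andbF.
- rewrite El mxE; case: (eqVneq i j) => [<-|hij] /=; last first.
    by rewrite mulr0; case: eqP => _; rewrite mxE // (negPf hij).
  case: (eqVneq x y) => [->|hxy]; first by rewrite mxE eqxx /= -natrM mulnb andbb.
  rewrite mxE -natrM mulnb; case: eqP => // ->; rewrite (negPf hxy) //.
- rewrite El !mxE.
  case: andP => [[_ /eqP h]|_] /=.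
    by have [-> _] := string_verts hC h; rewrite eqxx mul1r.
  case: andP => [[/eqP -> /eqP h]|_]; last by rewrite mulr0.
  by have [_ ->] := string_verts hC h; rewrite eqxx mul1r.
- rewrite Er !mxE.
  case: andP => [[/eqP -> /eqP h]|_].
    by have [_ ->] := string_verts hC h; rewrite eqxx mulr1.
  case: andP => [[_ /eqP h]|_]; last by rewrite mul0r.
  by have [-> _] := string_verts hC h; rewrite eqxx mulr1.
rewrite [RHS]mxE mxE; apply: big1 => l _; rewrite !mxE -natrM mulnb.
have F (c : bool) : ~ c -> c%:R = 0 :> k by case: c => // /(_ isT).
apply: F => /andP[/orP[] /andP[/eqP hl /eqP h]] /orP[] /andP[/eqP hj /eqP h'].
- rewrite hl in h'; have /and3P[_ _] := string_stepP hC h h'.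
  by rewrite /= hab.
- by move: hj h'; rewrite hl => -[<-]; rewrite h.
- by rewrite h in h'.
- rewrite hj in h; have /and3P[_ _] := string_stepP hC h' h.
  by rewrite /= hab.
Qed.

Definition smod (C : string) : amod k Q :=
  AMod (string_act_module (stringP C)).

Definition lazy (x : vertex Q) : walk := (x, [::]).

(* The walk FD: first D, then F.                                              *)
Definition wcat (F D : walk) : walk := (D.1, D.2 ++ F.2).

Definition orient (o : bool) (C : walk) : walk := if o then winv C else C.

(* The isomorphism M(C) -> M(orient o C), or the other way round, where m = n *)
(* is the dimension.                                                          *)
Definition orient_mx (o : bool) m n : 'M[k]_(m, n) :=
  \matrix_(i, j) (if o then (i + j == n.-1)%N else i == j :> nat)%:R.

(* A factorization (F, E, D) of a walk FED.                                   *)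
Record factorization := Fact { fF : walk; fE : walk; fD : walk }.

(* The factorization of C with D of length a and ED of length b.              *)
Definition fact_at (C : walk) (a b : nat) : factorization :=
  Fact (nth C.1 (wverts C) b, drop b C.2)
       (nth C.1 (wverts C) a, drop a (take b C.2))
       (C.1, take a C.2).

Definition fact_orient (o : bool) (f : factorization) : factorization :=
  if o then Fact (winv (fD f)) (winv (fE f)) (winv (fF f)) else f.

(* C is lazy, or its first (resp. last) letter has type d.                    *)
Definition first_letter (d : bool) (C : walk) : bool :=
  if C.2 is l :: _ then l.2 == d else true.
Definition last_letter (d : bool) (C : walk) : bool :=
  if rev C.2 is l :: _ then l.2 == d else true.

Definition quotient_fact (f : factorization) : bool :=
  last_letter false (fD f) && first_letter true (fF f).
Definition submodule_fact (f : factorization) : bool :=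
  last_letter true (fD f) && first_letter false (fF f).

(* The map M(C) -> M(C') through the common middle term of the factorizations *)
(* f of C and f' of C'.                                                       *)
Definition graph_map (C C' : walk) (f f' : factorization) :
    'M[k]_(wdim C, wdim C') :=
  let d := size (wletters (fD f)) in
  let d' := size (wletters (fD f')) in
  let e := size (wletters (fE f)) in
  \matrix_(i, j) [&& d <= i, i <= d + e & i + d' == j + d]%N%:R.

Variables X Y : string.

(* T = (a, oX, oY) is an occurrence of a connecting arrow: a joins the end of *)
(* X (its start if oX) to the start of Y (its end if oY).  The two ends of a  *)
(* lazy string are the same, hence counted once.                              *)
Definition conn_walk (T : arrow Q * bool * bool) : walk :=
  wcat (orient T.2 Y) (wcat (tgt T.1.1, [:: (T.1.1, false)]) (orient T.1.2 X)).

Definition is_connecting (T : arrow Q * bool * bool) : bool :=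
  [&& wend (orient T.1.2 X) == tgt T.1.1, src T.1.1 == wstart (orient T.2 Y),
      is_string (conn_walk T),
      (size (wletters X) == 0) ==> ~~ T.1.2 & (size (wletters Y) == 0) ==> ~~ T.2].

Definition connecting := {T | is_connecting T}.

Lemma conn_string (T : connecting) : is_string (conn_walk (sval T)).
Proof. by have /and5P[] := valP T. Qed.

Definition conn_seq (T : connecting) : sequence (smod Y) (smod X) :=
  let: (a, oX, oY) := sval T in
  let X' := orient oX X in
  let Y' := orient oY Y in
  let C := conn_walk (sval T) in
  let aX := wcat (tgt a, [:: (a, false)]) X' in
  let Ya := wcat Y' (tgt a, [:: (a, false)]) in
  @Sequence k Q (smod Y) (smod X) (smod (String (conn_string T)))
    (orient_mx oX (wdim X) (wdim X') *m
     graph_map X' C (Fact (lazy (wend X')) X' (lazy (wstart X')))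
                    (Fact Ya X' (lazy (wstart X'))))
    (graph_map C Y' (Fact (lazy (wend Y')) Y' aX)
                    (Fact (lazy (wend Y')) Y' (lazy (wstart Y'))) *m
     orient_mx oY (wdim Y') (wdim Y)).

(* The positions in X and in Y of a pair of factorizations.                   *)
Definition fact_pair :=
  (('I_(wdim X) * 'I_(wdim X)) * ('I_(wdim Y) * 'I_(wdim Y)))%type.

Definition factX (T : fact_pair) : factorization := fact_at X T.1.1 T.1.2.
Definition factY (T : fact_pair) (o : bool) : factorization :=
  fact_orient o (fact_at Y T.2.1 T.2.2).

(* T is an admissible pair, where Y is replaced by its inverse if o.          *)
Definition admissible (T : fact_pair) (o : bool) : bool :=
  [&& T.1.1 <= T.1.2, T.2.1 <= T.2.2, quotient_fact (factX T),
      submodule_fact (factY T o) & fE (factX T) == fE (factY T o)]%N.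

(* F1 E D2 and F2 E D1.                                                       *)
Definition mid1 (T : fact_pair) (o : bool) : walk :=
  wcat (fF (factX T)) (wcat (fE (factX T)) (fD (factY T o))).
Definition mid2 (T : fact_pair) (o : bool) : walk :=
  wcat (fF (factY T o)) (wcat (fE (factX T)) (fD (factX T))).

(* If E has positive length, F1 E D2 and F2 E D1 are strings automatically,   *)
(* see [mid_string] below.                                                    *)
Definition two_sided_at (T : fact_pair) (o : bool) : bool :=
  [&& admissible T o,
      (size (wletters (fE (factX T))) == 0) ==>
        is_string (mid1 T o) && is_string (mid2 T o),
      (0 < size (wletters (fD (factX T)))) || (0 < size (wletters (fD (factY T o)))) &
      (0 < size (wletters (fF (factX T)))) || (0 < size (wletters (fF (factY T o))))]%N.

Definition two_sided := {T : fact_pair | [exists o, two_sided_at T o]}.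

(* A two-sided pair with an orientation of Y as required.  The orientation is *)
(* not always unique, and reversing it changes the sign of the extension.     *)
Definition oriented := {To : fact_pair * bool | two_sided_at To.1 To.2}.

Lemma last_nth_drop (V : Type) (x d : V) (v : seq V) b : (b <= size v)%N ->
  last (nth d (x :: v) b) (drop b v) = last x v.
Proof. by elim: v x b => [|y v IH] x [|b] //= hb; apply: IH. Qed.

Lemma fact_cat (C : walk) a b o : (a <= b)%N -> (b < wdim C)%N ->
  let f := fact_orient o (fact_at C a b) in
  orient o C = wcat (fF f) (wcat (fE f) (fD f)).
Proof.
case: C => x w hab hb.
have E : w = take a w ++ drop a (take b w) ++ drop b w.
  by rewrite catA -(take_takel w hab) cat_take_drop cat_take_drop.
case: o => /=; last by rewrite /wcat /= -catA -E.
rewrite /wcat /winv /wend /= -!rev_cat -!map_cat -E; congr pair.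
by rewrite map_drop last_nth_drop // size_map.
Qed.

Lemma string_glue x y (c c' e b b' : seq letter) : (0 < size e)%N ->
  is_string (x, c ++ e ++ b') -> is_string (y, c' ++ e ++ b) ->
  is_string (x, c ++ e ++ b).
Proof.
case: e => // l e _; rewrite !is_stringE /=.
case: c => [|m c] /= /andP[-> h].
  by case: c' => [|m' c'] /= /andP[_] //; rewrite cat_path /= => /and3P[_ _ ->].
move: h; rewrite cat_path /= => /and3P[h1 h2 _]; rewrite /= cat_path /= h1 h2 /=.
by case: c' => [|m' c'] /= /andP[_] //; rewrite cat_path /= => /and3P[].
Qed.

Lemma mid_string T o :
  two_sided_at T o -> is_string (mid1 T o) && is_string (mid2 T o).
Proof.
case/and4P=> /and5P[hX hY _ _ /eqP hE] h _ _.
have [h0|] := eqVneq (size (wletters (fE (factX T)))) 0.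
  by apply: (implyP h); rewrite h0.
rewrite -lt0n => hpos.
have EX : X = wcat (fF (factX T)) (wcat (fE (factX T)) (fD (factX T))) :> walk.
  exact: (@fact_cat X _ _ false).
have EY : orient o Y = wcat (fF (factY T o)) (wcat (fE (factX T)) (fD (factY T o))).
  by rewrite hE; apply: fact_cat.
have sX := stringP X; have sY : is_string (orient o Y).
  by case: o {h hE EY} => /=; [apply: winv_string|]; apply: stringP.
rewrite EX /wcat /= -catA in sX; rewrite EY /wcat /= -catA in sY.
by rewrite /mid1 /mid2 /wcat /= -!catA (string_glue _ sY sX) ?(string_glue _ sX sY).
Qed.

Lemma mid1_string (T : oriented) : is_string (mid1 (sval T).1 (sval T).2).
Proof. by have /mid_string/andP[] := valP T. Qed.

Lemma mid2_string (T : oriented) : is_string (mid2 (sval T).1 (sval T).2).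
Proof. by have /mid_string/andP[] := valP T. Qed.

Definition two_sided_seq (T : oriented) : sequence (smod Y) (smod X) :=
  let o := (sval T).2 in
  let Y' := orient o Y in
  let C1 := mid1 (sval T).1 o in
  let C2 := mid2 (sval T).1 o in
  let: Fact F1 E D1 := factX (sval T).1 in
  let: Fact F2 _ D2 := factY (sval T).1 o in
  @Sequence k Q (smod Y) (smod X)
    (dsum (smod (String (mid1_string T))) (smod (String (mid2_string T))))
    (row_mx
      (graph_map X C1 (Fact (lazy (wend X)) (wcat F1 E) D1)
                      (Fact (lazy (wend X)) (wcat F1 E) D2))
      (graph_map X C2 (Fact F1 (wcat E D1) (lazy (wstart X)))
                      (Fact F2 (wcat E D1) (lazy (wstart X)))))
    (col_mx
      (graph_map C1 Y' (Fact F1 (wcat E D2) (lazy (wstart Y')))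
                       (Fact F2 (wcat E D2) (lazy (wstart Y'))))
      (- graph_map C2 Y' (Fact (lazy (wend Y')) (wcat F2 E) D1)
                         (Fact (lazy (wend Y')) (wcat F2 E) D2)) *m
     orient_mx o (wdim Y') (wdim Y)).

End Strings.

(* Main.v *)
Require Import Defs.
From HB Require Import structures.
From mathcomp Require Import all_boot all_order all_algebra generic_quotient.
From mathcomp Require Import zify.
From mathcomp Require boolp.

Set Implicit Arguments.
Unset Strict Implicit.
Unset Printing Implicit Defensive.

Import GRing.Theory.
Local Open Scope ring_scope.

(** Why the theorem holds.  An extension of M(Y) by M(X) is recorded by a
    cocycle D, which may be normalized to vanish on the idempotents.  What is
    left is a matrix D(a) for every arrow a; its entries are indexed by
    triples (u, a, w) with u a position of Y at the source of a and w a
    position of X at the target of a.  The cocycle condition says that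
    D(b) X(c) + Y(b) D(c) = 0 for every generator cb of I, and coboundaries are
    the h X(a) - Y(a) h for matrices h whose rows are the positions of Y and
    whose columns are those of X.

    Take for h the matrix unit at a pair (i, j) of positions at the same
    vertex.  Its coboundary has at most four entries: one for each neighbour
    of j to which an arrow maps the basis vector z_j of X, and, with the
    opposite sign, one for each neighbour of i from which an arrow maps to the
    basis vector z_i of Y.  Match a side of i with a side of j: the coboundary
    is the sum of two [corner]s, one for each pair of matched sides.  If X and
    Y continue by the same letter on matched sides, the corner cancels against
    the opposite corner of the neighbouring pair.  Hence the coboundary of the
    partial bijection h along a common substring E of X and Y is the sum of
    just two corners, at the two ends of E ([shift_boundary]).  The same
    identity shows that graph maps are homomorphisms and computes the cocycles
    of the given extensions: the class of a two-sided pair is the corner at the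
    right end of E ([two_sided_exact]), that of a connecting arrow a is a single
    matrix unit in D(a) ([connecting_exact]).

    The classes generate ([in_span_all]).  Let (u, a, w) be a nonzero entry of
    a normalized cocycle.  By the gentle conditions and the cocycle condition,
    either it is isolated, and then a connects an end of X to an end of Y, or
    it belongs to a corner that lies in D up to a scalar and whose sides can be
    matched coherently.  Extend such a corner to a maximal common substring E.
    Modulo coboundaries the corner is, up to sign, the corner at either end of
    E.  If one of these vanishes, so does the class; otherwise E is the middle
    term of a two-sided pair ([corner_in_span]).  Subtracting the cocycle that
    was found makes the support of D smaller.

    The classes are independent ([basis_cochains_free]).  Suppose that a
    combination of the cocycles is the coboundary of h.  Let E be the middle
    term of a two-sided pair.  None of the cocycles has an entry at the left
    corner of E or between two consecutive positions of E, so h vanishes at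
    the left end of E and is constant along E ([walk_along]).  Therefore h
    vanishes at the right end too; but at the right corner the coboundary is
    the value of h there, up to sign, while the pair in question is the only
    one that contributes.  The entry of a connecting arrow is seen by no
    coboundary and by no other of the cocycles. *)

(** * Classes of extensions and their cocycles *)

Section ExtCocycles.

Variables (k : fieldType) (Q : bound_quiver) (N M : amod k Q).

Notation gen := (vertex Q + arrow Q)%type.
Notation cochain := (gen -> 'M[k]_(Defs.dim N, Defs.dim M)).

Definition represents (v : Ext1 N M) (D : cochain) :=
  cobound (fun g => cocycle (repr v) g - D g).

Lemma represents_trans v (D D' : cochain) :
  represents v D -> cobound (fun g => D g - D' g) -> represents v D'.
Proof.
by move=> h h'; apply: cobound_ext (coboundD h h') => g; rewrite addrA subrK.
Qed.

Lemma eq_represents v (D D' : cochain) : D =1 D' -> represents v D -> represents v D'.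
Proof. by move=> E; apply: cobound_ext => g; rewrite E. Qed.

Lemma represents_repr v : represents v (cocycle (repr v)).
Proof. by apply: cobound_ext (cobound0 N M) => g; rewrite subrr. Qed.

Lemma represents_class (e : extension N M) (D : cochain) :
  cobound (fun g => cocycle e g - D g) -> represents (ext_class e) D.
Proof.
move=> h; apply: represents_trans h.
by apply/ext_equivP/ext_classP; rewrite /ext_class reprK.
Qed.

Lemma represents_inj v w (D : cochain) : represents v D -> represents w D -> v = w.
Proof.
move=> hv hw; rewrite -[v]reprK -[w]reprK; apply/eqP/ext_classP/ext_equivP.
apply: cobound_ext (coboundD hv (coboundN hw)) => g.
by rewrite opprB addrA subrK.
Qed.

Lemma represents_cobound v (D D' : cochain) :
  represents v D -> represents v D' -> cobound (fun g => D g - D' g).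
Proof.
move=> h h'; apply: cobound_ext (coboundD (coboundN h) h') => g.
by rewrite opprB addrA subrK.
Qed.

Lemma represents0 (D : cochain) : cobound D -> represents 0 D.
Proof.
move=> h; apply: (@represents_class (ext_split N M)).
exact: coboundD (cocycle_split N M) (coboundN h).
Qed.

Lemma representsD v w (D D' : cochain) :
  represents v D -> represents w D' -> represents (v + w) (fun g => D g + D' g).
Proof.
move=> hv hw; rewrite -[v]reprK -[w]reprK -!/(ext_class _) -ext_classD.
apply: represents_class; apply: cobound_ext
  (coboundD (cocycle_baer (repr v) (repr w)) (coboundD hv hw)) => g.
by rewrite [X in _ + X = _]addrACA -opprD addrA subrK.
Qed.

Lemma representsZ c v (D : cochain) :
  represents v D -> represents (c *: v) (fun g => c *: D g).
Proof.
move=> hv; rewrite -[v]reprK -!/(ext_class _) -ext_classZ.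
apply: represents_class; apply: cobound_ext
  (coboundD (cocycle_scale c (repr v)) (coboundZ c hv)) => g.
by rewrite scalerBr addrA subrK.
Qed.

Lemma represents_sum (I : finType) (b : I -> Ext1 N M) (D : I -> cochain)
    (c : I -> k) :
  (forall i, represents (b i) (D i)) ->
  represents (\sum_i c i *: b i) (fun g => \sum_i c i *: D i g).
Proof.
move=> h; rewrite /index_enum; elim: (Finite.enum I) => [|i s IH].
  rewrite big_nil; apply: represents0; apply: cobound_ext (cobound0 N M) => g.
  by rewrite big_nil.
rewrite big_cons; apply: eq_represents (representsD (representsZ (c i) (h i)) IH).
by move=> g; rewrite big_cons.
Qed.

(** Independence is a statement about cocycles modulo coboundaries, so it may be
    checked on any representatives of the classes. *)
Lemma basis_of_cocycles (I : finType) (b : I -> Ext1 N M) (D : I -> cochain) :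
  (forall i, represents (b i) (D i)) ->
  (forall c : I -> k, cobound (fun g => \sum_i c i *: D i g) -> forall i, c i = 0) ->
  (forall v, exists c : {ffun I -> k}, v = \sum_i c i *: b i) ->
  is_basis b.
Proof.
move=> hD hfree hgen v; have [c hc] := hgen v; exists c; split=> // c' hc'.
apply/ffunP=> i; apply/eqP; rewrite -subr_eq0; apply/eqP.
apply: (hfree (fun i => c i - c' i)).
have := represents_sum c hD; rewrite -hc => h1.
have := represents_sum c' hD; rewrite -hc' => h2.
apply: cobound_ext (represents_cobound h1 h2) => g.
by rewrite -sumrB; apply: eq_bigr => j _; rewrite scalerBl.
Qed.

(** Adding to a cocycle the coboundary of h amounts to moving the chosen
    section by h, so every representative of a class is the cocycle of some
    extension with respect to some splitting. *)
Lemma represents_section v (D : cochain) : represents v D ->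
  exists (e : extension N M) s r, [/\ forall g, D g = s *m act (mid e) g *m r,
    r *m inc e + prj e *m s = 1%:M, s *m prj e = 1%:M, inc e *m r = 1%:M &
    s *m r = 0].
Proof.
case=> h hD; exists (repr v).
exists (sect (repr v) - h *m inc (repr v)), (retr (repr v) + prj (repr v) *m h).
move: (repr v) hD => e hD; split=> [g||||].
- have -> : D g = cocycle e g - (h *m act M g - act N g *m h) by rewrite -hD subKr.
  rewrite /cocycle mulmxDr !mulmxBl.
  have -> : h *m inc e *m act (mid e) g *m retr e = h *m act M g.
    by rewrite -(mulmxA h) -inc_act -!mulmxA inc_retr mulmx1.
  have -> : sect e *m act (mid e) g *m (prj e *m h) = act N g *m h.
    by rewrite mulmxA -(mulmxA _ _ (prj e)) prj_act mulmxA sect_prj mul1mx.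
  have -> : h *m inc e *m act (mid e) g *m (prj e *m h) = 0.
    by rewrite mulmxA -(mulmxA _ _ (prj e)) prj_act mulmxA -(mulmxA h) inc_prj mulmx0 !mul0mx.
  by rewrite subr0 opprD opprK addrA.
- rewrite mulmxDl mulmxBr -(splitting e) !mulmxA.
  by rewrite addrACA subrr addr0.
- by rewrite mulmxBl sect_prj -mulmxA inc_prj mulmx0 subr0.
- by rewrite mulmxDr inc_retr mulmxA inc_prj mul0mx addr0.
- rewrite mulmxDr !mulmxBl sect_retr mulmxA sect_prj mul1mx -mulmxA inc_retr.
  by rewrite -(mulmxA h) (mulmxA (inc e)) inc_prj mul0mx mulmx0 mulmx1 subr0 sub0r addNr.
Qed.

Lemma represents_mul v (D : cochain) : represents v D ->
  exists (e : extension N M) s r, [/\ forall g, D g = s *m act (mid e) g *m r,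
     s *m r = 0 &
     forall g g', s *m (act (mid e) g *m act (mid e) g') *m r =
       D g *m act M g' + act N g *m D g'].
Proof.
case/represents_section=> e [s [r [hD h1 h2 h3 h4]]]; exists e, s, r; split=> // g g'.
rewrite -(mul1mx (act _ g')) -h1 mulmxDl mulmxDr mulmxDr mulmxDl; congr (_ + _).
  by rewrite hD -!mulmxA (mulmxA (inc e)) -inc_act -(mulmxA (act M g')) h3 mulmx1.
rewrite hD !mulmxA -(mulmxA _ _ (prj e)) prj_act !mulmxA h2 mul1mx.
by [].
Qed.

(** The idempotents span a separable subalgebra, so its cocycles are
    coboundaries.  On the idempotents D is the coboundary of the sum over the
    vertices y of D(e_y) followed by e_y. *)
Lemma normalized_cocycle v :
  exists2 D, represents v D & forall x, D (inl x) = 0.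
Proof.
have [e [s [r [hD hsr hmul]]]] := represents_mul (represents_repr v).
have /is_moduleP[m1 m2 _ _ _] := actP M.
have /is_moduleP[_ e2 _ _ _] := actP (mid e).
set D := cocycle (repr v) in hD hmul.
pose h := \sum_y D (inl y) *m act M (inl y).
exists (fun g => D g - (h *m act M g - act N g *m h)).
  apply: represents_trans (represents_repr v) _; exists h => g.
  by rewrite subKr.
have E x y : D (inl x) *m act M (inl y) + act N (inl x) *m D (inl y) =
   if x == y then D (inl x) else 0.
  by rewrite -hmul e2; case: eqP => _; rewrite ?mulmx0 ?mul0mx // hD.
move=> x.
have -> : h *m act M (inl x) = D (inl x) *m act M (inl x).
  rewrite mulmx_suml (bigD1 x) //= big1 ?addr0 => [|y hy].
    by rewrite -mulmxA m2 eqxx.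
  by rewrite -mulmxA m2 (negPf hy) mulmx0.
have -> : act N (inl x) *m h = D (inl x) *m act M (inl x) - D (inl x).
  rewrite mulmx_sumr.
  have F y : act N (inl x) *m (D (inl y) *m act M (inl y)) =
     (if x == y then D (inl x) *m act M (inl x) else 0) - D (inl x) *m act M (inl y).
    rewrite mulmxA; have /(canRL (addKr _)) -> := E x y.
    rewrite mulmxDl mulNmx -mulmxA m2 eqxx addrC; congr (_ - _).
    by case: eqP => [->|_] //; rewrite mul0mx.
  rewrite (eq_bigr _ (fun y _ => F y)) sumrB -mulmx_sumr m1 mulmx1; congr (_ - _).
  rewrite (bigD1 x) //= eqxx big1 ?addr0 // => y.
  by rewrite eq_sym => /negPf ->.
by rewrite subKr subrr.
Qed.

Lemma normalized_cocycleP v (D : cochain) :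
  represents v D -> (forall x, D (inl x) = 0) ->
  [/\ forall a, act N (inl (src a)) *m D (inr a) = D (inr a),
      forall a, D (inr a) *m act M (inl (tgt a)) = D (inr a) &
      forall a b, zero_rel a b ->
        D (inr b) *m act M (inr a) + act N (inr b) *m D (inr a) = 0].
Proof.
move=> /represents_mul[e [s [r [hD _ hmul]]]] h0.
have /is_moduleP[_ _ e3 e4 e5] := actP (mid e); split=> [a|a|a b hab].
- by have := hmul (inl (src a)) (inr a); rewrite h0 mul0mx add0r e3 -hD.
- by have := hmul (inr a) (inl (tgt a)); rewrite h0 mulmx0 addr0 e4 -hD.
- by have := hmul (inr b) (inr a); rewrite e5 // mulmx0 mul0mx.
Qed.

(** A sequence is recognized as exact, and its class is computed, from a
    section [S] of the projection, a retraction [r] of the inclusion and the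
    defect [D] of [S] to be a homomorphism. *)
Lemma section_exact (s : sequence N M) S r (D : cochain) :
  is_hom (inc s) -> S *m prj s = 1%:M -> inc s *m r = 1%:M -> inc s *m prj s = 0 ->
  prj s *m S + r *m inc s = 1%:M ->
  (forall g, S *m act (mid s) g = act N g *m S + D g *m inc s) ->
  short_exact s.
Proof.
move=> /homP hi hS hr h0 h1 hD; apply/short_exactP; split=> // [g||m v hv].
- have -> : act (mid s) g *m prj s =
      (prj s *m S + r *m inc s) *m act (mid s) g *m prj s by rewrite h1 mul1mx.
  rewrite 2!mulmxDl -(mulmxA (prj s)) hD -(mulmxA r) -hi.
  rewrite -(mulmxA (prj s)) mulmxDl -(mulmxA _ S) hS -(mulmxA _ (inc s)) h0.
  by rewrite mulmx0 addr0 mulmx1 -!(mulmxA r) -(mulmxA _ (inc s)) h0 !mulmx0 addr0.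
- by apply/andP; split; [apply/row_freeP; exists r|apply/row_fullP; exists S].
- apply/submxP; exists (v *m r).
  by rewrite -{1}[v]mulmx1 -h1 mulmxDr mulmxA hv mul0mx add0r mulmxA.
Qed.

(** Every section, not only the chosen one, computes the class: two sections of
    the projection differ by a map into the kernel, whose coboundary is the
    difference of the defects. *)
Lemma section_cocycle (e : extension N M) S (D : cochain) :
  S *m prj e = 1%:M ->
  (forall g, S *m act (mid e) g = act N g *m S + D g *m inc e) ->
  represents (ext_class e) D.
Proof.
move=> hS hD; apply: represents_class.
have hSr : S = sect e + (S *m retr e) *m inc e.
  rewrite -{1}[S]mulmx1 -(splitting e) mulmxDr !mulmxA hS mul1mx addrC //.
exists (- (S *m retr e)) => g; rewrite mulNmx mulmxN opprK.
have : S *m act (mid e) g *m retr e = act N g *m (S *m retr e) + D g.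
  by rewrite hD mulmxDl -!mulmxA inc_retr mulmx1.
rewrite {1}hSr !mulmxDl -/(cocycle e g) -(mulmxA _ (inc e)) -inc_act -!mulmxA inc_retr mulmx1 !mulmxA.
move: (cocycle e g) (S *m _ *m _) (act N g *m _ *m _) => A B C /(canRL (addrK _)) ->.
by rewrite addrAC addrK addrC.
Qed.

End ExtCocycles.

(** * Letters leaving a position of a string *)

Section Letters.

Variable Q : bound_quiver.
Implicit Types (C : walk Q) (l : letter Q) (s o : bool) (i j : nat).

Local Open Scope nat_scope.

Definition vertex_at C i : vertex Q := nth C.1 (wverts C) i.

(** The two sides of a position are treated alike: [s] is [true] for the side of
    the end of the walk, and on the other side the letter is inverted, so that
    it too points away from the position. *)
Definition leave C s i : option (letter Q) :=
  if s then onth C.2 i else if i is i'.+1 then omap (@linv Q) (onth C.2 i') else None.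

Definition move s i := if s then i.+1 else i.-1.

(** For two letters leaving a vertex: a string may enter by the inverse of [l] and
    go on by [l'].  In this form the condition is symmetric. *)
Definition compat l l' := string_step (linv l) l'.

Lemma linvK : involutive (@linv Q).
Proof. by case=> a b; rewrite /linv /= negbK. Qed.

Lemma compatC l l' : compat l l' = compat l' l.
Proof. by rewrite /compat -{2}(linvK l) string_step_inv. Qed.

Lemma compatxx l : compat l l = false.
Proof. by rewrite /compat /string_step linvK eqxx andbF. Qed.

Lemma onth_rev (T : Type) (w : seq T) i :
  onth (rev w) i = if i < size w then onth w (size w - i.+1) else None.
Proof.
rewrite !onthE map_rev; case: ltnP => hi; last first.
  by rewrite nth_default // size_rev size_map.
by rewrite nth_rev size_map.
Qed.

Lemma leaveF_le C i l : leave C false i = Some l -> 0 < i <= size C.2.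
Proof. by case: i => //= i; move: (onthTE C.2 i); case: (onth C.2 i). Qed.

Lemma leaveT_lt C i l : leave C true i = Some l -> i < size C.2.
Proof. by rewrite /= -onthTE => ->. Qed.

Lemma leave_range C s i l : leave C s i = Some l -> i < wdim C /\ move s i < wdim C.
Proof.
by case: s => [/leaveT_lt|/leaveF_le]; rewrite /wdim /=; lia.
Qed.

Lemma leaveT_None C i : leave C true i = None <-> size C.2 <= i.
Proof. by rewrite -onthNE /=; case: onth. Qed.

Lemma leaveF_None C i : i <= size C.2 -> leave C false i = None <-> i = 0.
Proof. by case: i => //= i; rewrite -onthTE; case: onth. Qed.

Lemma move_neq C s i l : leave C s i = Some l -> move s i <> i.
Proof. by case: s => /= [_|]; [lia|case: i => //= i _; lia]. Qed.

Lemma moveK C s i l : leave C s i = Some l -> move (~~ s) (move s i) = i.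
Proof. by case: s => //=; case: i. Qed.

Lemma leave_back C s i l : leave C s i = Some l ->
  leave C (~~ s) (move s i) = Some (linv l).
Proof.
case: s => /=; first by move=> ->.
by case: i => //= i; case: onth => //= l' [<-]; rewrite linvK.
Qed.

Lemma leave_verts C s i l : is_string C -> leave C s i = Some l ->
  vertex_at C i = lsrc l /\ vertex_at C (move s i) = ltgt l.
Proof.
move=> hC; case: s => /=; first exact: string_verts.
case: i => //= i; case E: onth => [l'|] //= [<-].
by rewrite lsrc_inv ltgt_inv; have [] := string_verts hC E.
Qed.

Lemma leave_compat C s i l l' : is_string C ->
  leave C s i = Some l -> leave C (~~ s) i = Some l' -> compat l l'.
Proof.
move=> hC; wlog -> : s l l' / s = false.
  move=> h; case: s; last exact: h.
  by move=> h1 h2; rewrite compatC; apply: (h false).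
case: i => //= i; case E: onth => [m|] //= [<-] h.
by rewrite /compat linvK; apply: string_stepP E h.
Qed.

(** No letter is followed by its inverse, so the letters on the two sides of a
    position are distinct. *)
Lemma leave_uniq C s s' i l : is_string C ->
  leave C s i = Some l -> leave C s' i = Some l -> s = s'.
Proof.
move=> hC h h'; apply/eqP; apply/negP=> /negP; rewrite eq_sym => /eqP hs.
have es : s' = ~~ s by case: s s' hs {h h'} => [] [].
by rewrite es in h'; have := leave_compat hC h h'; rewrite compatxx.
Qed.

Lemma size_winv C : size (winv C).2 = size C.2.
Proof. by rewrite size_rev size_map. Qed.

Lemma size_orient o C : size (orient o C).2 = size C.2.
Proof. by case: o => //; apply: size_winv. Qed.

Lemma orient_string o C : is_string C -> is_string (orient o C).
Proof. by case: o => //; apply: winv_string. Qed.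

(** The place of position i after reversal, an involution. *)
Definition orient_pos o C i := if o then size C.2 - i else i.

Lemma leave_orient o C s i : i <= size C.2 ->
  leave (orient o C) s i = leave C (o (+) s) (orient_pos o C i).
Proof.
case: o => //= hi; case: s => /=.
  rewrite onth_rev size_map; case: ltnP => h.
    have -> : size C.2 - i = (size C.2 - i.+1).+1 by lia.
    by rewrite onth_map.
  by have -> : size C.2 - i = 0 by lia.
case: i hi => [|i] hi; first by rewrite onth_default // subn0.
rewrite onth_rev size_map hi onth_map.
by case: onth => //= l; rewrite linvK.
Qed.

Lemma vertex_orient o C i : is_string C -> i <= size C.2 ->
  vertex_at (orient o C) i = vertex_at C (orient_pos o C i).
Proof.
case: o => //= hC hi.
have hW := winv_string hC.
have [|h0] := posnP (size C.2).
  move=> h0; have -> : i = 0 by lia.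
  by case: (C) h0 => x [] //.
have [hi0|hi0] := ltnP i (size C.2).
  have : onth (winv C).2 i = leave C false (size C.2 - i).
    exact: (@leave_orient true C true i).
  case E: leave => [l|]; last first.
    by move/leaveF_None: E => /(_ (leq_subr _ _)); lia.
  by move=> /(@leave_verts _ true _ _ hW) [-> _]; have [<- _] := leave_verts hC E.
have -> : i = (size C.2).-1.+1 by lia.
have hi1 : (size C.2).-1 < size C.2 by lia.
have : onth (winv C).2 (size C.2).-1 = leave C false (size C.2 - (size C.2).-1).
  by apply: (@leave_orient true C true); lia.
case E: leave => [l|]; last first.
  by move/leaveF_None: E => /(_ (leq_subr _ _)); lia.
move=> /(@leave_verts _ true _ _ hW) [_ /= ->]; have [_ /= <-] := leave_verts hC E.
by congr vertex_at; lia.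
Qed.

(** The arrow [a] maps z_i to z_j in the string module of C. *)
Definition sends C (a : arrow Q) i j : bool :=
  ((j == i.+1) && (onth C.2 i == Some (a, true))) ||
  ((i == j.+1) && (onth C.2 j == Some (a, false))).

Lemma sendsP C a i j :
  reflect (exists2 s, leave C s i = Some (a, true) & j = move s i) (sends C a i j).
Proof.
apply: (iffP orP) => [[]/andP[/eqP-> /eqP h]|[[] h ->]].
- by exists true.
- by exists false => //=; rewrite h.
- by left; rewrite eqxx /=; apply/eqP.
- right; case: i h => //= i; case: onth => //= l [<-]; rewrite eqxx /=.
  by case: l => b [].
Qed.

Lemma sends_backP C a i j :
  reflect (exists2 s, leave C s j = Some (a, false) & i = move s j) (sends C a i j).
Proof.
apply: (iffP (sendsP _ _ _ _)) => -[s h ->]; exists (~~ s).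
- by rewrite (leave_back h).
- by rewrite (moveK h).
- by rewrite (leave_back h).
- by rewrite (moveK h).
Qed.

(** Together with [sends_inj]: arrows act on a string module by partial
    injections of its basis. *)
Lemma sends_fun C a i j j' : is_string C -> sends C a i j -> sends C a i j' -> j = j'.
Proof.
move=> hC /sendsP[s h ->] /sendsP[s' h' ->].
by rewrite (leave_uniq hC h h').
Qed.

Lemma sends_inj C a i i' j : is_string C -> sends C a i j -> sends C a i' j -> i = i'.
Proof.
move=> hC /sends_backP[s h ->] /sends_backP[s' h' ->].
by rewrite (leave_uniq hC h h').
Qed.

Lemma sends_range C a i j : sends C a i j -> i < wdim C /\ j < wdim C.
Proof. by case/sendsP=> s /leave_range[h1 h2] ->. Qed.

Lemma sends_verts C a i j : is_string C -> sends C a i j ->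
  vertex_at C i = src a /\ vertex_at C j = tgt a.
Proof. by move=> hC /sendsP[s h ->]; apply: (leave_verts hC h). Qed.

End Letters.

(** * Consecutive letters in a gentle algebra *)

Section Gentle.

Variables (Q : bound_quiver) (hQ : gentle Q).
Implicit Types (l : letter Q) (a b c : arrow Q).

Lemma card_le1 (T : finType) (P : pred T) x y :
  (#|[set z | P z]| <= 1)%N -> P x -> P y -> x = y.
Proof. by move=> /card_le1_eqP h hx hy; apply: h; rewrite inE. Qed.

Lemma card_le2 (T : finType) (P : pred T) x y z :
  (#|[set z | P z]| <= 2)%N -> P x -> P y -> P z -> x != z -> y != z -> x = y.
Proof.
move=> h hx hy hz hxz hyz; apply/eqP; apply: contraLR h => hxy.
rewrite -ltnNge; apply: (@leq_trans #|[set x; y; z]|).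
  by rewrite -setUA cardsU1 cards2 !inE negb_or hxy hxz hyz.
by apply: subset_leq_card; apply/subsetP=> t; rewrite !inE => /orP[/orP[]|] /eqP->.
Qed.

Lemma compat_dd a b : compat (a, true) (b, true) = (src a == src b) && (a != b).
Proof.
rewrite /compat /string_step /linv /ltgt /lsrc /= andbT; congr (_ && _).
by rewrite xpair_eqE andbT eq_sym.
Qed.

Lemma compat_ii a b : compat (a, false) (b, false) = (tgt a == tgt b) && (a != b).
Proof.
rewrite /compat /string_step /linv /ltgt /lsrc /= andbT; congr (_ && _).
by rewrite xpair_eqE andbT eq_sym.
Qed.

Lemma compat_id a b : compat (a, false) (b, true) = (src b == tgt a) && ~~ zero_rel b a.
Proof.
rewrite /compat /string_step /linv /ltgt /lsrc /= xpair_eqE andbF /=.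
by rewrite eq_sym.
Qed.

Lemma compat_di a b : compat (a, true) (b, false) = (src a == tgt b) && ~~ zero_rel a b.
Proof. by rewrite compatC compat_id. Qed.

Definition compatE := (compat_dd, compat_ii, compat_id, compat_di).

(** At most two arrows leave or enter a vertex, and an arrow has at most one
    continuation outside I on either side. *)
Lemma compat_same_type l l1 l2 : compat l l1 -> compat l l2 -> l1.2 = l2.2 -> l1 = l2.
Proof.
case: l l1 l2 => [a []] [b []] [c []] //=; rewrite !compatE => /andP[/eqP h1 h2] /andP[/eqP h3 h4] _;
  congr pair.
- by apply: (card_le2 (gentle_out2 hQ (src a)) (z := a)); rewrite 1?eq_sym //; apply/eqP.
- by apply: (card_le1 (gentle_before hQ a)); rewrite ?h2 ?h4 andbT; apply/eqP.
- by apply: (card_le1 (gentle_after hQ a)); rewrite ?h2 ?h4 andbT; apply/eqP.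
- by apply: (card_le2 (gentle_in2 hQ (tgt a)) (z := a)); rewrite 1?eq_sym //; apply/eqP.
Qed.

(** The letter l forms a product outside I with one of c and a.  That factor has
    no second such product, so ca lies in I. *)
Lemma compat_zero_rel l c a : compat l (c, true) -> compat l (a, false) -> zero_rel c a.
Proof.
case: l => [b []]; rewrite !compatE => /andP[/eqP h1 h2] /andP[/eqP h3 h4]; apply/negPn/negP=> h5.
- move/eqP: h2; apply; apply: (card_le1 (gentle_after hQ a)); first by rewrite h4 h3 eqxx.
  by rewrite h5 -h1 h3 eqxx.
- move/eqP: h4; apply; apply: (card_le1 (gentle_before hQ c)); first by rewrite h2 h1 eqxx.
  by rewrite h5 h1 h3 eqxx.
Qed.

(** A vertex has no three pairwise compatible letters: two of them would have the
    same type.  This is why a position of a string is an end when all letters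
    leaving it are compatible with some further letter. *)
Lemma compat_triangle l l1 l2 : compat l l1 -> compat l l2 -> compat l1 l2 -> False.
Proof.
move=> h1 h2 h; have [e|ne] := eqVneq l1.2 l2.2.
  by move: h; rewrite (compat_same_type h1 h2 e) compatxx.
case: l1 l2 ne h1 h2 h => [a []] [b []] //= _ h1 h2; rewrite compatE => /andP[_].
  by rewrite (compat_zero_rel h1 h2).
by rewrite (compat_zero_rel h2 h1).
Qed.

(** A product in I is the only one in I with the given factor, so c and
    a^-1 are compatible with the same letters. *)
Lemma compat_transfer l c a : zero_rel c a -> compat l (c, true) = compat l (a, false).
Proof.
move=> h; have e := gentle_length2 hQ h.
case: l => [b []]; rewrite !compatE.
- rewrite e; apply: andb_id2l => /eqP e'; apply/idP/idP; apply: contra.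
    by move=> h'; apply/eqP; apply: (card_le1 (gentle_after0 hQ a)); rewrite ?h ?h' ?e ?e' eqxx.
  by move/eqP->.
- rewrite e [tgt b == _]eq_sym; apply: andb_id2l => /eqP e'; apply/idP/idP; apply: contra.
    by move/eqP->.
  by move=> h'; apply/eqP; apply: (card_le1 (gentle_before0 hQ c)); rewrite ?h ?h' ?e ?e' eqxx.
Qed.

End Gentle.

(** * Matrices with entries indexed by natural numbers *)

Section NatMatrices.

Variable k : fieldType.

(** Positions in strings are compared and shifted all the time; natural numbers
    as indices avoid casts between ordinals of different dimensions. *)
Definition nat_mx m n (f : nat -> nat -> k) : 'M[k]_(m, n) := \matrix_(i, j) f i j.

Definition entry m n (A : 'M[k]_(m, n)) (i j : nat) : k :=
  if (insub i, insub j) is (Some i', Some j') then A i' j' else 0.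

Lemma eq_nat_mx m n (f g : nat -> nat -> k) :
  (forall i j, (i < m)%N -> (j < n)%N -> f i j = g i j) -> nat_mx m n f = nat_mx m n g.
Proof. by move=> h; apply/matrixP=> i j; rewrite !mxE h. Qed.

Lemma entryE m n (A : 'M[k]_(m, n)) (i : 'I_m) (j : 'I_n) : entry A i j = A i j.
Proof. by rewrite /entry !valK. Qed.

Lemma entry_nat_mx m n f i j : (i < m)%N -> (j < n)%N -> entry (nat_mx m n f) i j = f i j.
Proof. by move=> hi hj; rewrite (entryE _ (Ordinal hi) (Ordinal hj)) mxE. Qed.

Lemma entry_linear m n (I : finType) (c : I -> k) (A : I -> 'M[k]_(m, n)) i j :
  entry (\sum_t c t *: A t) i j = \sum_t c t * entry (A t) i j.
Proof.
rewrite /entry; case: insubP => [i' _ _|_]; last by rewrite big1 // => t; rewrite mulr0.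
case: insubP => [j' _ _|_]; last by rewrite big1 // => t; rewrite mulr0.
by rewrite summxE; apply: eq_bigr => t _; rewrite mxE.
Qed.

Lemma entryB m n (A B : 'M[k]_(m, n)) i j : entry (A - B) i j = entry A i j - entry B i j.
Proof.
rewrite /entry; case: insubP => [i' _ _|_]; last by rewrite subr0.
by case: insubP => [j' _ _|_]; rewrite ?subr0 // !mxE.
Qed.

Lemma nat_mxD m n (f g : nat -> nat -> k) :
  nat_mx m n f + nat_mx m n g = nat_mx m n (fun i j => f i j + g i j).
Proof. by apply/matrixP=> i j; rewrite !mxE. Qed.

Lemma nat_mxN m n (f : nat -> nat -> k) :
  - nat_mx m n f = nat_mx m n (fun i j => - f i j).
Proof. by apply/matrixP=> i j; rewrite !mxE. Qed.

Lemma nat_mx0 m n : 0 = nat_mx m n (fun _ _ => 0).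
Proof. by apply/matrixP=> i j; rewrite !mxE. Qed.

Lemma nat_mx1 n : 1%:M = nat_mx n n (fun i j => (i == j)%:R).
Proof. by apply/matrixP=> i j; rewrite !mxE. Qed.

Lemma mul_nat_mx_row m n p (f g : nat -> nat -> k) (q : nat -> bool) (r : nat -> nat) :
  (forall i, (i < m)%N -> q i -> (r i < n)%N) ->
  (forall i j, (i < m)%N -> (j < n)%N -> f i j = (q i && (j == r i))%:R) ->
  nat_mx m n f *m nat_mx n p g = nat_mx m p (fun i j => if q i then g (r i) j else 0).
Proof.
move=> hr hf; apply/matrixP=> i j; rewrite !mxE.
case: ifP => hq; last by apply: big1 => l _; rewrite !mxE hf // hq mul0r.
rewrite (bigD1 (Ordinal (hr i (ltn_ord i) hq))) //= big1 => [|l hl].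
  by rewrite !mxE hf ?hr // hq eqxx mul1r addr0.
rewrite !mxE hf // hq /=; case: eqP => [e|_]; last by rewrite mul0r.
by case/eqP: hl; apply: val_inj.
Qed.

Lemma mul_nat_mx_col m n p (f g : nat -> nat -> k) (q : nat -> bool) (r : nat -> nat) :
  (forall j, (j < p)%N -> q j -> (r j < n)%N) ->
  (forall i j, (i < n)%N -> (j < p)%N -> g i j = (q j && (i == r j))%:R) ->
  nat_mx m n f *m nat_mx n p g = nat_mx m p (fun i j => if q j then f i (r j) else 0).
Proof.
move=> hr hg; apply/matrixP=> i j; rewrite !mxE.
case: ifP => hq; last by apply: big1 => l _; rewrite !mxE hg // hq mulr0.
rewrite (bigD1 (Ordinal (hr j (ltn_ord j) hq))) //= big1 => [|l hl].
  by rewrite !mxE hg ?hr // hq eqxx mulr1 addr0.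
rewrite !mxE hg // hq /=; case: eqP => [e|_]; last by rewrite mulr0.
by case/eqP: hl; apply: val_inj.
Qed.

Definition shift_entry (d d' l i j : nat) : k := [&& d <= i, i < d + l & i + d' == j + d]%N%:R.

(** The partial bijection between the bases of two string modules that carries
    the l positions from d on to those from d' on.  Graph maps are such
    matrices. *)
Definition shift_mx m n d d' l : 'M[k]_(m, n) := nat_mx m n (shift_entry d d' l).

Lemma shift_mulmx m n p d d' l (g : nat -> nat -> k) : (d' + l <= n)%N ->
  shift_mx m n d d' l *m nat_mx n p g =
  nat_mx m p (fun i j => if (d <= i < d + l)%N then g (i - d + d')%N j else 0).
Proof.
move=> h; apply: mul_nat_mx_row => [i hi /andP[h1 h2]|i j hi hj]; first by lia.
by rewrite /shift_entry; congr (_%:R); congr nat_of_bool; lia.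
Qed.

Lemma mulmx_shift m n p d d' l (f : nat -> nat -> k) : (d + l <= n)%N ->
  nat_mx m n f *m shift_mx n p d d' l =
  nat_mx m p (fun i j => if (d' <= j < d' + l)%N then f i (j - d' + d)%N else 0).
Proof.
move=> h; apply: mul_nat_mx_col => [i hi /andP[h1 h2]|i j hi hj]; first by lia.
by rewrite /shift_entry; congr (_%:R); congr nat_of_bool; lia.
Qed.

Definition orient_at o (n i : nat) : nat := (if o then n.-1 - i else i)%N.

Lemma orient_mulmx o m n p (g : nat -> nat -> k) : m = n ->
  orient_mx k o m n *m nat_mx n p g = nat_mx m p (fun i j => g (orient_at o m i) j).
Proof.
move=> <-; have -> : orient_mx k o m m =
    nat_mx m m (fun i j => (if o then (i + j == m.-1)%N else i == j :> nat)%:R).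
  by apply/matrixP=> i j; rewrite !mxE.
rewrite (@mul_nat_mx_row _ _ _ _ _ (fun=> true) (orient_at o m)) //.
  by move=> i hi _; rewrite /orient_at; case: o; lia.
move=> i j hi hj; rewrite /orient_at; congr (_%:R); congr nat_of_bool.
by case: o; lia.
Qed.

Lemma orient_mxK o m n : m = n -> orient_mx k o m n *m orient_mx k o n m = 1%:M.
Proof.
move=> e; have -> : orient_mx k o n m =
    nat_mx n m (fun i j => (if o then (i + j == m.-1)%N else i == j :> nat)%:R).
  by apply/matrixP=> i j; rewrite !mxE.
rewrite orient_mulmx // nat_mx1; apply: eq_nat_mx => i j hi hj; rewrite /orient_at.
by congr (_%:R); congr nat_of_bool; case: o; lia.
Qed.

End NatMatrices.

(** * Corners and the coboundary of a partial bijection *)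

Section Corners.

Variables (k : fieldType) (Q : bound_quiver).
Implicit Types (C : walk Q) (s : bool) (i j : nat).

Lemma string_act_arrow C a :
  string_act k C (inr a) = nat_mx (wdim C) (wdim C) (fun i j => (sends C a i j)%:R).
Proof. by apply/matrixP=> i j; rewrite !mxE. Qed.

Lemma string_act_vertex C x : string_act k C (inl x) =
  nat_mx (wdim C) (wdim C) (fun i j => ((i == j) && (vertex_at C i == x))%:R).
Proof. by apply/matrixP=> i j; rewrite !mxE. Qed.

(** The part of the coboundary of the matrix unit at (i, j) that concerns side s
    of i and side s' of j.  The factor on the source side is the walk C, which
    plays the role of Y, and C' plays that of X. *)
Definition corner_entry C C' s s' i j a (u w : nat) : k :=
  [&& leave C' s' j == Some (a, true), u == i & w == move s' j]%:R
  - [&& leave C s i == Some (a, false), u == move s i & w == j]%:R.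

Definition corner C C' s s' i j (g : vertex Q + arrow Q) : 'M[k]_(wdim C, wdim C') :=
  if g is inr a then nat_mx _ _ (corner_entry C C' s s' i j a) else 0.

Lemma leaveF_entry C i b (a : arrow Q) (w : nat) :
  (leave C false i == Some (a, b)) && (w == i.-1) =
  (i == w.+1) && (onth C.2 w == Some (a, ~~ b)).
Proof.
case: i => [|i] //=; rewrite eqSS [w == i]eq_sym andbC.
apply: andb_id2l => /eqP <-; case: onth => [l|] //=; apply/eqP/eqP => -[].
  by case: l => a' b' [<- <-]; rewrite negbK.
by move=> ->; rewrite /linv /= negbK.
Qed.

(** Inside the range the two walks have the same letters, so both products move
    a basis vector along the same letter and cancel.  What remains are the
    arrows that act across an end of the range: out of it in C' and into it in
    C. *)
Lemma shift_boundary C C' d d' l g :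
  (0 < l)%N -> (d + l <= wdim C)%N -> (d' + l <= wdim C')%N ->
  (forall t, (t < l)%N -> vertex_at C (d + t) = vertex_at C' (d' + t)) ->
  (forall t, (t.+1 < l)%N -> onth C.2 (d + t) = onth C'.2 (d' + t)) ->
  shift_mx k (wdim C) (wdim C') d d' l *m string_act k C' g -
    string_act k C g *m shift_mx k (wdim C) (wdim C') d d' l =
  corner C C' true true (d + l.-1) (d' + l.-1) g + corner C C' false false d d' g.
Proof.
move=> l0 hl hl' hv hw; case: g => [x|a].
  rewrite !string_act_vertex shift_mulmx // mulmx_shift // addr0; apply/eqP.
  rewrite subr_eq0; apply/eqP; apply: eq_nat_mx => i j hi hj.
  case: (boolP (d <= i < d + l)%N) => h1; case: (boolP (d' <= j < d' + l)%N) => h2 //.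
  - have e1 : (i - d + d' = d' + (i - d))%N by lia.
    have e2 : i = (d + (i - d))%N by lia.
    rewrite e1 -hv -?e2; last by lia.
    by congr (_%:R); congr nat_of_bool; congr (_ && _); lia.
  - by case: eqP => //= e; exfalso; lia.
  - by case: eqP => //= e; exfalso; lia.
rewrite !string_act_arrow shift_mulmx // mulmx_shift // !nat_mxN !nat_mxD.
apply: eq_nat_mx => i j hi hj; rewrite /corner_entry.
have E1 (b c : bool) : [&& leave C' false d' == Some (a, b), c & j == move false d'] =
    [&& d' == j.+1, onth C'.2 j == Some (a, ~~ b) & c].
  by rewrite (andbA (d' == _)) -leaveF_entry /= andbA andbAC.
have E2 (b c : bool) : [&& leave C false d == Some (a, b), i == move false d & c] =
    [&& d == i.+1, onth C.2 i == Some (a, ~~ b) & c].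
  by rewrite (andbA (d == _)) -leaveF_entry /= andbA.
rewrite E1 E2 /= {E1 E2}.
(* Both indices in range: cancellation.  One in range: exactly one of the two
   products survives, at an end.  None: everything vanishes. *)
have F (b : bool) : b = false -> b%:R = 0 :> k by move->.
case: (boolP (d <= i < d + l)%N) => h1; case: (boolP (d' <= j < d' + l)%N) => h2.
- do 4 (rewrite (F [&& _, _ & _]); last by lia); rewrite !subr0 addr0.
  apply/eqP; rewrite subr_eq0; apply/eqP; congr (_%:R); congr nat_of_bool.
  rewrite /sends; congr orb.
    case: (eqVneq j _) => e; case: (eqVneq _ i.+1) => e' //=; try by exfalso; lia.
    have -> : (i - d + d' = d' + (i - d))%N by lia.
    by rewrite -hw; [congr (onth _ _ == _)|]; lia.
  case: (eqVneq _ j.+1) => e; case: (eqVneq i _) => e' //=; try by exfalso; lia.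
  have -> : (j - d' + d = d + (j - d'))%N by lia.
  by rewrite hw; [congr (onth _ _ == _)|]; lia.
- rewrite (F [&& _ == Some (a, false), _ & _]); last by lia.
  rewrite (F [&& d == _, _ & _]); last by lia.
  rewrite !subr0 /sends; case: (eqVneq j (d' + l.-1).+1) => hj1.
    rewrite andbT (F [&& d' == _, _ & _]) ?addr0; last by lia.
    rewrite [X in _ || X](_ : _ = false) ?orbF; last by lia.
    congr (_%:R); congr nat_of_bool; rewrite andbC; case: (eqVneq i (d + l.-1)%N) => hi1.
      have -> : (i - d + d' = d' + l.-1)%N by lia.
      by rewrite hj1 eqxx.
    by rewrite andbF; apply/negP=> /andP[_ /eqP]; lia.
  rewrite !andbF add0r; congr (_%:R); congr nat_of_bool.
  rewrite [X in X || _](_ : _ = false) /=; last by lia.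
  case: (eqVneq _ j.+1) => e1; case: (eqVneq d' _) => e2 //=; try by exfalso; lia.
    by rewrite (_ : (i == d) = true) ?andbT; lia.
  by rewrite (_ : (i == d) = false) ?andbF //; lia.
- rewrite (F [&& _ == Some (a, true), _ & _]); last by lia.
  rewrite (F [&& d' == _, _ & _]); last by lia.
  rewrite !sub0r -opprD; congr (- _).
  rewrite /sends; case: (eqVneq i (d + l.-1).+1) => hi1.
    rewrite [X in X || _](_ : _ = false) /=; last by lia.
    rewrite (F [&& d == _, _ & _]) ?addr0; last by lia.
    congr (_%:R); congr nat_of_bool; rewrite andbC; case: (eqVneq j (d' + l.-1)%N) => hj1.
      have -> : (j - d' + d = d + l.-1)%N by lia.
      by rewrite hi1 eqxx !andbT.
    by rewrite andbF; apply/negP=> /andP[_ /eqP]; lia.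
  rewrite !andbF add0r; congr (_%:R); congr nat_of_bool.
  rewrite [X in _ || X](_ : _ = false) ?orbF; last by lia.
  case: (eqVneq _ i.+1) => e1; case: (eqVneq d _) => e2 //=; try by exfalso; lia.
    by rewrite (_ : (j == d') = true) ?andbT; lia.
  by rewrite (_ : (j == d') = false) ?andbF //; lia.
- do 4 (rewrite (F [&& _, _ & _]); last by lia).
  by rewrite !subr0 addr0.
Qed.

End Corners.

(** * Reversing a string *)

Section Orientation.

Variables (k : fieldType) (Q : bound_quiver).
Implicit Types (C : walk Q) (s o : bool) (i j : nat).

Lemma wdim_orient o C : wdim (orient o C) = wdim C.
Proof. by rewrite /wdim size_orient. Qed.

Lemma orient_atE o C i : orient_at o (wdim C) i = orient_pos o C i.
Proof. by []. Qed.

Lemma orient_pos_le o C i : (i <= size C.2)%N -> (orient_pos o C i <= size C.2)%N.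
Proof. by rewrite /orient_pos; case: o => //; lia. Qed.

Lemma orient_posK o C i : (i <= size C.2)%N -> orient_pos o C (orient_pos o C i) = i.
Proof. by rewrite /orient_pos; case: o => //; lia. Qed.

Lemma orient_pos_move o C s i l : leave (orient o C) s i = Some l ->
  orient_pos o C (move s i) = move (o (+) s) (orient_pos o C i).
Proof.
case: s => [/leaveT_lt|/leaveF_le]; rewrite size_orient /orient_pos /move;
by case: o => //=; lia.
Qed.

Lemma sends_orient o C a i j : (i <= size C.2)%N -> (j <= size C.2)%N ->
  sends (orient o C) a i j = sends C a (orient_pos o C i) (orient_pos o C j).
Proof.
move=> hi hj; apply/sendsP/sendsP => -[s h e].
  by exists (o (+) s); rewrite -?leave_orient // e (orient_pos_move h).
have h' : leave (orient o C) (o (+) s) i = Some (a, true).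
  by rewrite leave_orient // addKb.
exists (o (+) s) => //; rewrite -(orient_posK o hj) e -[in LHS](addKb o s).
rewrite -(orient_pos_move h') orient_posK //.
by have [_] := leave_range h'; rewrite wdim_orient.
Qed.

Lemma mulmx_orient o m n p (f : nat -> nat -> k) : n = p ->
  nat_mx m n f *m orient_mx k o n p = nat_mx m p (fun i j => f i (orient_at o n j)).
Proof.
move=> <-; have -> : orient_mx k o n n =
    nat_mx n n (fun i j => (if o then (i + j == n.-1)%N else i == j :> nat)%:R).
  by apply/matrixP=> i j; rewrite !mxE.
rewrite (@mul_nat_mx_col _ _ _ _ _ _ (fun=> true) (orient_at o n)) //.
  by move=> i hi _; rewrite /orient_at; case: o; lia.
move=> i j hi hj; rewrite /orient_at; congr (_%:R); congr nat_of_bool.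
by case: o; lia.
Qed.

Lemma orient_act o C g : is_string C ->
  orient_mx k o (wdim C) (wdim (orient o C)) *m string_act k (orient o C) g =
  string_act k C g *m orient_mx k o (wdim C) (wdim (orient o C)).
Proof.
move=> hC; have e := esym (wdim_orient o C); case: g => [x|a].
  rewrite !string_act_vertex orient_mulmx // mulmx_orient //.
  apply: eq_nat_mx => i j hi hj; congr (_%:R); congr nat_of_bool.
  rewrite wdim_orient in hj; rewrite !orient_atE.
  rewrite vertex_orient ?orient_pos_le // orient_posK //.
  congr andb; by apply/eqP/eqP => [<-|->]; rewrite orient_posK.
rewrite !string_act_arrow orient_mulmx // mulmx_orient //.
apply: eq_nat_mx => i j hi hj; congr (_%:R); congr nat_of_bool.
rewrite wdim_orient in hj; rewrite !orient_atE.
by rewrite sends_orient ?orient_posK //; apply: orient_pos_le.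
Qed.

(** Reversing the walk exchanges its sides.  Everything below can therefore be
    stated for corners of Y itself, the orientation being kept in the side. *)
Lemma orient_corner o C C' s s' i j g : (i <= size C.2)%N ->
  orient_mx k o (wdim C) (wdim (orient o C)) *m corner k (orient o C) C' s s' i j g =
  corner k C C' (o (+) s) s' (orient_pos o C i) j g.
Proof.
move=> hi; case: g => [x|a] /=; first by rewrite mulmx0.
rewrite orient_mulmx ?wdim_orient //; apply: eq_nat_mx => u w hu hw.
rewrite /corner_entry leave_orient //; congr (_%:R - _%:R); congr nat_of_bool.
  congr [&& _, _ & _]; rewrite orient_atE; apply/eqP/eqP => [<-|->].
    by rewrite orient_posK.
  by rewrite orient_posK.
case: (eqVneq (leave C _ _)) => //= h; congr andb.
have h' : leave (orient o C) s i = Some (a, false) by rewrite leave_orient.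
rewrite -(orient_pos_move h') orient_atE.
have [_] := leave_range h'; rewrite wdim_orient => hm.
by apply/eqP/eqP => [<-|->]; rewrite orient_posK.
Qed.

(** It suffices to split a sequence whose ends are replaced by the modules of the
    reversed strings. *)
Lemma oriented_exact (X Y : string Q) oX oY (s : sequence (smod k Y) (smod k X))
    (inc0 : 'M_(wdim (orient oX X), Defs.dim (mid s)))
    (prj0 : 'M_(Defs.dim (mid s), wdim (orient oY Y))) S0 r0
    (D0 : vertex Q + arrow Q -> 'M_(wdim (orient oY Y), wdim (orient oX X))) :
  inc s = orient_mx k oX (wdim X) (wdim (orient oX X)) *m inc0 ->
  prj s = prj0 *m orient_mx k oY (wdim (orient oY Y)) (wdim Y) ->
  (forall g, inc0 *m act (mid s) g - string_act k (orient oX X) g *m inc0 = 0) ->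
  S0 *m prj0 = 1%:M -> inc0 *m r0 = 1%:M -> inc0 *m prj0 = 0 ->
  prj0 *m S0 + r0 *m inc0 = 1%:M ->
  (forall g, S0 *m act (mid s) g - string_act k (orient oY Y) g *m S0 = D0 g *m inc0) ->
  exists h : short_exact s, represents (ext_class (Extension h))
    (fun g => orient_mx k oY (wdim Y) (wdim (orient oY Y)) *m D0 g
              *m orient_mx k oX (wdim (orient oX X)) (wdim X)).
Proof.
set OX := orient_mx k oX _ _; set OY := orient_mx k oY _ _ => hinc hprj hi hS hr h0 h1 hD.
set OY' := orient_mx k oY (wdim Y) _.
set OX' := orient_mx k oX (wdim (orient oX X)) _.
have eX : OX *m OX' = 1%:M by rewrite orient_mxK // wdim_orient.
have eX' : OX' *m OX = 1%:M by rewrite orient_mxK // wdim_orient.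
have eY : OY *m OY' = 1%:M by rewrite orient_mxK // wdim_orient.
have eY' : OY' *m OY = 1%:M by rewrite orient_mxK // wdim_orient.
have E1 : (OY' *m S0) *m prj s = 1%:M.
  by rewrite hprj -mulmxA (mulmxA S0) hS mul1mx.
have E2 g : (OY' *m S0) *m act (mid s) g =
   act (smod k Y) g *m (OY' *m S0) + OY' *m D0 g *m OX' *m inc s.
  have -> : act (smod k Y) g *m (OY' *m S0) =
      OY' *m string_act k (orient oY Y) g *m S0.
    by rewrite /OY' orient_act ?mulmxA //; apply: stringP.
  rewrite hinc -(mulmxA _ OX') (mulmxA OX') eX' mul1mx -!mulmxA -hD -mulmxDr.
  by rewrite addrC subrK.
suff hs : short_exact s by exists hs;
    exact: (@section_cocycle _ _ _ _ (Extension hs) (OY' *m S0) _ E1 E2).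
apply: (@section_exact _ _ _ _ s (OY' *m S0) (r0 *m OX')) E2 => //.
- apply/homP=> g; rewrite hinc mulmxA.
  have -> : act (smod k X) g *m OX = OX *m string_act k (orient oX X) g.
    by rewrite [RHS]orient_act //; apply: stringP.
  rewrite -!mulmxA; congr (_ *m _); apply/eqP; rewrite eq_sym -subr_eq0.
  by rewrite hi.
- by rewrite hinc -mulmxA (mulmxA inc0) hr mul1mx.
- by rewrite hinc hprj -mulmxA (mulmxA inc0) h0 mul0mx mulmx0.
- rewrite hinc hprj -!mulmxA (mulmxA OY) eY mul1mx.
  by rewrite (mulmxA OX') eX' mul1mx.
Qed.

End Orientation.

(** * Overlaps and spliced walks *)

Section Splice.

Variable Q : bound_quiver.
Implicit Types C : walk Q.

Local Open Scope nat_scope.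

Lemma vertex_atS C t : vertex_at C t.+1 = if onth C.2 t is Some l then ltgt l else C.1.
Proof.
rewrite /vertex_at /wverts /= -(odflt_onth C.1) onth_map.
by case: onth.
Qed.

(** With C = Y and C' = X, cut at the end of the common part E, this is F_1 E D_2;
    with the roles exchanged it is F_2 E D_1. *)
Definition splice C C' b b' : walk Q := (C.1, take b C.2 ++ drop b' C'.2).

Lemma size_splice C C' b b' : b <= size C.2 ->
  size (splice C C' b b').2 = b + (size C'.2 - b').
Proof. by move=> h; rewrite size_cat size_drop size_takel. Qed.

Lemma onth_drop (T : Type) (w : seq T) b t : onth (drop b w) t = onth w (t + b).
Proof. by rewrite !onthE map_drop nth_drop addnC. Qed.

Lemma onth_take (T : Type) (w : seq T) b t :
  onth (take b w) t = if t < b then onth w t else None.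
Proof.
rewrite !onthE map_take; case: ltnP => h; first by rewrite nth_take.
by rewrite nth_default // size_take_min; lia.
Qed.

Lemma onth_splice C C' b b' t : b <= size C.2 ->
  onth (splice C C' b b').2 t = if t < b then onth C.2 t else onth C'.2 (t - b + b').
Proof.
move=> h; rewrite /splice onth_cat size_takel // onth_take onth_drop.
by case: (ltnP t b).
Qed.

Lemma vertex_splice C C' b b' t : b <= size C.2 -> b' <= size C'.2 ->
  vertex_at C b = vertex_at C' b' -> t <= b + (size C'.2 - b') ->
  vertex_at (splice C C' b b') t =
    if t <= b then vertex_at C t else vertex_at C' (t - b + b').
Proof.
move=> hb hb' e; case: t => [|t] ht; first by [].
rewrite vertex_atS onth_splice //; case: ltnP => h; first by rewrite vertex_atS.
rewrite (_ : t.+1 - b + b' = (t - b + b').+1); last by lia.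
rewrite vertex_atS; case E: onth => //.
have : ~~ onth C'.2 (t - b + b') by rewrite E.
by rewrite onthNE; lia.
Qed.

End Splice.

Section Overlap.

Variable Q : bound_quiver.
Implicit Types C : walk Q.

Local Open Scope nat_scope.

(** A common substring of length m, as positions.  The vertices are compared at
    one position only; the letters determine the others. *)
Definition overlap C C' d d' m : Prop :=
  [/\ d + m <= size C.2, d' + m <= size C'.2, vertex_at C d = vertex_at C' d' &
      forall t, t < m -> onth C.2 (d + t) = onth C'.2 (d' + t)].

Lemma overlap_vertex C C' d d' m t : overlap C C' d d' m -> t <= m ->
  vertex_at C (d + t) = vertex_at C' (d' + t).
Proof.
move=> [h1 h2 hv hw]; case: t => [|t] ht; first by rewrite !addn0.
rewrite !addnS !vertex_atS hw //.
by move: (onthTE C'.2 (d' + t)); case: onth => //= /esym; lia.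
Qed.

Lemma leave_spliceF C C' b b' t : b <= size C.2 -> t <= b ->
  leave (splice C C' b b') false t = leave C false t.
Proof. by move=> hb; case: t => //= t ht; rewrite onth_splice // ht. Qed.

End Overlap.

Section CornerVanish.

Variables (k : fieldType) (Q : bound_quiver).

Lemma corner0 (C C' : walk Q) s s' i j g :
  (forall a, leave C' s' j <> Some (a, true)) ->
  (forall a, leave C s i <> Some (a, false)) -> corner k C C' s s' i j g = 0.
Proof.
move=> h h'; case: g => //= a; rewrite (nat_mx0 k); apply: eq_nat_mx => u w _ _.
rewrite /corner_entry; case: eqP => [/h|_] //=; case: eqP => [/h'|_] //=.
by rewrite subrr.
Qed.

Lemma leave_last (C : walk Q) i : (size C.2 <= i)%N -> leave C true i = None.
Proof. by move=> h; apply/leaveT_None. Qed.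

Lemma shift_mx_nil m n d d' : shift_mx k m n d d' 0 = 0.
Proof.
rewrite (nat_mx0 k); apply: eq_nat_mx => i j _ _.
by rewrite /shift_entry addn0; case: leqP.
Qed.

Lemma shift_mx_full n a b : n = (a + b)%N ->
  shift_mx k n n 0 0 a + shift_mx k n n a a b = 1%:M.
Proof.
move=> e; rewrite nat_mxD nat_mx1; apply: eq_nat_mx => i j hi hj.
rewrite /shift_entry add0n !addn0 eqn_add2r leq0n -e hi.
by case: (ltnP i a) => /= h; rewrite ?addr0 ?add0r.
Qed.

(** Composing two partial bijections.  The range of the first and the domain
    of the second meet in c positions; these start at the xth position of the
    one and at the yth of the other, whence x = 0 or y = 0. *)
Lemma shift_comp m n p x y c d d' l e e' l' : (d' + l <= n)%N ->
  (e + y = d' + x)%N -> (x + c <= l)%N -> (y + c <= l')%N ->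
  (x == 0)%N || (y == 0)%N -> (x + c == l)%N || (y + c == l')%N ->
  shift_mx k m n d d' l *m shift_mx k n p e e' l' = shift_mx k m p (d + x) (e' + y) c.
Proof.
move=> h1 h2 h3 h4 h5 h6; rewrite shift_mulmx //; apply: eq_nat_mx => i j _ _.
rewrite /shift_entry; case: (boolP (d <= i < d + l)%N) => h; last first.
  by rewrite (_ : [&& _, _ & _] = false) //; lia.
by congr (_%:R); congr nat_of_bool; lia.
Qed.

End CornerVanish.

(** * The extension of a two-sided pair *)

Section TwoSidedExact.

Variables (k : fieldType) (Q : bound_quiver) (X W : walk Q) (p q m : nat).
Hypothesis hov : overlap W X q p m.
Hypothesis hXr : forall l, leave X true (p + m) = Some l -> l.2 = true.
Hypothesis hWr : forall l, leave W true (q + m) = Some l -> l.2 = false.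
Hypothesis hXl : forall l, leave X false p = Some l -> l.2 = true.
Hypothesis hWl : forall l, leave W false q = Some l -> l.2 = false.

Let C1 := splice W X (q + m) (p + m).
Let C2 := splice X W (p + m) (q + m).

(* The components of the two maps, followed by a section of the projection and a
   retraction of the inclusion.  The section lifts the part E D_2 of W to the
   first summand and the rest of W, with the opposite sign, to the second. *)
Let inc1 := shift_mx k (wdim X) (wdim C1) p q (size X.2 - p).+1.
Let inc2 := shift_mx k (wdim X) (wdim C2) 0 0 (p + m).+1.
Let prj1 := shift_mx k (wdim C1) (wdim W) 0 0 (q + m).+1.
Let prj2 := shift_mx k (wdim C2) (wdim W) p q (size W.2 - q).+1.
Let S1 := shift_mx k (wdim W) (wdim C1) 0 0 (q + m).+1.
Let S2 := shift_mx k (wdim W) (wdim C2) (q + m).+1 (p + m).+1 (size W.2 - (q + m)).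
Let r1 := shift_mx k (wdim C1) (wdim X) (q + m).+1 (p + m).+1 (size X.2 - (p + m)).
Let r2 := shift_mx k (wdim C2) (wdim X) 0 0 (p + m).+1.

Let hqm : (q + m <= size W.2)%N. Proof. by case: hov. Qed.
Let hpm : (p + m <= size X.2)%N. Proof. by case: hov. Qed.
Let hv t : (t <= m)%N -> vertex_at W (q + t) = vertex_at X (p + t).
Proof. exact: overlap_vertex. Qed.
Let hw t : (t < m)%N -> onth W.2 (q + t) = onth X.2 (p + t).
Proof. by case: hov => _ _ _; apply. Qed.

Let size1 : size C1.2 = (q + m + (size X.2 - (p + m)))%N.
Proof. exact: size_splice. Qed.
Let size2 : size C2.2 = (p + m + (size W.2 - (q + m)))%N.
Proof. exact: size_splice. Qed.

Let dims := (size1, size2).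

Lemma two_sided_inc1_hom g :
  inc1 *m string_act k C1 g - string_act k X g *m inc1 = 0.
Proof.
rewrite /inc1 shift_boundary ?/wdim ?dims //; try by lia.
- rewrite !corner0 ?addr0 //.
  + by move=> a; rewrite leave_spliceF //; [move/hWl|lia].
  + by move=> a /hXl.
  + by move=> a; rewrite leave_last // dims /=; lia.
  + by move=> a; rewrite leave_last //=; lia.
- move=> t ht; rewrite vertex_splice //; [|by rewrite hv|by lia].
  case: ifP => h; first by rewrite hv; [|lia].
  by congr vertex_at; lia.
- move=> t ht; rewrite onth_splice //; case: ifP => h; first by rewrite hw; [|lia].
  by congr onth; lia.
Qed.

Lemma two_sided_inc2_hom g :
  inc2 *m string_act k C2 g - string_act k X g *m inc2 = 0.
Proof.
rewrite /inc2 shift_boundary ?/wdim ?dims //; try by lia.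
- rewrite !corner0 ?addr0 // => a.
  + by rewrite add0n /= onth_splice // ltnn subnn add0n => /hWr.
  + by rewrite add0n => /hXr.
- by move=> t ht; rewrite vertex_splice // ?hv //; [rewrite ifT//|]; lia.
- by move=> t ht; rewrite onth_splice // ifT.
Qed.

(** The section fails to be a homomorphism only at the right end of E: a letter
    of F_1 leads out of E in the first summand but not in W, and a letter of
    F_2 leads back into E from the part of W that is lifted to the second
    summand. *)
Lemma two_sided_S1 g :
  S1 *m string_act k C1 g - string_act k W g *m S1 =
  corner k W X true true (q + m) (p + m) g *m inc1.
Proof.
rewrite /S1 shift_boundary ?/wdim ?dims //; try by lia.
- rewrite [X in _ + X]corner0 // addr0 add0n.
  case: g => [x|a] /=; first by rewrite mul0mx.
  rewrite mulmx_shift; last by rewrite /wdim; lia.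
  apply: eq_nat_mx => u w; rewrite /wdim dims => hu hw'.
  rewrite /corner_entry /= onth_splice // ltnn subnn add0n.
  case: ifP => h.
    by congr (_%:R - _%:R); congr nat_of_bool; congr [&& _, _ & _]; lia.
  have h0 : (w < q)%N by move: h hw' hpm; clear; lia.
  rewrite !(ltn_eqF (leq_trans h0 _)) ?andbF ?subrr // ?leq_addr //.
  by rewrite leqW // leq_addr.
- by move=> t ht; rewrite vertex_splice // ?hv //; [rewrite ifT//|]; lia.
- by move=> t ht; rewrite onth_splice // ifT.
Qed.

Lemma two_sided_S2 g :
  - (S2 *m string_act k C2 g - string_act k W g *m S2) =
  corner k W X true true (q + m) (p + m) g *m inc2.
Proof.
have E : corner k W X true true (q + m) (p + m) g *m inc2 =
         - corner k W C2 false false (q + m).+1 (p + m).+1 g.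
  case: g => [x|a] /=; first by rewrite mul0mx oppr0.
  rewrite mulmx_shift; last by rewrite /wdim; lia.
  rewrite nat_mxN; apply: eq_nat_mx => u w; rewrite /wdim dims => hu hw'.
  rewrite /corner_entry /= onth_splice // ltnn subnn add0n.
  have hWr' := hWr; rewrite /= in hWr'.
  case El: (onth W.2 (q + m)) hWr' => [[b c]|] /= hWr'; last first.
    case: ifP => h; last by rewrite subrr oppr0.
    by rewrite [X in _ && X](_ : _ = false) ?andbF ?subrr ?oppr0 //; lia.
  have -> : c = false by apply: (hWr' (b, c)).
  rewrite /linv /= (_ : (Some (b, true) == Some (a, false)) = false) /=; last first.
    by apply/eqP => -[].
  rewrite subr0; case: ifP => h; last first.
    by rewrite [X in [&& _, _ & X]](_ : _ = false) ?andbF ?oppr0 //; lia.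
  rewrite subn0 addn0 [w == (p + m).+1](_ : _ = false) ?andbF ?sub0r; last by lia.
  congr (- _%:R); congr nat_of_bool; congr andb.
have [h0|h0] := posnP (size W.2 - (q + m)).
  have -> : S2 = 0 by rewrite /S2 h0 shift_mx_nil.
  rewrite mul0mx mulmx0 subrr E; congr (- _); rewrite corner0 // => a.
    rewrite /= onth_splice // ltnn subnn add0n.
    by rewrite (_ : onth _ _ = None) //; apply: onth_default; lia.
  by rewrite /= (_ : onth _ _ = None) //; apply: onth_default; lia.
rewrite E /S2; congr (- _).
rewrite shift_boundary ?/wdim ?dims //; try by lia.
- rewrite [X in X + _]corner0 ?add0r // => a.
    by rewrite leave_last // dims; lia.
  by rewrite leave_last //; lia.
- move=> t ht; rewrite vertex_splice //; [|by rewrite hv|by lia].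
  by rewrite ifF; [congr vertex_at|]; lia.
- move=> t ht; rewrite onth_splice // ifF; last by lia.
  by congr onth; lia.
Qed.

Lemma two_sided_S_prj : S1 *m prj1 + S2 *m prj2 = 1%:M.
Proof.
rewrite (@shift_comp _ _ _ _ 0 0 (q + m).+1) ?/wdim ?dims //; try lia.
rewrite (@shift_comp _ _ _ _ 0 m.+1 (size W.2 - (q + m))) ?/wdim ?dims //; try lia.
by rewrite !addn0 !addnS; apply: shift_mx_full; rewrite /wdim; lia.
Qed.

Lemma two_sided_inc_r : inc1 *m r1 + inc2 *m r2 = 1%:M.
Proof.
rewrite (@shift_comp _ _ _ _ m.+1 0 (size X.2 - (p + m))) ?/wdim ?dims //; try lia.
rewrite (@shift_comp _ _ _ _ 0 0 (p + m).+1) ?/wdim ?dims //; try lia.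
by rewrite addrC !addn0 !addnS; apply: shift_mx_full; rewrite /wdim; lia.
Qed.

Lemma two_sided_inc_prj : inc1 *m prj1 - inc2 *m prj2 = 0.
Proof.
rewrite (@shift_comp _ _ _ _ 0 q m.+1) ?/wdim ?dims //; try lia.
rewrite (@shift_comp _ _ _ _ p 0 m.+1) ?/wdim ?dims //; try lia.
by rewrite !addn0 !add0n subrr.
Qed.

Lemma two_sided_split11 : prj1 *m S1 + r1 *m inc1 = 1%:M.
Proof.
rewrite (@shift_comp _ _ _ _ 0 0 (q + m).+1) ?/wdim ?dims //; try lia.
rewrite (@shift_comp _ _ _ _ 0 m.+1 (size X.2 - (p + m))) ?/wdim ?dims //; try lia.
by rewrite !addn0 !addnS; apply: shift_mx_full; lia.
Qed.

Lemma two_sided_split12 : - (prj1 *m S2) + r1 *m inc2 = 0.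
Proof.
rewrite (@shift_comp _ _ _ _ (q + m).+1 0 0) ?/wdim ?dims //; try lia.
rewrite (@shift_comp _ _ _ _ 0 (p + m).+1 0) ?/wdim ?dims //; try lia.
by rewrite !shift_mx_nil oppr0 addr0.
Qed.

Lemma two_sided_split21 : - (prj2 *m S1) + r2 *m inc1 = 0.
Proof.
rewrite (@shift_comp _ _ _ _ 0 q m.+1) ?/wdim ?dims //; try lia.
rewrite (@shift_comp _ _ _ _ p 0 m.+1) ?/wdim ?dims //; try lia.
by rewrite !addn0 !add0n addNr.
Qed.

Lemma two_sided_split22 : prj2 *m S2 + r2 *m inc2 = 1%:M.
Proof.
rewrite (@shift_comp _ _ _ _ m.+1 0 (size W.2 - (q + m))) ?/wdim ?dims //; try lia.
rewrite (@shift_comp _ _ _ _ 0 0 (p + m).+1) ?/wdim ?dims //; try lia.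
by rewrite addrC !addn0 !addnS; apply: shift_mx_full; lia.
Qed.

End TwoSidedExact.

(** * The extension of a connecting arrow *)

Section Connecting.

Variables (k : fieldType) (Q : bound_quiver).

Lemma natr_if (b c : bool) : (if b then c%:R else 0) = (b && c)%:R :> k.
Proof. by case: b. Qed.

Lemma graph_mapE (C C' : walk Q) f f' : graph_map k C C' f f' =
  shift_mx k (wdim C) (wdim C') (size (wletters (fD f))) (size (wletters (fD f')))
    (size (wletters (fE f))).+1.
Proof. by apply/matrixP=> i j; rewrite !mxE /shift_entry addnS ltnS. Qed.

Definition unit_cochain m n (a : arrow Q) (i j : nat) (g : vertex Q + arrow Q) :
    'M[k]_(m, n) :=
  if g is inr b then nat_mx m n (fun u w => [&& b == a, u == i & w == j]%:R) else 0.

Lemma shift_mx1 n : shift_mx k n n 0 0 n = 1%:M.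
Proof. by rewrite -(@shift_mx_full k n n 0) ?addn0 // shift_mx_nil addr0. Qed.

Lemma vertex_last (C : walk Q) : wend C = vertex_at C (size C.2).
Proof. by rewrite /wend /vertex_at /wverts -(size_map (@ltgt Q)) -last_nth. Qed.

Section Matrices.

Variables (X W : walk Q) (a : arrow Q).
Hypothesis hX : wend X = tgt a.
Hypothesis hW : src a = wstart W.

Let C := wcat W (wcat (tgt a, [:: (a, false)]) X).
Let inc0 := shift_mx k (wdim X) (wdim C) 0 0 (wdim X).
Let prj0 := shift_mx k (wdim C) (wdim W) (wdim X) 0 (wdim W).
Let S0 := shift_mx k (wdim W) (wdim C) 0 (wdim X) (wdim W).
Let r0 := shift_mx k (wdim C) (wdim X) 0 0 (wdim X).

Let sizeC : size C.2 = (wdim X + size W.2)%N.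
Proof. by rewrite !size_cat addn1. Qed.

Let onthC t : onth C.2 t = if (t < size X.2)%N then onth X.2 t
  else if t == size X.2 then Some (a, false) else onth W.2 (t - wdim X).
Proof.
rewrite /C /= !onth_cat !size_cat addn1 ltnS; case: ltngtP => //= h.
by rewrite h subnn.
Qed.

Let vertexX t : (t <= size X.2)%N -> vertex_at C t = vertex_at X t.
Proof. by case: t => // t ht; rewrite !vertex_atS onthC ht. Qed.

Let vertexW t : (t <= size W.2)%N -> vertex_at C (wdim X + t) = vertex_at W t.
Proof.
move=> ht; rewrite /wdim addSn vertex_atS onthC.
rewrite ltnNge leq_addr /= -{2}[size X.2]addn0 eqn_add2l.
case: t ht => [|t] ht; first by rewrite /ltgt /= hW.
rewrite vertex_atS (_ : (_ - _)%N = t); last by rewrite /wdim; lia.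
by move: (onthTE W.2 t); case: onth => //= /esym; lia.
Qed.

Lemma conn_inc_hom g : inc0 *m string_act k C g - string_act k X g *m inc0 = 0.
Proof.
rewrite /inc0 shift_boundary ?/wdim ?sizeC //; try by rewrite /wdim; lia.
- rewrite !corner0 ?addr0 // => b.
  + by rewrite !add0n /= onthC ltnn eqxx => -[].
  + by rewrite leave_last.
- by move=> t; rewrite ltnS => ht; rewrite vertexX.
- by move=> t; rewrite ltnS => ht; rewrite onthC ht.
Qed.

(** The middle term contains W and X as substrings joined by a^-1, so the
    obvious lift of W fails only at a, which maps the first basis vector of W
    to the last one of X. *)
Lemma conn_S g : S0 *m string_act k C g - string_act k W g *m S0 =
  unit_cochain (wdim W) (wdim X) a 0 (size X.2) g *m inc0.
Proof.
rewrite /S0 shift_boundary ?/wdim ?sizeC //; try by rewrite /wdim; lia.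
- rewrite [X in X + _]corner0 ?add0r; try by move=> b; rewrite leave_last // sizeC /wdim; lia.
  case: g => [x|b] /=; first by rewrite mul0mx.
  rewrite mulmx_shift //; apply: eq_nat_mx => u w hu hw.
  rewrite /corner_entry /= onthC ltnn eqxx /= subr0 subn0 addn0 natr_if.
  congr (_%:R); congr nat_of_bool; rewrite (inj_eq Some_inj) xpair_eqE andbT eq_sym.
  case: (b == a); case: (u == 0)%N; rewrite /= ?andbF //.
  by case: eqP => [->|_]; rewrite ?andbF // add0n ltnS leqnn.
- by move=> t; rewrite ltnS => ht; rewrite vertexW.
- move=> t; rewrite ltnS => ht; rewrite onthC /wdim ifF; last by lia.
  by rewrite ifF; [congr onth|]; lia.
Qed.

Lemma conn_S_prj : S0 *m prj0 = 1%:M.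
Proof.
rewrite (@shift_comp _ _ _ _ 0 0 (wdim W)) ?add0n ?addn0 ?eqxx //; last first.
  by rewrite /wdim sizeC /wdim; lia.
exact: shift_mx1.
Qed.

Lemma conn_inc_r : inc0 *m r0 = 1%:M.
Proof.
rewrite (@shift_comp _ _ _ _ 0 0 (wdim X)) ?add0n ?addn0 ?eqxx //; last first.
  by rewrite /wdim sizeC /wdim; lia.
exact: shift_mx1.
Qed.

Lemma conn_inc_prj : inc0 *m prj0 = 0.
Proof.
rewrite (@shift_comp _ _ _ _ (wdim X) 0 0) ?add0n ?addn0 ?eqxx ?orbT //.
  by rewrite shift_mx_nil.
by rewrite /wdim sizeC /wdim; lia.
Qed.

Lemma conn_splitting : prj0 *m S0 + r0 *m inc0 = 1%:M.
Proof.
rewrite (@shift_comp _ _ _ _ 0 0 (wdim W)) ?add0n ?addn0 ?eqxx //.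
rewrite (@shift_comp _ _ _ _ 0 0 (wdim X)) ?add0n ?addn0 ?eqxx //.
by rewrite addrC shift_mx_full // /wdim sizeC /wdim; lia.
Qed.

End Matrices.

Lemma orient_unit (X Y : walk Q) oX oY a i j g :
  (i <= size Y.2)%N -> (j <= size X.2)%N ->
  orient_mx k oY (wdim Y) (wdim (orient oY Y)) *m
    unit_cochain (wdim (orient oY Y)) (wdim (orient oX X)) a i j g *m
    orient_mx k oX (wdim (orient oX X)) (wdim X) =
  unit_cochain (wdim Y) (wdim X) a (orient_pos oY Y i) (orient_pos oX X j) g.
Proof.
move=> hi hj; case: g => [x|b] /=; first by rewrite mulmx0 mul0mx.
rewrite orient_mulmx ?wdim_orient // mulmx_orient ?wdim_orient //.
apply: eq_nat_mx => u w hu hw; congr (_%:R); congr nat_of_bool.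
rewrite !orient_atE; congr [&& _, _ & _].
  by apply/eqP/eqP => [<-|->]; rewrite orient_posK.
by apply/eqP/eqP => [<-|->]; rewrite orient_posK.
Qed.

Variables X Y : string Q.

Lemma connecting_exact (T : connecting X Y) :
  exists h : short_exact (conn_seq k T), represents (ext_class (Extension h))
    (unit_cochain (wdim Y) (wdim X) (sval T).1.1 (orient_pos (sval T).2 Y 0)
                  (orient_pos (sval T).1.2 X (size (string_walk X).2))).
Proof.
case: T => -[[a oX] oY] /= h; have /and5P[/= /eqP hX /eqP hY hC _ _] := h.
set s := conn_seq k _; pose X' := orient oX X; pose Y' := orient oY Y.
pose C := wcat Y' (wcat (tgt a, [:: (a, false)]) X').
have hs := @oriented_exact k Q X Y oX oY s
  (shift_mx k (wdim X') (wdim C) 0 0 (wdim X'))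
  (shift_mx k (wdim C) (wdim Y') (wdim X') 0 (wdim Y'))
  (shift_mx k (wdim Y') (wdim C) 0 (wdim X') (wdim Y'))
  (shift_mx k (wdim C) (wdim X') 0 0 (wdim X'))
  (unit_cochain (wdim Y') (wdim X') a 0 (size X'.2)).
have [||||||||hs' rep] := hs.
- by rewrite /s /= graph_mapE.
- by rewrite /s /= graph_mapE /= size_cat addn1.
- exact: conn_inc_hom.
- exact: conn_S_prj.
- exact: conn_inc_r.
- exact: conn_inc_prj.
- exact: conn_splitting.
- by move=> g; apply: conn_S.
exists hs'; apply: eq_represents rep => g.
by rewrite orient_unit // size_orient.
Qed.

End Connecting.

(** * Two-sided pairs as overlaps *)

Section TwoSided.

Variable Q : bound_quiver.
Implicit Types C : walk Q.

Local Open Scope nat_scope.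

(** The letters by which Y and X leave an end of E when the end is as in a
    quotient factorization of X and a submodule factorization of Y, and E is
    not all of both strings on that side. *)
Definition admissible_end (lY lX : option (letter Q)) : bool :=
  [&& if lY is Some l then l.2 == false else true,
      if lX is Some l then l.2 == true else true &
      isSome lX || isSome lY].

Definition ocompat (x y : option (letter Q)) : bool :=
  if x is Some l then if y is Some l' then compat l l' else true else true.

(** Crossing over at the position gives strings.  For a lazy E this is the
    requirement on the orientation of Y. *)
Definition coherent C C' s s' i j : bool :=
  ocompat (leave C s i) (leave C' (~~ s') j) && ocompat (leave C (~~ s) i) (leave C' s' j).

(** If E has positive length, the walks that cross over at its end use letters of
    the two strings only, and coherence is automatic: see [overlap_coherent]. *)
Definition two_sided_overlap W X q p m : Prop :=
  [/\ overlap W X q p m, admissible_end (leave W true (q + m)) (leave X true (p + m)),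
      admissible_end (leave W false q) (leave X false p) &
      coherent W X true true (q + m) (p + m)].

Lemma ocompatC x y : ocompat x y = ocompat y x.
Proof. by case: x y => [l|] [l'|] //=; rewrite compatC. Qed.

Lemma leave_ocompat C s i : is_string C -> ocompat (leave C s i) (leave C (~~ s) i).
Proof.
move=> hC; case E: (leave C s i) => [l|] //; case E': (leave C _ i) => [l'|] //=.
exact: leave_compat E E'.
Qed.

Lemma string_of_steps C :
  (forall l, onth C.2 0 = Some l -> lsrc l = C.1) ->
  (forall i l l', onth C.2 i = Some l -> onth C.2 i.+1 = Some l' -> string_step l l') ->
  is_string C.
Proof.
rewrite is_stringE; case: C => x w /= h0 h; apply/andP; split.
  by case: w h0 {h} => //= l w /(_ l erefl) ->.
elim: w {h0} h => //= l [|l' w] IH h //=.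
rewrite (h 0 l l') //=; apply: IH => i m m' h1 h2; apply: (h i.+1 m m' h1 h2).
Qed.

Lemma splice_compat C C' b b' : is_string (splice C C' b b') -> b <= size C.2 ->
  ocompat (leave C false b) (leave C' true b').
Proof.
move=> h hb; rewrite -(@leave_spliceF _ C C' b b') //.
have -> : leave C' true b' = leave (splice C C' b b') true b.
  by rewrite /= onth_splice // ltnn subnn.
by rewrite ocompatC; apply: (@leave_ocompat _ true).
Qed.

Lemma splice_string C C' b b' : is_string C -> is_string C' ->
  b <= size C.2 -> vertex_at C b = vertex_at C' b' ->
  ocompat (leave C false b) (leave C' true b') -> is_string (splice C C' b b').
Proof.
move=> hC hC' hb e h; apply: string_of_steps => [l|i l l'].
  rewrite onth_splice //; case: ifP => h0.
    by move/(@leave_verts _ C true 0 _ hC) => [<- _].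
  have -> : 0 - b + b' = b' by lia.
  move/(@leave_verts _ C' true b' _ hC') => [<- _]; rewrite -e.
  by have -> : b = 0 by lia.
rewrite !onth_splice //; case: ltnP => h1; case: ltnP => h2.
- by move=> h3 h4; apply: string_stepP h3 h4.
- have eb : b = i.+1 by lia.
  rewrite eb subnn add0n => h3 h4; move: h; rewrite eb /= h3 h4 /=.
  by rewrite /compat linvK.
- by lia.
- rewrite (_ : i.+1 - b + b' = (i - b + b').+1); last by lia.
  by move=> h3 h4; apply: string_stepP h3 h4.
Qed.

Lemma overlap_coherent W X q p m : is_string W -> is_string X -> 0 < m ->
  overlap W X q p m -> coherent W X true true (q + m) (p + m).
Proof.
move=> hW hX; case: m => // m _ [_ _ _ /(_ m (ltnSn m)) e]; rewrite /coherent !addnS /=.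
apply/andP; split.
  rewrite -e -[X in ocompat _ X]/(leave W (~~ true) (q + m).+1).
  exact: leave_ocompat.
rewrite e -[X in ocompat X _]/(leave X (~~ true) (p + m).+1) ocompatC.
exact: leave_ocompat.
Qed.

Lemma overlap_coherentF W X q p m : is_string W -> is_string X -> 0 < m ->
  overlap W X q p m -> coherent W X false false q p.
Proof.
move=> hW hX; case: m => // m _ [_ _ _ /(_ 0 isT)]; rewrite !addn0 => e.
have e' : leave W true q = leave X true p by [].
rewrite /coherent; apply/andP; split.
  by rewrite /= -[onth X.2 p]e; apply: (@leave_ocompat _ false).
by rewrite /= e ocompatC; apply: (@leave_ocompat _ false).
Qed.

Lemma first_letterE d C b : first_letter d (vertex_at C b, drop b C.2) =
  if leave C true b is Some l then l.2 == d else true.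
Proof.
by rewrite /first_letter /= -[in RHS](add0n b) -onth_drop; case: drop.
Qed.

Lemma last_letterE d C a : a <= size C.2 -> last_letter d (C.1, take a C.2) =
  if leave C false a is Some l then l.2 == ~~ d else true.
Proof.
case: a => [|a] h; first by rewrite take0.
rewrite /last_letter /=; case E: onth => [l|] /=; last first.
  by move: (onthTE C.2 a); rewrite E h.
rewrite (take_nth l) // (onth_nth l l _ _ E) rev_rcons.
by case: l.2; case: d.
Qed.

Lemma size_takeE C a : a <= size C.2 -> (0 < size (take a C.2)) = isSome (leave C false a).
Proof.
move=> h; rewrite size_takel //; case: a h => //= a.
by rewrite -onthTE; case: onth.
Qed.

Lemma size_dropE C b : (0 < size (drop b C.2)) = isSome (leave C true b).
Proof. by rewrite size_drop subn_gt0 /= -onthTE; case: onth. Qed.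

Lemma wend_sub C a b : a <= b -> b <= size C.2 ->
  wend (vertex_at C a, drop a (take b C.2)) = vertex_at C b.
Proof.
move=> hab hb; rewrite vertex_last /= size_drop size_takel //.
have [->|h] := eqVneq a b; first by rewrite subnn.
rewrite (_ : b - a = (b - a).-1.+1) ?vertex_atS /=; last by lia.
rewrite onth_drop onth_take (_ : (b - a).-1 + a = b.-1); last by lia.
rewrite ifT; last by lia.
rewrite (_ : b = b.-1.+1) ?vertex_atS /=; last by lia.
by move: (onthTE C.2 b.-1); case: onth => //= /esym; lia.
Qed.

(** Reversing Y turns the factorization around, so an oriented factorization is
    again given by two positions. *)
Lemma fact_orient_at o C a b : is_string C -> a <= b -> b <= size C.2 ->
  fact_orient o (fact_at C a b) =
  fact_at (orient o C) (orient_pos o C (if o then b else a))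
    (orient_pos o C (if o then a else b)).
Proof.
move=> hC hab hb; have ha := leq_trans hab hb; case: o => //=.
have E c : c <= size C.2 -> nth (winv C).1 (wverts (winv C)) (size C.2 - c) = vertex_at C c.
  move=> h; rewrite -[LHS]/(vertex_at (winv C) _).
  by rewrite (@vertex_orient _ true) //= ?leq_subr // subKn.
rewrite /fact_at !E //; congr Fact; rewrite /winv.
- rewrite -{1}[C.1]/(vertex_at C 0) -{1}[take a C.2]drop0 wend_sub //; congr pair.
  by rewrite map_take rev_take size_map.
- rewrite -[nth _ _ a]/(vertex_at C a) wend_sub //; congr pair.
  rewrite /= map_drop map_take rev_drop rev_take size_map size_takel ?size_map //.
  by rewrite take_drop; congr (drop _ (take _ _)); lia.
- rewrite -[nth _ _ b]/(vertex_at C b); congr pair.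
    have := @wend_sub C b (size C.2) hb (leqnn _).
    by rewrite take_size -vertex_last.
  by rewrite /= map_drop rev_drop size_map.
Qed.

Lemma sub_walkP C C' a b c d : a <= b -> b <= size C.2 -> c <= d -> d <= size C'.2 ->
  (vertex_at C a, drop a (take b C.2)) = (vertex_at C' c, drop c (take d C'.2)) <->
  d = c + (b - a) /\ overlap C C' a c (b - a).
Proof.
move=> hab hb hcd hd; split=> [[ev ew]|[ed [_ _ ev ew]]].
  have es := congr1 size ew; rewrite !size_drop !size_takel // in es.
  split; first by lia.
  split=> //; try lia.
  move=> t ht; have := congr1 (fun w => onth w t) ew.
  by rewrite !onth_drop !onth_take !ifT; try lia; rewrite ![t + _]addnC.
rewrite ev; congr pair; apply: eq_from_onth => t; rewrite !onth_drop !onth_take.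
case: ltnP => h; last by rewrite ifF //; lia.
rewrite ifT; last by lia.
by rewrite ![t + _]addnC ew //; lia.
Qed.

Section Pairs.

Variables X Y : string Q.
Implicit Types (T : fact_pair X Y) (o : bool).

Definition start_in_Y T o : nat := orient_pos o Y (if o then nat_of_ord T.2.2 else T.2.1).
Definition end_in_Y T o : nat := orient_pos o Y (if o then nat_of_ord T.2.1 else T.2.2).

Lemma factYE T o : T.2.1 <= T.2.2 ->
  factY T o = fact_at (orient o Y) (start_in_Y T o) (end_in_Y T o).
Proof.
by move=> h; rewrite /factY fact_orient_at ?stringP // -ltnS ltn_ord.
Qed.

Lemma two_sided_atP T o : two_sided_at T o <->
  [/\ T.1.1 <= T.1.2, T.2.1 <= T.2.2, end_in_Y T o = start_in_Y T o + (T.1.2 - T.1.1) &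
      two_sided_overlap (orient o Y) X (start_in_Y T o) T.1.1 (T.1.2 - T.1.1)].
Proof.
rewrite /two_sided_at /admissible.
case: (leqP T.1.1 T.1.2) => h1; last by split => // -[].
case: (leqP T.2.1 T.2.2) => h2; last by split => // -[].
rewrite /mid1 /mid2 factYE // /factX /quotient_fact /submodule_fact /fact_at /=.
set W := orient o Y; set q := start_in_Y T o; set q' := end_in_Y T o.
have hX : is_string X by apply: stringP.
have hW : is_string W by apply: orient_string; apply: stringP.
have hb : T.1.2 <= size (string_walk X).2 by rewrite -ltnS.
have ha := leq_trans h1 hb.
have hd' : T.2.2 <= size (string_walk Y).2 by rewrite -ltnS.
have hc' := leq_trans h2 hd'.
have hq' : q' <= size W.2 by rewrite size_orient /q' /end_in_Y orient_pos_le //; case: (o).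
have hqq : q <= q' by rewrite /q /q' /start_in_Y /end_in_Y /orient_pos; case: (o) => //; lia.
have hq := leq_trans hqq hq'.
rewrite -![nth _ _ _]/(vertex_at _ _) !last_letterE // !first_letterE !size_takeE //.
rewrite !size_dropE.
(* For a lazy middle term the conditions that F_1 E D_2 and F_2 E D_1 are
   strings amount to coherence at the junction. *)
have Ep (eW : q' = q + (T.1.2 - T.1.1)) (ov : overlap W X q T.1.1 (T.1.2 - T.1.1)) :
   (size (drop T.1.1 (take T.1.2 (string_walk X).2)) == 0) ==>
   is_string (wcat (vertex_at X T.1.2, drop T.1.2 (string_walk X).2)
               (wcat (vertex_at X T.1.1, drop T.1.1 (take T.1.2 (string_walk X).2)) (W.1, take q W.2))) &&
   is_string (wcat (vertex_at W q', drop q' W.2)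
       (wcat (vertex_at X T.1.1, drop T.1.1 (take T.1.2 (string_walk X).2)) ((string_walk X).1, take T.1.1 (string_walk X).2)))
   <-> coherent W X true true q' T.1.2.
  rewrite size_drop size_takel //; case: (posnP (T.1.2 - T.1.1)) => h0; last first.
    split=> //= _; have := overlap_coherent hW hX h0 ov.
    by rewrite -eW subnKC.
  rewrite /=; rewrite h0 addn0 in eW.
  have eX : T.1.2 = T.1.1 :> nat by lia.
  rewrite eX eW (_ : drop T.1.1 (take T.1.1 _) = [::]); last first.
    by apply/eqP; rewrite -size_eq0 size_drop size_takel ?subnn.
  rewrite /wcat /= !cats0.
  have [_ _ ev _] := ov.
  rewrite -[(W.1, _)]/(splice W X q T.1.1) -[(_, _ ++ drop q _)]/(splice X W T.1.1 q).
  split=> [/andP[s1 s2]|/andP[s1 s2]].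
    rewrite /coherent /= -/(leave W false q) -/(leave X false T.1.1).
    by rewrite (splice_compat s1) // ocompatC (splice_compat s2).
  by rewrite !splice_string // 1?ocompatC //; case/andP: (conj s1 s2).
rewrite /=; split.
  case/and4P => /and3P[/andP[g1 g2] /andP[g3 g4] /eqP/esym] /sub_walkP.
  move=> /(_ hqq hq' h1 hb)[e1 ov] hs g5 g6.
  have e2 : (T.1.2 - T.1.1 = q' - q)%N by rewrite e1 addKn.
  rewrite -e2 in ov; have eW : q' = q + (T.1.2 - T.1.1) by rewrite e2 subnKC.
  split=> //; split=> //; rewrite -?eW ?subnKC //.
  - by rewrite /admissible_end g4 g2 g6.
  - by rewrite /admissible_end g3 g1 g5.
  - exact/Ep.
case=> _ _ eW [ov]; rewrite -eW (subnKC h1) => /and3P[g1 g2 g3] /and3P[g4 g5 g6] hc.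
rewrite g1 g2 g3 g4 g5 g6 /= andbT; apply/andP; split; last exact/Ep.
apply/eqP/esym/sub_walkP => //; rewrite eW addKn; split=> //.
by rewrite subnKC.
Qed.


End Pairs.

End TwoSided.

Section TwoSidedExact.

Variables (k : fieldType) (Q : bound_quiver).

Lemma admissible_endP (lY lX : option (letter Q)) : admissible_end lY lX ->
  [/\ forall l, lY = Some l -> l.2 = false, forall l, lX = Some l -> l.2 = true &
      lX \/ lY].
Proof.
case/and3P=> h1 h2 h3; split=> [l e|l e|].
- by move: h1; rewrite e => /eqP.
- by move: h2; rewrite e => /eqP.
- by case: lX lY h3 {h1 h2} => [lX|] [lY|] //= _; auto.
Qed.

Lemma orient_mxF n : orient_mx k false n n = 1%:M.
Proof. by apply/matrixP=> i j; rewrite !mxE. Qed.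

(** The cocycle is the corner at the right end of E. *)
Lemma splice_exact (X Y : string Q) o p q m (C1 C2 : string Q) :
  two_sided_overlap (orient o Y) X q p m ->
  string_walk C1 = splice (orient o Y) X (q + m) (p + m) ->
  string_walk C2 = splice X (orient o Y) (p + m) (q + m) ->
  let s := @Sequence k Q (smod k Y) (smod k X) (dsum (smod k C1) (smod k C2))
    (row_mx (shift_mx k (wdim X) (wdim C1) p q (size (string_walk X).2 - p).+1)
            (shift_mx k (wdim X) (wdim C2) 0 0 (p + m).+1))
    (col_mx (shift_mx k (wdim C1) (wdim (orient o Y)) 0 0 (q + m).+1)
            (- shift_mx k (wdim C2) (wdim (orient o Y)) p q (size (orient o Y).2 - q).+1)
     *m orient_mx k o (wdim (orient o Y)) (wdim Y)) in
  exists h : short_exact s, represents (ext_class (Extension h))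
    (corner k Y X (~~ o) true (orient_pos o Y (q + m)) (p + m)).
Proof.
case: C1 C2 => [w1 h1] [w2 h2] [ov gr gl hc] /= e1 e2; move: h1 h2; rewrite {}e1 {}e2 => h1 h2.
set s := @Sequence _ _ _ _ _ _ _; set W := orient o Y in ov gr gl hc h1 h2 s *.
have [gr1 gr2 _] := admissible_endP gr; have [gl1 gl2 _] := admissible_endP gl.
pose C1 := splice W X (q + m) (p + m); pose C2 := splice X W (p + m) (q + m).
have hs := @oriented_exact k Q X Y false o s
  (row_mx (shift_mx k (wdim X) (wdim C1) p q (size (string_walk X).2 - p).+1)
            (shift_mx k (wdim X) (wdim C2) 0 0 (p + m).+1))
  (col_mx (shift_mx k (wdim C1) (wdim W) 0 0 (q + m).+1)
            (- shift_mx k (wdim C2) (wdim W) p q (size W.2 - q).+1))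
  (row_mx (shift_mx k (wdim W) (wdim C1) 0 0 (q + m).+1)
     (- shift_mx k (wdim W) (wdim C2) (q + m).+1 (p + m).+1 (size W.2 - (q + m))))
  (col_mx (shift_mx k (wdim C1) (wdim X) (q + m).+1 (p + m).+1
             (size (string_walk X).2 - (p + m)))
     (shift_mx k (wdim C2) (wdim X) 0 0 (p + m).+1))
  (corner k W X true true (q + m) (p + m)).
have [||g|||||g|hs' rep] := hs.
- by rewrite orient_mxF mul1mx.
- by [].
- rewrite /= /dsum_act mul_row_block !mulmx0 addr0 add0r mul_mx_row.
  rewrite opp_row_mx add_row_mx two_sided_inc1_hom // two_sided_inc2_hom //.
  exact: row_mx0.
- by rewrite mul_row_col mulmxN mulNmx opprK; apply: two_sided_S_prj.
- by rewrite mul_row_col; apply: two_sided_inc_r.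
- by rewrite mul_row_col mulmxN; apply: two_sided_inc_prj.
- rewrite !mul_col_row !mulmxN !mulNmx opprK add_block_mx.
  rewrite two_sided_split11 // two_sided_split12 //.
  rewrite two_sided_split21 // two_sided_split22 //.
  by rewrite -scalar_mx_block.
- rewrite /= /dsum_act mul_row_block !mulmx0 addr0 add0r !mul_mx_row.
  rewrite opp_row_mx add_row_mx; congr row_mx; first exact: two_sided_S1.
  by rewrite mulmxN mulNmx opprK addrC -two_sided_S2 // opprB.
exists hs'; apply: eq_represents rep => g.
rewrite orient_mxF mulmx1 orient_corner; last by case: ov; rewrite size_orient.
by rewrite addbT.
Qed.

Lemma two_sided_exact (X Y : string Q) (T : oriented X Y) :
  exists h : short_exact (two_sided_seq k T), represents (ext_class (Extension h))
    (corner k Y X (~~ (sval T).2) true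
       (if (sval T).2 then (sval T).1.2.1 : nat else (sval T).1.2.2) (sval T).1.1.2).
Proof.
case: T => -[t o] h; have [h1 h2 eW hov] := (two_sided_atP t o).1 h.
set T : oriented X Y := exist (fun To => two_sided_at To.1 To.2) (t, o) h.
pose f := factX t; pose f' := factY t o; pose Y' := orient o Y.
pose C1 := String (mid1_string T); pose C2 := String (mid2_string T).
have -> : two_sided_seq k T =
  @Sequence k Q (smod k Y) (smod k X) (dsum (smod k C1) (smod k C2))
    (row_mx
      (graph_map k X C1 (Fact (lazy (wend X)) (wcat (fF f) (fE f)) (fD f))
                      (Fact (lazy (wend X)) (wcat (fF f) (fE f)) (fD f')))
      (graph_map k X C2 (Fact (fF f) (wcat (fE f) (fD f)) (lazy (wstart X)))
                      (Fact (fF f') (wcat (fE f) (fD f)) (lazy (wstart X)))))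
    (col_mx
      (graph_map k C1 Y' (Fact (fF f) (wcat (fE f) (fD f')) (lazy (wstart Y')))
                       (Fact (fF f') (wcat (fE f) (fD f')) (lazy (wstart Y'))))
      (- graph_map k C2 Y' (Fact (lazy (wend Y')) (wcat (fF f') (fE f)) (fD f))
                         (Fact (lazy (wend Y')) (wcat (fF f') (fE f)) (fD f'))) *m
     orient_mx k o (wdim Y') (wdim Y)).
  by rewrite /C1 /C2 /f /f' /Y' /T; clear -h; case: o h.
set p := nat_of_ord t.1.1 in hov h1 eW; set m := (_ - p)%N in hov eW.
set q := start_in_Y t o in hov eW.
have [[hq hp _ _] _ _ _] := hov.
have eX : nat_of_ord t.1.2 = (p + m)%N by rewrite /m subnKC.
have ef : f = fact_at X p (p + m) by rewrite /f /factX eX.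
have ef' : f' = fact_at Y' q (q + m) by rewrite /f' factYE // eW.
have eE : fE f = fE f' by have /and4P[/and5P[_ _ _ _ /eqP]] := h.
have sD : size (wletters (fD f)) = p.
  by rewrite ef /= size_takel // (leq_trans _ hp) // leq_addr.
have sD' : size (wletters (fD f')) = q.
  by rewrite ef' /= size_takel // (leq_trans _ hq) // leq_addr.
have sE : size (wletters (fE f)) = m.
  by rewrite ef /= size_drop size_takel // addKn.
have sF : size (wletters (fF f)) = (size (string_walk X).2 - (p + m))%N.
  by rewrite ef /= size_drop.
have sF' : size (wletters (fF f')) = (size Y'.2 - (q + m))%N.
  by rewrite ef' /= size_drop.
have take_sub (T' : Type) (w : seq T') a : take a w ++ drop a (take (a + m) w) = take (a + m) w.
  by rewrite -{1}(take_takel w (leq_addr m a)) cat_take_drop.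
have e1 : string_walk C1 = splice Y' X (q + m) (p + m).
  rewrite /C1 /= /mid1 -/f -/f' eE ef' ef /wcat /splice /=.
  by rewrite take_sub.
have e2 : string_walk C2 = splice X Y' (p + m) (q + m).
  rewrite /C2 /= /mid2 -/f -/f' ef' ef /wcat /splice /=.
  by rewrite take_sub.
have := @splice_exact X Y o p q m C1 C2 hov e1 e2.
rewrite !graph_mapE /= -/(wletters _) !size_cat -!/(wletters _) sE sD sD' sF sF'.
have tail b c n : (b + c <= n)%N -> (c + (n - (b + c)) = n - b)%N by lia.
rewrite (tail _ _ _ hp) (tail _ _ _ hq).
have -> : orient_pos o Y (q + m) = if o then t.2.1 : nat else t.2.2.
  rewrite -eW /end_in_Y orient_posK //.
  by rewrite -ltnS; case: (o); rewrite ltn_ord.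
by rewrite eX.
Qed.

End TwoSidedExact.

(** * Maximal overlaps *)

Section Overlaps.

Variable Q : bound_quiver.
Implicit Types (C W : walk Q) (X Y : string Q).

Local Open Scope nat_scope.

Lemma overlap_extend_right C C' q p m l : overlap C C' q p m ->
  leave C true (q + m) = Some l -> leave C' true (p + m) = Some l ->
  overlap C C' q p m.+1.
Proof.
move=> [h1 h2 hv hw] eW eX; have := leaveT_lt eW; have := leaveT_lt eX.
split; rewrite ?addnS // => t; rewrite ltnS leq_eqVlt => /orP[/eqP->|]; last exact: hw.
by rewrite /= in eW eX; rewrite eW eX.
Qed.

Lemma overlap_extend_left C C' q p m l : is_string C -> is_string C' ->
  overlap C C' q p m ->
  leave C false q = Some l -> leave C' false p = Some l ->
  overlap C C' q.-1 p.-1 m.+1.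
Proof.
move=> hC hC' [h1 h2 hv hw] eC eC'.
have /andP[q0 _] := leaveF_le eC; have /andP[p0 _] := leaveF_le eC'.
have [_ e1] := leave_verts hC eC; have [_ e2] := leave_verts hC' eC'.
split; [lia|lia|by rewrite e1 e2|].
case=> [|t] ht; last first.
  rewrite (_ : q.-1 + t.+1 = q + t); last by lia.
  by rewrite (_ : p.-1 + t.+1 = p + t) ?hw //; lia.
rewrite !addn0; move: eC eC'; case: (q) q0 => // q' _; case: (p) p0 => // p' _ /=.
case: onth => //= x /Some_inj <-; case: onth => //= y /Some_inj e.
by rewrite (can_inj (@linvK Q) e).
Qed.

Lemma maximal_overlap_right C C' q p m0 : overlap C C' q p m0 -> exists m,
  overlap C C' q p m /\
  (forall l, leave C true (q + m) = Some l -> leave C' true (p + m) <> Some l).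
Proof.
move: {2}(size C.2 - m0) (leqnn (size C.2 - m0)) => n; elim: n m0 => [|n IH] m0 hn ov.
  exists m0; split=> // l /leaveT_lt; lia.
have [e|ne] := eqVneq (leave C true (q + m0)) (leave C' true (p + m0)).
  case E: (leave C true (q + m0)) => [l|]; last first.
    by exists m0; split=> // l; rewrite E.
  apply: (IH m0.+1); last exact: (overlap_extend_right ov E (etrans (esym e) E)).
  by have := leaveT_lt E; lia.
by exists m0; split=> // l e e'; rewrite e e' eqxx in ne.
Qed.

Lemma maximal_overlap_left C C' q p m : is_string C -> is_string C' ->
  overlap C C' q p m -> exists d, [/\ d <= q, d <= p,
    overlap C C' (q - d) (p - d) (d + m) &
    (forall l, leave C false (q - d) = Some l -> leave C' false (p - d) <> Some l)].
Proof.
move=> hC hC'; move: {2}q (leqnn q) => n; elim: n q p m => [|n IH] q p m hn ov.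
  exists 0; rewrite !subn0; split=> // l /leaveF_le; lia.
have [e|ne] := eqVneq (leave C false q) (leave C' false p).
  case E: (leave C false q) => [l|]; last first.
    by exists 0; rewrite !subn0; split=> // l; rewrite E.
  have ov' := overlap_extend_left hC hC' ov E (etrans (esym e) E).
  have /andP[q0 _] := leaveF_le E; rewrite e in E; have /andP[p0 _] := leaveF_le E.
  have [|d [d1 d2 ov1 hd]] := IH _ _ _ _ ov'; first by lia.
  have eq : q - d.+1 = q.-1 - d by lia.
  have ep : p - d.+1 = p.-1 - d by lia.
  exists d.+1; split; rewrite ?eq ?ep //; try lia.
  by rewrite addSnnS.
by exists 0; rewrite !subn0; split=> // l e e'; rewrite e e' eqxx in ne.
Qed.

(** The middle letter of a palindrome would be its own inverse, or the two
    middle letters would be inverse to each other.  Hence the orientation of Y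
    is determined by a middle term of positive length. *)
Lemma no_palindrome C p m : is_string C -> 0 < m -> p + m <= size C.2 ->
  ~ (forall t, t < m -> onth C.2 (p + t) = omap (@linv Q) (onth C.2 (p + (m.-1 - t)))).
Proof.
move=> hC m0 hm h; have := h (m.-1./2); have := odd_double_half m.-1.
have Some_onth i : i < size C.2 -> exists l, onth C.2 i = Some l.
  by rewrite -onthTE; case: onth => // l _; exists l.
move: (m.-1./2) => s; case: (odd m.-1) => e ht.
  have [|l hl] := Some_onth (p + s); first by lia.
  have [|l' hl'] := Some_onth (p + s).+1; first by lia.
  have hs : s < m by lia.
  move: (ht hs); rewrite (_ : p + (m.-1 - s) = (p + s).+1) ?hl ?hl' /=; last by lia.
  have /and3P[_ h' _] := string_stepP hC hl hl'.
  by move/Some_inj=> el; rewrite el linvK eqxx in h'.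
have [|l hl] := Some_onth (p + s); first by lia.
have hs : s < m by lia.
move: (ht hs); rewrite (_ : p + (m.-1 - s) = p + s) ?hl /=; last by lia.
by case: l {hl} => a [].
Qed.

Lemma coherentN C C' s s' i j :
  coherent C C' (~~ s) (~~ s') i j = coherent C C' s s' i j.
Proof. by rewrite /coherent !negbK andbC. Qed.

(** The corner at these letters does not vanish. *)
Definition active (lY lX : option (letter Q)) : bool :=
  (if lY is Some l then l.2 == false else false) ||
  (if lX is Some l then l.2 == true else false).

Section Gentle.

Hypothesis hQ : gentle Q.

(** Let the two strings part at this corner.  If both go on by letters of the
    same type, these letters would be equal, since both are compatible with a
    letter on the other side.  So the types differ, and as the corner does not
    vanish they are those of an admissible end. *)
Lemma active_admissible_end C C' s s' i j : coherent C C' s s' i j ->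
  active (leave C s i) (leave C' s' j) ->
  leave C (~~ s) i || leave C' (~~ s') j ->
  (forall l, leave C s i = Some l -> leave C' s' j <> Some l) ->
  is_string C -> is_string C' ->
  admissible_end (leave C s i) (leave C' s' j).
Proof.
move=> /andP[h1 h2] act hs hne hC hC'.
have h3 := leave_ocompat s i hC; have h4 := leave_ocompat s' j hC'.
move: h1 h2 h3 h4 hne act hs; rewrite /admissible_end /active.
case: (leave C s i) => [l|]; last first.
  by case: (leave C' s' j) => [l'|] //= _ _ _ _ _ -> _.
case: (leave C' s' j) => [l'|]; last by move=> _ _ _ _ _ /=; rewrite !orbF andbT.
move=> h1 h2 h3 h4 hne act hs.
have same : l.2 <> l'.2.
  move=> e; apply: (hne l erefl); congr Some; apply/esym.
  case: (leave C (~~ s) i) h2 h3 hs => [l1|] /= h2 h3.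
    by move=> _; apply: (compat_same_type hQ (l := l1)); rewrite // compatC.
  case: (leave C' (~~ s') j) h1 h4 => [l1|] //= h1 h4 _.
  by apply: (compat_same_type hQ (l := l1)); rewrite // compatC.
by case: l l' same {h1 h2 h3 h4 hne hs} act => [a []] [b []].
Qed.

End Gentle.

End Overlaps.

(** * The span of a family *)

Section Span.

Variables (k : fieldType) (V : lmodType k) (I : finType) (b : I -> V).

Definition in_span v := exists c : {ffun I -> k}, v = \sum_i c i *: b i.

Lemma in_span0 : in_span 0.
Proof. by exists [ffun=> 0]; rewrite big1 // => i _; rewrite ffunE scale0r. Qed.

Lemma in_spanD v w : in_span v -> in_span w -> in_span (v + w).
Proof.
move=> [c ->] [c' ->]; exists [ffun i => c i + c' i]; rewrite -big_split.
by apply: eq_bigr => i _; rewrite ffunE scalerDl.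
Qed.

Lemma in_spanZ x v : in_span v -> in_span (x *: v).
Proof.
move=> [c ->]; exists [ffun i => x * c i]; rewrite scaler_sumr.
by apply: eq_bigr => i _; rewrite ffunE scalerA.
Qed.

Lemma in_span_gen i : in_span (b i).
Proof.
exists [ffun j => (j == i)%:R]; rewrite (bigD1 i) //= big1 => [|j /negPf h].
  by rewrite ffunE eqxx scale1r addr0.
by rewrite ffunE h scale0r.
Qed.

End Span.

(** * Classes of corners *)

Section CornerClasses.

Variables (k : fieldType) (Q : bound_quiver) (hQ : gentle Q) (X Y : string Q).
Implicit Types (o s : bool) (p q m i j : nat).

Lemma overlap_cobound o q p m : overlap (orient o Y) X q p m ->
  @cobound k Q (smod k Y) (smod k X) (fun g =>
    corner k Y X (~~ o) true (orient_pos o Y (q + m)) (p + m) g +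
    corner k Y X o false (orient_pos o Y q) p g).
Proof.
move=> ov; have [h1 h2 _ hw] := ov; set W := orient o Y in ov h1 hw.
pose OY := orient_mx k o (wdim Y) (wdim W).
exists (OY *m shift_mx k (wdim W) (wdim X) q p m.+1) => g.
have hY := stringP Y.
have -> : act (smod k Y) g *m (OY *m shift_mx k (wdim W) (wdim X) q p m.+1) =
   OY *m (string_act k W g *m shift_mx k (wdim W) (wdim X) q p m.+1).
  by rewrite !mulmxA [in RHS]orient_act.
rewrite -mulmxA -mulmxBr shift_boundary ?addnS //=.
- rewrite mulmxDr !orient_corner ?addbT ?addbF //; first by rewrite size_orient in h1; lia.
  by rewrite size_orient in h1.
- by move=> t; rewrite ltnS => ht; apply: overlap_vertex ov ht.
Qed.

(** The two corners make up the coboundary of the matrix unit at (i, j). *)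
Lemma corner_cobound s s' i j : (i <= size (string_walk Y).2)%N ->
  (j <= size (string_walk X).2)%N -> vertex_at Y i = vertex_at X j ->
  @cobound k Q (smod k Y) (smod k X) (fun g =>
    corner k Y X s s' i j g + corner k Y X (~~ s) (~~ s') i j g).
Proof.
move=> hi hj hv; pose o := s (+) s'.
have ov : overlap (orient o Y) X (orient_pos o Y i) j 0.
  split; rewrite ?addn0 ?size_orient ?orient_pos_le //.
  by rewrite vertex_orient ?stringP ?orient_pos_le // orient_posK.
apply: cobound_ext (overlap_cobound ov) => g; rewrite !addn0 orient_posK // /o.
by clear; case: s'; rewrite ?addbT ?addbF ?negbK // addrC.
Qed.

Lemma corner_inactive s s' i j g :
  ~~ active (leave Y s i) (leave X s' j) -> corner k Y X s s' i j g = 0.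
Proof.
rewrite /active negb_or => /andP[h1 h2]; apply: corner0 => a e.
  by rewrite e in h2.
by rewrite e in h1.
Qed.

Lemma two_sided_of_overlap o p q m : two_sided_overlap (orient o Y) X q p m ->
  exists T : fact_pair X Y, [/\ two_sided_at T o, T.1.1 = p :> nat, T.1.2 = (p + m)%N :> nat,
     T.2.1 = orient_pos o Y (if o then q + m else q)%N :> nat &
     T.2.2 = orient_pos o Y (if o then q else q + m)%N :> nat].
Proof.
move=> h; have [[hq hp _ _] _ _ _] := h; rewrite size_orient in hq.
have hp2 : (p + m < wdim X)%N by rewrite ltnS.
have hp1 : (p < wdim X)%N by rewrite ltnS (leq_trans _ hp) // leq_addr.
have hq2 : (orient_pos o Y (if o then q + m else q)%N < wdim Y)%N.
  by rewrite ltnS orient_pos_le //; case: (o) => //; lia.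
have hq1 : (orient_pos o Y (if o then q else q + m)%N < wdim Y)%N.
  by rewrite ltnS orient_pos_le //; case: (o) => //; lia.
exists ((Ordinal hp1, Ordinal hp2), (Ordinal hq2, Ordinal hq1)); split=> //=.
have es : start_in_Y ((Ordinal hp1, Ordinal hp2), (Ordinal hq2, Ordinal hq1)) o = q.
  rewrite /start_in_Y /=; case: (o); rewrite orient_posK //; lia.
have ee : end_in_Y ((Ordinal hp1, Ordinal hp2), (Ordinal hq2, Ordinal hq1)) o = (q + m)%N.
  rewrite /end_in_Y /=; case: (o); rewrite orient_posK //; lia.
apply/two_sided_atP; rewrite es ee /= addKn; split=> //.
  exact: leq_addr.
by rewrite /orient_pos; case: (o); lia.
Qed.

(** A middle term of positive length would be a palindrome.  For a lazy middle
    term, if both orientations are possible then the letters leaving the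
    position in X and in Y are pairwise compatible, so there are at most two of
    them; as there is one on either side whichever way the sides are matched,
    both belong to the same string. *)
Lemma two_orientations (T : fact_pair X Y) o : two_sided_at T o -> two_sided_at T (~~ o) ->
  [/\ T.1.1 = T.1.2 :> nat, T.2.1 = T.2.2 :> nat &
    (forall s, leave Y s T.2.2 = None) \/ (forall s, leave X s T.1.2 = None)].
Proof.
move=> /two_sided_atP[h1 h2 h3 h4] /two_sided_atP[_ _ h3' h4'].
have [ov gr gl hc] := h4; have [ov' gr' gl' hc'] := h4'.
have hX := stringP X; have hY := stringP Y.
have hb : (T.1.2 <= size (string_walk X).2)%N by rewrite -ltnS.
have hd : (T.2.2 <= size (string_walk Y).2)%N by rewrite -ltnS.
have m0 : T.1.1 = T.1.2 :> nat.
  apply/eqP; rewrite eqn_leq h1 /= leqNgt -subn_gt0; apply/negP=> hm.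
  apply: (@no_palindrome _ X T.1.1 _ hX hm); first by rewrite subnKC.
  move=> t ht; have [_ _ _ hw] := ov; have [_ _ _ hw'] := ov'.
  rewrite -hw // -hw'; last by lia.
  case E: (leave (orient o Y) true (start_in_Y T o + t)) => [l|]; last first.
    by case: ov => hq _ _ _; move/leaveT_None: E; lia.
  rewrite -!/(leave _ true _) E.
  have hq : (start_in_Y T o + t <= size (string_walk Y).2)%N.
    by have := leaveT_lt E; rewrite size_orient; lia.
  have hq' : (start_in_Y T (~~ o) + ((T.1.2 - T.1.1).-1 - t) <= size (string_walk Y).2)%N.
    by case: ov' => + _ _ _; rewrite size_orient; lia.
  move: E; rewrite !leave_orient // !addbT negbK => E.
  rewrite (_ : orient_pos (~~ o) Y _ = move (~~ o) (orient_pos o Y (start_in_Y T o + t))).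
    by move/leave_back: E; rewrite negbK => -> /=; rewrite linvK.
  move: h3 h3' hq hq' ht h1 h2; rewrite /orient_pos /start_in_Y /end_in_Y /orient_pos /move.
  by case: (o) => /=; lia.
have e0 : (T.1.2 - T.1.1 = 0)%N by rewrite m0 subnn.
have n0 : T.2.1 = T.2.2 :> nat.
  move: h3; rewrite e0 addn0 /start_in_Y /end_in_Y /orient_pos; case: (o) => //; lia.
split=> //; move: gr gl hc gr' gl' hc'; rewrite e0 !addn0 m0.
have sW o' : start_in_Y T o' = orient_pos o' Y T.2.2.
  by rewrite /start_in_Y n0; case: o'.
have lW o' s' : leave (orient o' Y) s' (start_in_Y T o') = leave Y (o' (+) s') T.2.2.
  by rewrite sW leave_orient ?orient_pos_le // orient_posK.
rewrite /coherent -![~~ true]/false !lW !addbT !addbF negbK.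
have := leave_ocompat o T.2.2 hY; have := leave_ocompat true T.1.2 hX.
rewrite -[~~ true]/false; set lX := leave X true _; set lX' := leave X false _.
set lY' := leave Y o _; set lY := leave Y (~~ o) _ => cX cY.
move=> /and3P[_ _ a1] /and3P[_ _ a2] /andP[c1 c2] /and3P[_ _ a3] /and3P[_ _ a4] /andP[c3 c4].
have none (x y z : option (letter Q)) : ocompat x y -> ocompat x z -> ocompat y z ->
    ~~ [&& isSome x, isSome y & isSome z].
  case: x y z => [x|] [y|] [z|] //= h h' h''.
  by case: (compat_triangle hQ h h' h'').
have n1 := none _ _ _ c2 cY (etrans (ocompatC _ _) c4).
have n3 := none _ _ _ c2 c3 cX.
have n4 := none _ _ _ c3 cY (etrans (ocompatC _ _) c1).
have {none} n2 := none _ _ _ cX (etrans (ocompatC _ _) c4) (etrans (ocompatC _ _) c1).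
have hYN : lY = None -> lY' = None -> forall s, leave Y s T.2.2 = None.
  by rewrite /lY /lY' => e e' []; case: (o) e e'.
have hXN : lX = None -> lX' = None -> forall s, leave X s T.1.2 = None by move=> ? ? [].
move: n1 n2 n3 n4 a1 a2 a3 a4 hYN hXN; clear.
by case: lX => [?|]; case: lX' => [?|]; case: lY => [?|]; case: lY' => [?|] //=; auto.
Qed.

End CornerClasses.

Section CornersSpan.

Variables (k : fieldType) (Q : bound_quiver) (hQ : gentle Q) (X Y : string Q).
Implicit Types (s : bool) (p q m i j : nat).

Definition two_sided_cochain (T : oriented X Y) :=
  corner k Y X (~~ (sval T).2) true
    (if (sval T).2 then (sval T).1.2.1 : nat else (sval T).1.2.2) (sval T).1.1.2.

Definition connecting_cochain (T : connecting X Y) (g : vertex Q + arrow Q) :=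
  unit_cochain k (wdim Y) (wdim X) (sval T).1.1 (orient_pos (sval T).2 Y 0)
    (orient_pos (sval T).1.2 X (size (string_walk X).2)) g.

Variables (o : two_sided X Y -> oriented X Y)
  (b : connecting X Y + two_sided X Y -> Ext1 (smod k Y) (smod k X)).
Hypothesis ho : forall T, (sval (o T)).1 = sval T.
Hypothesis hb : forall T, represents (b (inr T)) (two_sided_cochain (o T)).

Notation in_span := (in_span b).
Notation cobound D := (@cobound k Q (smod k Y) (smod k X) D).
Notation represents v D := (@represents k Q (smod k Y) (smod k X) v D).

(** The orientation chosen for the pair may be the opposite one.  Then X or Y is
    lazy, and reversing the orientation leaves the corner unchanged if it is Y,
    and changes the sign of its class if it is X. *)
Lemma two_sided_in_span (T : fact_pair X Y) oT : two_sided_at T oT ->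
  exists2 v, in_span v & represents v
    (corner k Y X (~~ oT) true (if oT then T.2.1 : nat else T.2.2) T.1.2).
Proof.
move=> hT; have exT : [exists o, two_sided_at T o] by apply/existsP; exists oT.
pose T' : two_sided X Y := exist (fun T : fact_pair X Y => [exists o, two_sided_at T o]) T exT.
have := hb T'; have := ho T'.
have : two_sided_at (sval (o T')).1 (sval (o T')).2 := valP (o T').
rewrite /two_sided_cochain; case: (sval (o T')) => t o' /= hT' et; rewrite {t}et in hT' *.
have [->|ne] := eqVneq o' oT; first by exists (b (inr T')); [apply: in_span_gen|].
have eo : o' = ~~ oT by case: o' oT ne {hT hT'} => [] [].
rewrite {o' ne}eo in hT' *; have [e1 e2 el] := two_orientations hQ hT hT'.
rewrite e2 !if_same negbK => rep.
case: el => hN.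
  exists (b (inr T')); first exact: in_span_gen.
  apply: eq_represents rep => -[] //= a; apply: eq_nat_mx => u w _ _.
  by rewrite /corner_entry !hN.
exists (-1 *: b (inr T')); first exact/in_spanZ/in_span_gen.
apply: represents_trans (representsZ (-1) rep) _.
have [ov _ _ _] := (two_sided_atP T oT).1 hT.
have [hd _ _ hov] := (two_sided_atP T oT).1 hT; have [[_ hj ev _] _ _ _] := hov.
apply: cobound_ext (coboundN (@corner_cobound k Q X Y (~~ oT) true T.2.2 T.1.2 _ _ _)).
- move=> g; rewrite scaleN1r negbK opprD addrC; congr (- _ - _).
  case: g => //= a; apply: eq_nat_mx => u w _ _.
  by rewrite /corner_entry !hN.
- by rewrite -ltnS.
- by rewrite -ltnS.
- move: ev; rewrite /start_in_Y e2 if_same e1 vertex_orient ?orient_posK ?orient_pos_le ?stringP //.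
  + by rewrite -ltnS.
  + by rewrite -ltnS.
Qed.

(** Push the corner along the overlap to the right end of a maximal one.  There
    it is minus the corner at the left end, modulo coboundaries.  If neither
    vanishes, both ends are admissible. *)
Lemma oriented_corner_in_span oT q p :
  (q <= size (string_walk Y).2)%N -> (p <= size (string_walk X).2)%N ->
  vertex_at (orient oT Y) q = vertex_at X p ->
  coherent (orient oT Y) X true true q p ->
  exists2 v, in_span v & represents v (corner k Y X (~~ oT) true (orient_pos oT Y q) p).
Proof.
move=> hq hp hv hc; set W := orient oT Y in hv hc.
have hX := stringP X; have hW : is_string W by apply/orient_string/stringP.
have ov0 : overlap W X q p 0 by split; rewrite ?addn0 ?size_orient.
have [m1 [ov1 max1]] := maximal_overlap_right ov0.
have [d [d1 d2 ov max2]] := maximal_overlap_left hW hX ov1.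
have eq : (q - d + (d + m1) = q + m1)%N by lia.
have ep : (p - d + (d + m1) = p + m1)%N by lia.
have z0 : (d + m1 = 0)%N -> m1 = 0%N /\ d = 0%N by clear; lia.
have z1 : (0 < d + m1)%N -> (q + m1 <> 0)%N by move: d1; clear; lia.
suff [v hv' rep] : exists2 v, in_span v & represents v
    (corner k Y X (~~ oT) true (orient_pos oT Y (q + m1)) (p + m1)).
  exists v => //; apply: represents_trans rep _.
  have c0 := overlap_cobound k ov0; have c1 := overlap_cobound k ov1.
  apply: cobound_ext (coboundD c1 (coboundN c0)) => g.
  by rewrite !addn0 opprD addrACA subrr addr0.
have cob := overlap_cobound k ov; rewrite eq ep in cob.
have hqm : (q + m1 <= size (string_walk Y).2)%N by case: ov1; rewrite size_orient.
have hqd : (q - d <= size (string_walk Y).2)%N by lia.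
have zero : forall D, cobound D -> exists2 v, in_span v & represents v D.
  by move=> D hD; exists 0; [apply: in_span0|apply: represents0].
have lR : leave W true (q + m1) = leave Y (~~ oT) (orient_pos oT Y (q + m1)).
  by rewrite leave_orient // addbT.
have lL : leave W false (q - d) = leave Y oT (orient_pos oT Y (q - d)).
  by rewrite leave_orient // addbF.
case aR: (active (leave W true (q + m1)) (leave X true (p + m1))); last first.
  apply: zero; apply: cobound_ext (cobound0 (smod k Y) (smod k X)) => g.
  by rewrite corner_inactive // -lR aR.
case aL: (active (leave W false (q - d)) (leave X false (p - d))); last first.
  apply: zero; apply: cobound_ext cob => g.
  by rewrite [X in _ + X]corner_inactive ?addr0 // -lL aL.
have act (x y : option (letter Q)) : active x y -> x || y by case: x y => [x|] [y|].
have cR : coherent W X true true (q + m1) (p + m1).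
  case: (posnP (d + m1)) => h0; last first.
    by have := overlap_coherent hW hX h0 ov; rewrite eq ep.
  by rewrite (z0 h0).1 !addn0.
have cL : coherent W X false false (q - d) (p - d).
  case: (posnP (d + m1)) => h0; last exact: overlap_coherentF ov.
  rewrite (z0 h0).2 !subn0.
  by rewrite -(coherentN W X true true) in hc.
have neighbour : (0 < d + m1)%N -> leave W false (q + m1) /\ leave W true (q - d).
  move=> h0; have [h1 _ _ _] := ov; have hqW : (q + m1 <= size W.2)%N by rewrite -eq.
  split.
    case E: (leave W false _) => //; move/(leaveF_None hqW): E.
    by move/(z1 h0).
  case E: (leave W true _) => //; move/leaveT_None: E; rewrite leqNgt.
  by rewrite (leq_trans _ h1) // -addn1 leq_add2l.
have gR : admissible_end (leave W true (q + m1)) (leave X true (p + m1)).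
  apply: (active_admissible_end hQ cR aR) => //.
  case: (posnP (d + m1)) => h0; last by rewrite (neighbour h0).1.
  move: (act _ _ aL); by rewrite (z0 h0).1 (z0 h0).2 !addn0 !subn0.
have gL : admissible_end (leave W false (q - d)) (leave X false (p - d)).
  apply: (active_admissible_end hQ cL aL) => //.
  case: (posnP (d + m1)) => h0; last by rewrite (neighbour h0).2.
  move: (act _ _ aR); by rewrite (z0 h0).1 (z0 h0).2 !addn0 !subn0.
have hts : two_sided_overlap W X (q - d) (p - d) (d + m1) by split; rewrite ?eq ?ep.
have [T [hT _ e2 e3 e4]] := two_sided_of_overlap hts.
have := two_sided_in_span hT; rewrite e2 e3 e4 eq ep.
by case: (oT).
Qed.

(** The sides are normalized by passing to the opposite corner, at the cost of a
    sign, so that the side in X is the right one. *)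
Lemma corner_in_span s s' i j :
  (i <= size (string_walk Y).2)%N -> (j <= size (string_walk X).2)%N ->
  vertex_at Y i = vertex_at X j -> coherent Y X s s' i j ->
  exists2 v, in_span v & represents v (corner k Y X s s' i j).
Proof.
move=> hi hj hv hc; wlog e : s s' hc / s' = true.
  move=> h; case: s' hc => hc; first exact: h.
  have [|v hv1 rep] := h (~~ s) true _ erefl.
    by rewrite -[true]/(~~ false) coherentN.
  exists (-1 *: v); first exact: in_spanZ.
  apply: represents_trans (representsZ (-1) rep) _.
  apply: cobound_ext (coboundN (corner_cobound k s false hi hj hv)) => g.
  by rewrite scaleN1r opprD addrC.
rewrite {s'}e -[s]negbK in hc *; have := @oriented_corner_in_span (~~ s) (orient_pos (~~ s) Y i) j.
rewrite orient_posK // vertex_orient ?orient_posK ?orient_pos_le ?stringP //.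
move=> h; apply: h => //; move: hc.
by rewrite /coherent !leave_orient ?orient_pos_le // !orient_posK // addbT addbF negbK.
Qed.

End CornersSpan.

(** * Entries of cochains *)

Section Entries.

Variables (k : fieldType) (Q : bound_quiver).
Implicit Types C : walk Q.

Lemma entryM m n p (A : 'M[k]_(m, n)) (B : 'M[k]_(n, p)) i j :
  entry (A *m B) i j = \sum_(l < n) entry A i l * entry B l j.
Proof.
rewrite [LHS]/entry; case: insubP => [i' _ ei|hi]; last first.
  by rewrite big1 // => l _; rewrite /entry insubN // mul0r.
case: insubP => [j' _ ej|hj]; last first.
  rewrite big1 // => l _; rewrite [X in _ * X](_ : _ = 0) ?mulr0 //.
  by rewrite /entry [insub j]insubN //; case: insub.
by rewrite mxE; apply: eq_bigr => l _; rewrite -ei -ej !entryE.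
Qed.

Lemma entry_sends C a i j : entry (string_act k C (inr a)) i j = (sends C a i j)%:R.
Proof.
case h: (sends C a i j).
  by have [hi hj] := sends_range h; rewrite string_act_arrow entry_nat_mx // h.
rewrite /entry; case: insubP => // i' _ ei; case: insubP => // j' _ ej.
by rewrite string_act_arrow mxE ei ej h.
Qed.

Lemma mulmx_sends C m (B : 'M[k]_(m, wdim C)) a u w w' : is_string C ->
  sends C a w w' -> entry (B *m string_act k C (inr a)) u w' = entry B u w.
Proof.
move=> hC h; have [hw _] := sends_range h; rewrite entryM (bigD1 (Ordinal hw)) //=.
rewrite entry_sends h mulr1 big1 ?addr0 // => l hl; rewrite entry_sends.
case h': (sends C a l w'); last by rewrite mulr0.
by case/eqP: hl; apply: val_inj; apply: sends_inj h' h.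
Qed.

Lemma mulmx_sends0 C m (B : 'M[k]_(m, wdim C)) a u w' :
  (forall w, ~~ sends C a w w') -> entry (B *m string_act k C (inr a)) u w' = 0.
Proof.
by move=> h; rewrite entryM big1 // => l _; rewrite entry_sends (negPf (h l)) mulr0.
Qed.

Lemma sends_mulmx C m (B : 'M[k]_(wdim C, m)) a u u' w : is_string C ->
  sends C a u u' -> entry (string_act k C (inr a) *m B) u w = entry B u' w.
Proof.
move=> hC h; have [_ hu] := sends_range h; rewrite entryM (bigD1 (Ordinal hu)) //=.
rewrite entry_sends h mul1r big1 ?addr0 // => l hl; rewrite entry_sends.
case h': (sends C a u l); last by rewrite mul0r.
by case/eqP: hl; apply: val_inj; apply: sends_fun h' h.
Qed.

Lemma sends_mulmx0 C m (B : 'M[k]_(wdim C, m)) a u w :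
  (forall u', ~~ sends C a u u') -> entry (string_act k C (inr a) *m B) u w = 0.
Proof.
by move=> h; rewrite entryM big1 // => l _; rewrite entry_sends (negPf (h l)) mul0r.
Qed.

Lemma image_or_none C a i : (exists j, sends C a i j) \/ (forall j, ~~ sends C a i j).
Proof.
case: (boolP [exists j : 'I_(wdim C), sends C a i j]) => [/existsP[j h]|h].
  by left; exists j.
right=> j; apply: contra h => h; have [_ hj] := sends_range h.
by apply/existsP; exists (Ordinal hj).
Qed.

Lemma preimage_or_none C a j : (exists i, sends C a i j) \/ (forall i, ~~ sends C a i j).
Proof.
case: (boolP [exists i : 'I_(wdim C), sends C a i j]) => [/existsP[i h]|h].
  by left; exists i.
right=> i; apply: contra h => h; have [hi _] := sends_range h.
by apply/existsP; exists (Ordinal hi).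
Qed.

Lemma vertex_mulmx C m (B : 'M[k]_(wdim C, m)) x u w :
  string_act k C (inl x) *m B = B -> entry B u w != 0 -> vertex_at C u = x.
Proof.
move=> <-; apply: contraNeq => h; rewrite entryM big1 // => l _.
rewrite string_act_vertex /entry; case: insubP => [u' _ eu|]; last by rewrite mul0r.
rewrite valK mxE -/(vertex_at C _) eu (negPf h) andbF.
by rewrite mul0r.
Qed.

Lemma mulmx_vertex C m (B : 'M[k]_(m, wdim C)) x u w :
  B *m string_act k C (inl x) = B -> entry B u w != 0 -> vertex_at C w = x.
Proof.
move=> <-; apply: contraNeq => h; rewrite entryM big1 // => l _.
rewrite string_act_vertex {2}/entry valK; case: insubP => [w' _ ew|]; last by rewrite mulr0.
rewrite mxE; case: eqP => [->|_]; last by rewrite mulr0.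
by rewrite ew (negPf h) mulr0.
Qed.

Lemma entry_range m n (B : 'M[k]_(m, n)) u w : entry B u w != 0 -> (u < m)%N /\ (w < n)%N.
Proof.
rewrite /entry; case: insubP => [u' hu _|_]; last by rewrite eqxx.
by case: insubP => [w' hw _|_]; last rewrite eqxx.
Qed.

Lemma corner_entry_out C C' s s' i j a : leave C' s' j = Some (a, true) ->
  corner_entry k C C' s s' i j a i (move s' j) = 1.
Proof.
move=> h; rewrite /corner_entry h !eqxx /=.
have /eqP/negPf := move_neq h; move=> ->.
by rewrite !andbF subr0.
Qed.

Lemma corner_entry_in C C' s s' i j a : leave C s i = Some (a, false) ->
  corner_entry k C C' s s' i j a (move s i) j = -1.
Proof.
move=> h; rewrite /corner_entry h !eqxx /=.
have /eqP/negPf := move_neq h; move=> ->.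
by rewrite !andbF sub0r.
Qed.

Lemma corner_entry_support C C' s s' i j a u w :
  corner_entry k C C' s s' i j a u w != 0 ->
  [/\ leave C' s' j = Some (a, true), u = i & w = move s' j] \/
  [/\ leave C s i = Some (a, false), u = move s i & w = j].
Proof.
rewrite /corner_entry; case: (and3P (b1 := _ == Some (a, true))) => [[/eqP ? /eqP ? /eqP ?]|_].
  by left.
case: and3P => [[/eqP ? /eqP ? /eqP ?]|_]; first by right.
by rewrite subr0 eqxx.
Qed.

End Entries.

(** * The classes generate *)

Section Generation.

Variables (k : fieldType) (Q : bound_quiver) (hQ : gentle Q) (X Y : string Q).
Variables (o : two_sided X Y -> oriented X Y)
  (b : connecting X Y + two_sided X Y -> Ext1 (smod k Y) (smod k X)).
Hypothesis ho : forall T, (sval (o T)).1 = sval T.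
Hypothesis hbt : forall T, represents (b (inr T)) (two_sided_cochain k (o T)).
Hypothesis hbc : forall T, represents (b (inl T)) (connecting_cochain k T).

Notation in_span := (in_span b).
Notation cochain := (vertex Q + arrow Q -> 'M[k]_(wdim Y, wdim X)).
Notation represents v D := (@represents k Q (smod k Y) (smod k X) v D).

Let hX := stringP X.
Let hY := stringP Y.

(** The multiple [c] of [om] can be subtracted from D: this removes the given
    entry from the support of D and adds none. *)
Definition reducible (D : cochain) a u w := exists (v : Ext1 (smod k Y) (smod k X)) om c,
  [/\ in_span v, represents v om, forall x, om (inl x) = 0,
     forall a' u' w', entry (om (inr a')) u' w' != 0 ->
       entry (D (inr a')) u' w' = c * entry (om (inr a')) u' w' &
     entry (om (inr a)) u w != 0].

Lemma corner_reducible (D : cochain) a u w s s' i j c :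
  (i <= size (string_walk Y).2)%N -> (j <= size (string_walk X).2)%N ->
  vertex_at Y i = vertex_at X j -> coherent Y X s s' i j ->
  (forall a', leave X s' j = Some (a', true) -> entry (D (inr a')) i (move s' j) = c) ->
  (forall a', leave Y s i = Some (a', false) -> entry (D (inr a')) (move s i) j = - c) ->
  corner_entry k Y X s s' i j a u w != 0 -> (u < wdim Y)%N -> (w < wdim X)%N ->
  reducible D a u w.
Proof.
move=> hi hj hv hc h1 h2 h3 hu hw.
have [v hv1 hv2] := corner_in_span hQ ho hbt hi hj hv hc.
exists v, (corner k Y X s s' i j), c; split=> //=; last by rewrite entry_nat_mx.
move=> a' u' w' hne; have [hu' hw'] := entry_range hne.
rewrite entry_nat_mx // in hne *.
have [[e1 -> ->]|[e1 -> ->]] := corner_entry_support hne.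
  by rewrite h1 // corner_entry_out // mulr1.
by rewrite h2 // corner_entry_in // mulrN1.
Qed.

Section Entry.

Variables (v : Ext1 (smod k Y) (smod k X)) (D : cochain).
Hypotheses (hD : represents v D) (hD0 : forall x, D (inl x) = 0).
Variables (a : arrow Q) (u w : nat).
Hypothesis hne : entry (D (inr a)) u w != 0.

Let hu : (u < wdim Y)%N. Proof. by case: (entry_range hne). Qed.
Let hw : (w < wdim X)%N. Proof. by case: (entry_range hne). Qed.

Let hvY : vertex_at Y u = src a.
Proof. by have [h _ _] := normalized_cocycleP hD hD0; apply: vertex_mulmx (h a) hne. Qed.

Let hvX : vertex_at X w = tgt a.
Proof. by have [_ h _] := normalized_cocycleP hD hD0; apply: mulmx_vertex (h a) hne. Qed.

Let hrel c d : zero_rel c d -> forall u w,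
  entry (D (inr d) *m string_act k X (inr c)) u w =
  - entry (string_act k Y (inr d) *m D (inr c)) u w.
Proof.
move=> h u' w'; have [_ _ /(_ c d h)/eqP] := normalized_cocycleP hD hD0.
rewrite addr_eq0 => /eqP /= ->.
by rewrite /entry; case: insubP => [? _ _|_]; rewrite ?oppr0 //;
  case: insubP => [? _ _|_]; rewrite ?oppr0 // mxE.
Qed.

(** The entry is tied by the cocycle condition to one in D(c); the two together
    form a corner, which is coherent since ca lies in I. *)
Lemma reducible_after c w' : zero_rel c a -> sends X c w w' -> reducible D a u w.
Proof.
move=> hca hs; have := hrel hca u w'; rewrite (mulmx_sends _ _ hX hs).
case: (image_or_none Y a u) => [[u' hs']|nex]; last first.
  by rewrite sends_mulmx0 // oppr0 => /eqP; rewrite (negPf hne).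
rewrite (sends_mulmx _ _ hY hs') => e.
have [s lY eu] := sends_backP _ _ _ _ hs'; have [s' lX ew] := sendsP _ _ _ _ hs.
have [_ hu'] := sends_range hs'; have [_ hv'] := sends_verts hY hs'.
apply: (@corner_reducible _ _ _ _ s s' u' w (- entry (D (inr a)) u w)) => //.
- by rewrite hv' hvX.
- rewrite /coherent lY lX /=; apply/andP; split.
    have := leave_ocompat s' w hX; rewrite lX; case: leave => //= l.
    by rewrite compatC (compat_transfer hQ _ hca) compatC.
  have := leave_ocompat s u' hY; rewrite lY; case: leave => //= l.
  by rewrite compatC -(compat_transfer hQ _ hca).
- by move=> a'; rewrite lX => -[<-]; rewrite -ew e opprK.
- by move=> a'; rewrite lY => -[<-]; rewrite -eu opprK.
- by rewrite eu (corner_entry_in _ _ _ _ lY) oppr_eq0 oner_eq0.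
Qed.

(** The entry is tied by the cocycle condition to one in D(d), as for
    [reducible_after]. *)
Lemma reducible_before d u' : zero_rel a d -> sends Y d u' u -> reducible D a u w.
Proof.
move=> had hs; have := hrel had u' w; rewrite (sends_mulmx _ _ hY hs).
case: (preimage_or_none X a w) => [[w' hs']|nex]; last first.
  by rewrite mulmx_sends0 // => /esym/eqP; rewrite oppr_eq0 (negPf hne).
rewrite (mulmx_sends _ _ hX hs') => e.
have [s lY eu] := sends_backP _ _ _ _ hs; have [s' lX ew] := sendsP _ _ _ _ hs'.
have [hw' _] := sends_range hs'; have [hv' _] := sends_verts hX hs'.
apply: (@corner_reducible _ _ _ _ s s' u w' (entry (D (inr a)) u w)) => //.
- by rewrite hv' hvY.
- rewrite /coherent lY lX /=; apply/andP; split.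
    have := leave_ocompat s' w' hX; rewrite lX; case: leave => //= l.
    by rewrite compatC (compat_transfer hQ _ had) compatC.
  have := leave_ocompat s u hY; rewrite lY; case: leave => //= l.
  by rewrite compatC -(compat_transfer hQ _ had).
- by move=> a'; rewrite lX => -[<-]; rewrite -ew.
- by move=> a'; rewrite lY => -[<-]; rewrite -eu.
- by rewrite ew (corner_entry_out _ _ _ _ lX) oner_eq0.
Qed.

(* From here on the entry is not tied to another one by the cocycle condition, so
   that the letters leaving w in X, other than a^-1, are compatible with a^-1,
   and those leaving u in Y, other than a, are compatible with a. *)
Hypothesis no_after : forall c w', zero_rel c a -> ~~ sends X c w w'.
Hypothesis no_before : forall d u', zero_rel a d -> ~~ sends Y d u' u.

Let compatX s l : leave X s w = Some l -> l = (a, false) \/ compat l (a, false).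
Proof.
move=> h; have [hv _] := leave_verts hX h; rewrite hvX in hv.
case: l h hv => c [] h hv; rewrite compatE.
  right; rewrite hv eqxx /=; apply/negP=> hz; have := no_after (move s w) hz.
  by move/negP; apply; apply/sendsP; exists s.
have [->|ne] := eqVneq c a; first by left.
by right; rewrite hv eqxx.
Qed.

Let compatY s l : leave Y s u = Some l -> l = (a, true) \/ compat l (a, true).
Proof.
move=> h; have [hv _] := leave_verts hY h; rewrite hvY in hv.
case: l h hv => c [] h hv; rewrite compatE.
  have [->|ne] := eqVneq c a; first by left.
  by right; rewrite hv eqxx.
right; rewrite hv eqxx /=; apply/negP=> hz; have := no_before (move s u) hz.
by move/negP; apply; apply/sends_backP; exists s.
Qed.

Let ocompatE (x : option (letter Q)) l : (forall l', x = Some l' -> compat l' l) ->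
  ocompat x (Some l).
Proof. by case: x => //= l' h; apply: h. Qed.

Let some_end (C : walk Q) i l : is_string C ->
  (forall s l', leave C s i = Some l' -> compat l' l) -> exists s, leave C s i = None.
Proof.
move=> hC h; case E: (leave C true i) => [l1|]; last by exists true.
case E': (leave C false i) => [l2|]; last by exists false.
have h1 := h _ _ E; have h2 := h _ _ E'; rewrite compatC in h1; rewrite compatC in h2.
by case: (compat_triangle hQ h1 h2 (leave_compat hC E E')).
Qed.

(** The corner at (u', w) has the given entry on the side of Y.  On the side of X
    take the letter a^-1 if it leaves w, so that the strings overlap there;
    otherwise w is an end of X, and take the free side. *)
Lemma reducible_of_sends_Y u' : sends Y a u u' -> reducible D a u w.
Proof.
move=> hs; have [s lY eu] := sends_backP _ _ _ _ hs.
have [_ hu'] := sends_range hs; have [_ hv'] := sends_verts hY hs.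
have [s' lX hc] : exists2 s', (forall c, leave X s' w <> Some (c, true)) &
    coherent Y X s s' u' w.
  have cY := leave_ocompat s u' hY; rewrite lY in cY.
  rewrite /coherent lY.
  have [/existsP[s' /eqP lX]|nl] := boolP [exists s', leave X s' w == Some (a, false)].
    exists s'; first by move=> c; rewrite lX.
    have := leave_ocompat s' w hX; rewrite lX => ->.
    by rewrite ocompatC cY.
  have hX' s' l : leave X s' w = Some l -> compat l (a, false).
    move=> e; case: (compatX e) => // el; case/existsP: nl; exists s'.
    by rewrite e el.
  have [s' e] := some_end hX hX'; exists s'; first by move=> c; rewrite e.
  rewrite e ocompatC ocompatE ?[ocompat _ None]ocompatC // => l.
  exact: hX'.
apply: (@corner_reducible _ _ _ _ s s' u' w (- entry (D (inr a)) u w)) => //.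
- by rewrite hv' hvX.
- by move=> a' /lX.
- by move=> a'; rewrite lY => -[<-]; rewrite -eu opprK.
- by rewrite eu (corner_entry_in _ _ _ _ lY) oppr_eq0 oner_eq0.
Qed.

(** As for [reducible_of_sends_Y], with the given entry on the side of X. *)
Lemma reducible_of_sends_X w' : sends X a w' w -> reducible D a u w.
Proof.
move=> hs; have [s' lX ew] := sendsP _ _ _ _ hs.
have [hw' _] := sends_range hs; have [hv' _] := sends_verts hX hs.
have [s lY hc] : exists2 s, (forall c, leave Y s u <> Some (c, false)) &
    coherent Y X s s' u w'.
  have cX := leave_ocompat s' w' hX; rewrite lX in cX.
  rewrite /coherent lX.
  have [/existsP[s /eqP lY]|nl] := boolP [exists s, leave Y s u == Some (a, true)].
    exists s; first by move=> c; rewrite lY.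
    have := leave_ocompat s u hY; rewrite lY => h.
    by rewrite cX ocompatC h.
  have hY' s l : leave Y s u = Some l -> compat l (a, true).
    move=> e; case: (compatY e) => // el; case/existsP: nl; exists s.
    by rewrite e el.
  have [s e] := some_end hY hY'; exists s; first by move=> c; rewrite e.
  by rewrite e /= ocompatE // => l; apply: hY'.
apply: (@corner_reducible _ _ _ _ s s' u w' (entry (D (inr a)) u w)) => //.
- by rewrite hv' hvY.
- by move=> a'; rewrite lX => -[<-]; rewrite -ew.
- by move=> a' /lY.
- by rewrite ew (corner_entry_out _ _ _ _ lX) oner_eq0.
Qed.

(** Nothing maps along a at u or at w, so all letters at u are compatible
    with a and all letters at w with a^-1: both positions are ends, and a
    connects them. *)
Lemma reducible_isolated : (forall u', ~~ sends Y a u u') -> (forall w', ~~ sends X a w' w) ->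
  reducible D a u w.
Proof.
move=> nY nX.
have hX' s l : leave X s w = Some l -> compat l (a, false).
  move=> e; case: (compatX e) => // el; case/negP: (nX (move s w)).
  by apply/sends_backP; exists s; rewrite // e el.
have hY' s l : leave Y s u = Some l -> compat l (a, true).
  move=> e; case: (compatY e) => // el; case/negP: (nY (move s u)).
  by apply/sendsP; exists s; rewrite // e el.
(* For a lazy string the end counts as the right end of X and the left end of Y,
   which is the orientation admitted for connecting arrows. *)
pose oX := isSome (leave X true w); pose oY := isSome (leave Y false u).
have eX : w = orient_pos oX X (size (string_walk X).2).
  have [s e] := some_end hX hX'; rewrite /oX /orient_pos subnn.
  have hw' : (w <= size (string_walk X).2)%N by rewrite -ltnS.
  case E: (leave X true w) => [l|] /=; last by move/leaveT_None: E; lia.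
  by case: s e => e; [rewrite e in E|apply/(leaveF_None hw')].
have eY : u = orient_pos oY Y 0.
  have [s e] := some_end hY hY'; rewrite /oY /orient_pos subn0.
  have hu' : (u <= size (string_walk Y).2)%N by rewrite -ltnS.
  case E: (leave Y false u) => [l|] /=; last by move/(leaveF_None hu'): E.
  by case: s e => e; [move/leaveT_None: e; lia|rewrite e in E].
pose X' := orient oX X; pose Y' := orient oY Y.
have hX1 : is_string X' by apply: orient_string.
have hY1 : is_string Y' by apply: orient_string.
have vX : vertex_at X' (size X'.2) = tgt a.
  by rewrite size_orient vertex_orient // -eX hvX.
have vY : vertex_at Y' 0 = src a by rewrite vertex_orient // -eY hvY.
pose A : walk Q := (tgt a, [:: (a, false)]).
have hA : is_string A by rewrite /A /is_string /lsrc /= eqxx.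
have hXa : is_string (splice X' A (size X'.2) 0).
  apply: splice_string => //; rewrite -[leave A true 0]/(Some (a, false)).
  rewrite size_orient leave_orient // -eX.
  by apply: ocompatE => l /hX'.
have hconn : is_string (conn_walk X Y (a, oX, oY)).
  have sz : size (splice X' A (size X'.2) 0).2 = (size X'.2).+1.
    by rewrite size_splice // addn1.
  have -> : conn_walk X Y (a, oX, oY) =
      splice (splice X' A (size X'.2) 0) Y' (size X'.2).+1 0.
    rewrite /splice /conn_walk /wcat /= !drop0 take_size; congr (_, _ ++ _).
    by rewrite take_oversize // size_cat addn1.
  apply: splice_string => //; first by rewrite sz.
    by rewrite vertex_atS onth_splice // ltnn subnn vY.
  rewrite -[leave _ false _]/(omap (@linv Q) (onth (splice X' A (size X'.2) 0).2 (size X'.2))).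
  rewrite onth_splice // ltnn subnn -[omap _ _]/(Some (a, true)) ocompatC.
  rewrite leave_orient // -eY.
  by apply: ocompatE => l /hY'.
have lazyX : (size (string_walk X).2 == 0)%N -> ~~ oX.
  by move=> /eqP h; rewrite /oX leave_last // h.
have lazyY : (size (string_walk Y).2 == 0)%N -> ~~ oY.
  move=> /eqP h; rewrite /oY; have hu' : (u < (size (string_walk Y).2).+1)%N by [].
  by rewrite h in hu'; case: (u) hu'.
have hT : is_connecting X Y (a, oX, oY).
  apply/and5P; split=> //=; first by rewrite vertex_last vX.
  - by rewrite -vY.
  - by apply/implyP.
  - by apply/implyP.
pose T : connecting X Y := exist (fun T => is_connecting X Y T) _ hT.
exists (b (inl T)), (connecting_cochain k T), (entry (D (inr a)) u w); split=> //.
- exact: in_span_gen.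
- move=> a' u' w' h; have [hu' hw'] := entry_range h.
  move: h; rewrite /connecting_cochain /= -eX -eY entry_nat_mx //.
  case: and3P => [[/eqP-> /eqP-> /eqP->]|_]; last by rewrite eqxx.
  by rewrite mulr1.
- by rewrite /connecting_cochain /= -eX -eY entry_nat_mx // !eqxx oner_eq0.
Qed.

End Entry.

Lemma reducible_entry v (D : cochain) a u w : represents v D -> (forall x, D (inl x) = 0) ->
  entry (D (inr a)) u w != 0 -> reducible D a u w.
Proof.
move=> hD hD0 hne.
case: (boolP [exists c, zero_rel c a && [exists w' : 'I_(wdim X), sends X c w w']]).
  by case/existsP=> c /andP[hc /existsP[w' hs]]; apply: (reducible_after hD hD0 hne hc hs).
rewrite negb_exists => /forallP h1.
case: (boolP [exists d, zero_rel a d && [exists u' : 'I_(wdim Y), sends Y d u' u]]).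
  by case/existsP=> d /andP[hd /existsP[u' hs]]; apply: (reducible_before hD hD0 hne hd hs).
rewrite negb_exists => /forallP h2.
have no_after c w' : zero_rel c a -> ~~ sends X c w w'.
  move=> hc; apply/negP=> hs; have [_ hw'] := sends_range hs.
  have := h1 c; rewrite hc /= => /existsP; apply.
  by exists (Ordinal hw').
have no_before d u' : zero_rel a d -> ~~ sends Y d u' u.
  move=> hd; apply/negP=> hs; have [hu' _] := sends_range hs.
  have := h2 d; rewrite hd /= => /existsP; apply.
  by exists (Ordinal hu').
case: (image_or_none Y a u) => [[u' hs]|nY].
  exact: (reducible_of_sends_Y hD hD0 hne no_after hs).
case: (preimage_or_none X a w) => [[w' hs]|nX].
  exact: (reducible_of_sends_X hD hD0 hne no_before hs).
exact: (reducible_isolated hD hD0 hne no_after no_before nY nX).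
Qed.

Lemma in_span_all v : in_span v.
Proof.
have [D hD hD0] := normalized_cocycle v.
pose supp (D : cochain) := [set t : arrow Q * ('I_(wdim Y) * 'I_(wdim X)) |
  D (inr t.1) t.2.1 t.2.2 != 0].
move: {2}#|supp D| (leqnn #|supp D|) => n; elim: n v D hD hD0 => [|n IH] v D hD hD0 hn.
  suff -> : v = 0 by apply: in_span0.
  apply: represents_inj hD _; apply: represents0.
  apply: cobound_ext (cobound0 (smod k Y) (smod k X)) => -[x|a]; first by rewrite hD0.
  apply/matrixP=> i j; rewrite mxE; apply/esym/eqP.
  move: hn; rewrite leqn0 cards_eq0 => /eqP/setP/(_ (a, (i, j))).
  by rewrite !inE => /negbFE.
have [h0|[t]] := set_0Vmem (supp D).
  by apply: (IH v D) => //; rewrite h0 cards0.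
case: t => a [i j]; rewrite inE /= => hne.
have := @reducible_entry v D a i j hD hD0; rewrite entryE => /(_ hne).
case=> v' [om [c [hv' rep' om0 hsupp hne']]].
rewrite entryE in hne'.
have -> : v = (v + - c *: v') + c *: v' by rewrite scaleNr subrK.
apply: in_spanD; last exact: in_spanZ.
apply: (IH _ (fun g => D g + - c *: om g)).
- by apply: representsD hD _; apply: representsZ.
- by move=> x; rewrite hD0 om0 scaler0 addr0.
rewrite -ltnS; apply: leq_trans hn; apply: proper_card.
have sub : supp (fun g => D g + - c *: om g) \subset supp D.
  apply/subsetP=> -[a' [i' j']]; rewrite !inE /= !mxE.
  apply: contraNneq => e; rewrite e add0r mulNr.
  have [->|ne] := eqVneq (om (inr a') i' j') 0; first by rewrite mulr0 oppr0.
  by have := hsupp a' i' j'; rewrite !entryE e => /(_ ne) <-; rewrite oppr0.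
rewrite properE sub; apply/subsetPn; exists (a, (i, j)); rewrite !inE //= !mxE.
have := hsupp a i j; rewrite !entryE => /(_ hne') ->.
by rewrite mulNr subrr eqxx.
Qed.

End Generation.

(** * Corners of two-sided pairs *)

Section AdmissibleCorners.

Variables (k : fieldType) (Q : bound_quiver) (hQ : gentle Q) (X Y : string Q).
Implicit Types (s : bool) (i j p q m : nat) (a : arrow Q).

Let hX := stringP X.
Let hY := stringP Y.

(** The corners at both ends of the middle term of a two-sided pair are of this
    kind.  The last condition says that X or Y goes on beyond the position on
    the other side. *)
Definition admissible_corner s s' i j : Prop :=
  [/\ admissible_end (leave Y s i) (leave X s' j), coherent Y X s s' i j &
      leave Y (~~ s) i || leave X (~~ s') j].

Lemma admissible_corner_zero_rel s s' i j c a : admissible_corner s s' i j ->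
  leave X s' j = Some (c, true) -> leave Y s i = Some (a, false) -> zero_rel c a.
Proof.
move=> [_ /andP[h1 h2] h3] lX lY.
have := leave_ocompat s i hY; have := leave_ocompat s' j hX.
move: h1 h2 h3; rewrite lX lY.
case: (leave Y (~~ s) i) => [l|] /=.
  by move=> _ h2 _ _ h4; apply: (compat_zero_rel hQ h2); rewrite compatC.
case: (leave X (~~ s') j) => [l|] //= h1 _ _ h4 _.
by apply: (@compat_zero_rel _ hQ l); rewrite compatC.
Qed.

Lemma corner_sends s s' i j a u w : corner_entry k Y X s s' i j a u w != 0 ->
  (exists u', sends Y a u u') \/ (exists w', sends X a w' w).
Proof.
case/corner_entry_support=> -[h -> ->].
  by right; exists j; apply/sendsP; exists s'.
by left; exists i; apply/sends_backP; exists s.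
Qed.

Lemma admissible_corner_no_direct s s' i j a t : admissible_corner s s' i j ->
  leave X s' j = Some (a, true) -> leave Y t i <> Some (a, true).
Proof.
move=> [/admissible_endP[g _ _] /andP[_ h] _] lX lY.
have [e|ne] := eqVneq t s; first by have := g _ (etrans (congr1 (leave Y ^~ i) (esym e)) lY).
have e : t = ~~ s by case: t s ne {lY h g} => [] [].
by move: h; rewrite -e lX lY /= compatxx.
Qed.

Lemma admissible_corner_no_inverse s s' i j a t : admissible_corner s s' i j ->
  leave Y s i = Some (a, false) -> leave X t j <> Some (a, false).
Proof.
move=> [/admissible_endP[_ g _] /andP[h _] _] lY lX.
have [e|ne] := eqVneq t s'; first by have := g _ (etrans (congr1 (leave X ^~ j) (esym e)) lX).
have e : t = ~~ s' by case: t s' ne {lX h g} => [] [].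
by move: h; rewrite -e lX lY /= compatxx.
Qed.


(** The entries of an admissible corner determine the position, and the sides
    except on a string that is lazy.  If, for instance, the sides in Y differ, a
    letter d^-1 leaving i in Y on one of them would give ad in I at one corner
    and ad outside I at the other, where a is the letter leaving j in X. *)
Lemma admissible_corner_uniq s s' i j s2 s2' i2 j2 a u w :
  admissible_corner s s' i j -> admissible_corner s2 s2' i2 j2 ->
  corner_entry k Y X s s' i j a u w != 0 -> corner_entry k Y X s2 s2' i2 j2 a u w != 0 ->
  [/\ i = i2, j = j2 &
      (s' = s2' /\ (s = s2 \/ forall t, leave Y t i = None)) \/
      (s = s2 /\ forall t, leave X t j = None)].
Proof.
move=> g g2 /corner_entry_support[[l e1 e2]|[l e1 e2]]
  /corner_entry_support[[l2 e3 e4]|[l2 e3 e4]].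
- have ei : i = i2 by rewrite -e1.
  have ej : j = j2.
    by apply: (@sends_inj _ X a _ _ w hX); apply/sendsP; [exists s'|exists s2'].
  rewrite -{i2}ei -{j2}ej in g2 l2 e3 e4 *; have es := leave_uniq hX l l2; subst s2'.
  split=> //; left; split=> //.
  have [->|ne] := eqVneq s s2; first by left.
  have es2 : s2 = ~~ s by case: s s2 ne {g g2} => [] [].
  right; subst s2.
  have lN r : admissible_corner r s' i j -> admissible_corner (~~ r) s' i j -> leave Y r i = None.
    move=> gr [_ /andP[_ h] _]; case E: (leave Y r i) => [[d b]|] //.
    have eb : b = false by have [/admissible_endP[g0 _ _] _ _] := gr; apply: (g0 _ E).
    rewrite eb in E; move: h; rewrite negbK E l /= compat_id => /andP[_].
    by rewrite (admissible_corner_zero_rel gr l E).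
  have n1 := lN s g g2; have n2 : leave Y (~~ s) i = None by apply: lN; rewrite ?negbK.
  by move=> t; case: (eqVneq t s) => [->|ne'] //; case: t s ne' n1 n2 {ne g g2 lN} => [] [].
- have lY := leave_back l2; rewrite -e3 e1 in lY.
  by case: (admissible_corner_no_direct g l lY).
- have lY := leave_back l; rewrite -e1 e3 in lY.
  by case: (admissible_corner_no_direct g2 l2 lY).
- have ej : j = j2 by rewrite -e2.
  have ei : i = i2.
    by apply: (@sends_fun _ Y a u _ _ hY); apply/sends_backP; [exists s|exists s2].
  rewrite -{i2}ei -{j2}ej in g2 l2 e3 e4 *; have es := leave_uniq hY l l2; subst s2.
  split=> //.
  have [->|ne] := eqVneq s' s2'; first by left; split=> //; left.
  have es2 : s2' = ~~ s' by case: s' s2' ne {g g2} => [] [].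
  right; split=> //; subst s2'.
  have lN r : admissible_corner s r i j -> admissible_corner s (~~ r) i j -> leave X r j = None.
    move=> gr [_ /andP[h _] _]; case E: (leave X r j) => [[d b]|] //.
    have eb : b = true by have [/admissible_endP[_ g0 _] _ _] := gr; apply: (g0 _ E).
    rewrite eb in E; move: h; rewrite negbK E l /= compat_id => /andP[_].
    by rewrite (admissible_corner_zero_rel gr E l).
  have n1 := lN s' g g2; have n2 : leave X (~~ s') j = None by apply: lN; rewrite ?negbK.
  by move=> t; case: (eqVneq t s') => [->|ne'] //; case: t s' ne' n1 n2 {ne g g2 lN} => [] [].
Qed.

(** Entries between consecutive positions of an overlap belong to no admissible
    corner, since the letters leaving such a corner are of opposite types. *)
Lemma admissible_corner_inner s2 s2' i2 j2 s s' i j a : admissible_corner s2 s2' i2 j2 ->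
  leave Y s i = Some (a, true) -> leave X s' j = Some (a, true) ->
  corner_entry k Y X s2 s2' i2 j2 a i (move s' j) = 0.
Proof.
move=> g lY lX; apply/eqP; apply/negPn/negP => /corner_entry_support[[l e1 e2]|[l e1 e2]].
  have ej : j = j2.
    by apply: (@sends_inj _ X a _ _ (move s' j) hX); apply/sendsP; [exists s'|exists s2'].
  by rewrite e1 in lY; case: (admissible_corner_no_direct g l lY).
have lX' := leave_back lX; rewrite e2 in lX'.
by case: (admissible_corner_no_inverse g l lX').
Qed.

(** Such an entry is hit by the two positions it lies between, with opposite
    signs. *)
Lemma inner_entry s s' i j a (h : 'M[k]_(wdim Y, wdim X)) :
  leave Y s i = Some (a, true) -> leave X s' j = Some (a, true) ->
  entry (h *m string_act k X (inr a)) i (move s' j) -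
    entry (string_act k Y (inr a) *m h) i (move s' j) =
  entry h i j - entry h (move s i) (move s' j).
Proof.
move=> lY lX.
have sX : sends X a j (move s' j) by apply/sendsP; exists s'.
have sY : sends Y a i (move s i) by apply/sendsP; exists s.
by rewrite (mulmx_sends _ _ hX sX) (sends_mulmx _ _ hY sY).
Qed.

(** Of the two positions at which h is evaluated by the coboundary at an entry of
    the corner, only (i, j) exists. *)
Lemma admissible_corner_value s s' i j : (i < wdim Y)%N -> (j < wdim X)%N ->
  admissible_corner s s' i j -> exists a u w,
  [/\ (u < wdim Y)%N, (w < wdim X)%N, corner_entry k Y X s s' i j a u w != 0 &
    forall h : 'M[k]_(wdim Y, wdim X),
      entry (h *m string_act k X (inr a)) u w - entry (string_act k Y (inr a) *m h) u w =
      corner_entry k Y X s s' i j a u w * entry h i j].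
Proof.
move=> hi hj g; have [/admissible_endP[gY gX g0] _ _] := g.
case EX: (leave X s' j) => [[c b]|].
  have eb : b = true := gX _ EX; subst b.
  have [_ hm] := leave_range EX.
  exists c, i, (move s' j); rewrite (corner_entry_out _ _ _ _ EX) oner_eq0.
  split=> // h; rewrite mul1r.
  rewrite (@mulmx_sends _ _ _ _ _ _ _ j) //; last by apply/sendsP; exists s'.
  rewrite sends_mulmx0 ?subr0 // => u'; apply/negP=> /sendsP[t e _].
  exact: (admissible_corner_no_direct g EX e).
case EY: (leave Y s i) g0 => [[a b]|] //; rewrite EX; last by case.
have eb : b = false := gY _ EY; subst b; move=> _.
have [_ hm] := leave_range EY.
exists a, (move s i), j; rewrite (corner_entry_in _ _ _ _ EY) oppr_eq0 oner_eq0.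
split=> // h; rewrite mulN1r.
rewrite (@sends_mulmx _ _ _ _ _ _ _ i) //; last by apply/sends_backP; exists s.
rewrite mulmx_sends0 ?sub0r // => w'; apply/negP=> /sends_backP[t e _].
exact: (admissible_corner_no_inverse g EY e).
Qed.

Section Pair.

Variables (T : fact_pair X Y) (o : bool).
Hypothesis hT : two_sided_at T o.

Definition right_in_Y : nat := if o then T.2.1 : nat else T.2.2.
Definition left_in_Y : nat := if o then T.2.2 : nat else T.2.1.

Let hp2 : (T.1.2 <= size (string_walk X).2)%N. Proof. by rewrite -ltnS. Qed.
Let hr : (right_in_Y <= size (string_walk Y).2)%N.
Proof. by rewrite /right_in_Y -ltnS; case: (o); apply: ltn_ord. Qed.
Let hl : (left_in_Y <= size (string_walk Y).2)%N.
Proof. by rewrite /left_in_Y -ltnS; case: (o); apply: ltn_ord. Qed.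

Lemma admissible_corners : admissible_corner (~~ o) true right_in_Y T.1.2 /\
  admissible_corner o false left_in_Y T.1.1.
Proof.
have [h1 h2 h3 [ov gr gl hc]] := (two_sided_atP T o).1 hT.
have hW : is_string (orient o Y) by apply: orient_string.
set q := start_in_Y T o in h3 ov gr gl hc.
have eq : q = orient_pos o Y left_in_Y by [].
have eq' : (q + (T.1.2 - T.1.1))%N = orient_pos o Y right_in_Y by rewrite -h3.
have ep : (T.1.1 + (T.1.2 - T.1.1))%N = T.1.2 by rewrite subnKC.
have hcl : coherent (orient o Y) X false false q T.1.1.
  case: (posnP (T.1.2 - T.1.1)) => h0; last exact: overlap_coherentF ov.
  by move: hc; rewrite h0 !addn0 -(coherentN _ _ true true).
have nb : (0 < T.1.2 - T.1.1)%N -> leave X true T.1.1 /\ leave X false T.1.2.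
  move=> h0; split.
    case E: (leave X true _) => //; move/leaveT_None: E => E.
    by move: h0; rewrite subn_gt0 ltnNge (leq_trans hp2 E).
  by case E: (leave X false _) => //; move/(leaveF_None hp2): E h0 => ->.
have e0 : (T.1.2 - T.1.1 = 0)%N -> T.1.1 = T.1.2 :> nat by move: h1; clear; lia.
move: gr gl hc hcl; rewrite /coherent eq' ep eq !leave_orient ?orient_pos_le //.
rewrite -![~~ true]/false -![~~ false]/true !orient_posK // !addbT !addbF => gr gl hc hcl.
split; split=> //.
- by rewrite /coherent negbK.
- rewrite negbK; case: (posnP (T.1.2 - T.1.1)) => h0; last by rewrite (nb h0).2 orbT.
  have er : right_in_Y = left_in_Y.
    by rewrite -(orient_posK o hr) -eq' h0 addn0 eq orient_posK.
  have e1 := e0 h0.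
  by case/and3P: gl => _ _; rewrite er -e1 orbC.
- case: (posnP (T.1.2 - T.1.1)) => h0; last by rewrite (nb h0).1 orbT.
  have er : right_in_Y = left_in_Y.
    by rewrite -(orient_posK o hr) -eq' h0 addn0 eq orient_posK.
  have e1 := e0 h0.
  by case/and3P: gr => _ _; rewrite er -e1 orbC.
Qed.

(** An inverse letter of E is direct when walked backwards, so the hypothesis
    applies to it at the next position. *)
Lemma walk_along (h : 'M[k]_(wdim Y, wdim X)) :
  (forall s s' i j a, leave Y s i = Some (a, true) -> leave X s' j = Some (a, true) ->
     entry h i j = entry h (move s i) (move s' j)) ->
  entry h left_in_Y T.1.1 = entry h right_in_Y T.1.2.
Proof.
move=> inner; have [h1 h2 h3 [ov _ _ _]] := (two_sided_atP T o).1 hT.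
set q := start_in_Y T o in h3 ov; set m := (T.1.2 - T.1.1)%N in h3 ov.
have [hq hp _ hw] := ov.
have step t : (t <= m)%N ->
    entry h (orient_pos o Y q) T.1.1 = entry h (orient_pos o Y (q + t)) (T.1.1 + t).
  elim: t => [|t IH] ht; first by rewrite !addn0.
  rewrite IH; last exact: ltnW.
  case E: (leave X true (T.1.1 + t)) => [[a d]|]; last first.
    by move/leaveT_None: E; rewrite leqNgt (leq_trans _ hp) // ltn_add2l.
  have E' : leave (orient o Y) true (q + t) = Some (a, d) by rewrite -E; apply: hw.
  have htY : (q + t <= size (string_walk Y).2)%N.
    by have := leaveT_lt E'; rewrite size_orient => /ltnW.
  have mv := orient_pos_move E'; rewrite addbT /= -addnS in mv.
  rewrite leave_orient // addbT in E'.
  rewrite addnS in mv; rewrite !addnS mv -[(T.1.1 + t).+1]/(move true (T.1.1 + t)).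
  case: d E E' => E E'; first exact: inner E' E.
  have B := leave_back E; have B' := leave_back E'.
  by rewrite (inner _ _ _ _ _ B' B) (moveK E) (moveK E').
have := step m (leqnn m); rewrite -h3 /m subnKC //.
by rewrite /q /start_in_Y /end_in_Y !orient_posK.
Qed.

End Pair.

End AdmissibleCorners.

(** * Independence *)

Section Independence.

Variables (k : fieldType) (Q : bound_quiver) (hQ : gentle Q) (X Y : string Q).

Let hX := stringP X.
Let hY := stringP Y.

Lemma lazy_string (C : walk Q) i : (i <= size C.2)%N -> (forall t, leave C t i = None) ->
  size C.2 = 0%N.
Proof.
move=> hi h; have := h false; move/(leaveF_None hi) => h0.
by have := h true; move/leaveT_None; rewrite h0 leqn0 => /eqP.
Qed.

(** A letter a following a^-1, or preceding it, is excluded in the string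
    Y a^-1 X. *)
Lemma connecting_isolated (T : connecting X Y) a u w :
  entry (connecting_cochain k T (inr a)) u w != 0 ->
  (forall u', ~~ sends Y a u u') /\ (forall w', ~~ sends X a w' w).
Proof.
move=> h; have [hu hw] := entry_range h; move: h.
rewrite /connecting_cochain entry_nat_mx //; case: T => -[[a' oX] oY] /= hT.
case: and3P => [[/eqP-> /eqP-> /eqP->] _|_]; last by rewrite eqxx.
have /and5P[/= /eqP e1 /eqP e2 hC _ _] := hT.
set X' := orient oX X in e1; set Y' := orient oY Y in e2.
have hX' : is_string X' by apply: orient_string.
have hY' : is_string Y' by apply: orient_string.
have onthC i : onth (conn_walk X Y (a', oX, oY)).2 i =
    if (i < size X'.2)%N then onth X'.2 i
    else if i == size X'.2 then Some (a', false) else onth Y'.2 (i - (size X'.2).+1).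
  rewrite /= !onth_cat !size_cat addn1 ltnS; case: ltngtP => //= hi.
  by rewrite hi subnn.
split=> z; apply/negP.
  case/sendsP=> s; rewrite -(addKb oY s) -leave_orient //.
  case: (oY (+) s) => // h _.
  have o1 : onth (conn_walk X Y (a', oX, oY)).2 (size X'.2) = Some (a', false).
    by rewrite onthC ltnn eqxx.
  have o2 : onth (conn_walk X Y (a', oX, oY)).2 (size X'.2).+1 = Some (a', true).
    by rewrite onthC ltnNge leqnSn /= gtn_eqF // subnn; apply: h.
  by have /and3P[_ + _] := string_stepP hC o1 o2; rewrite /linv eqxx.
case/sends_backP=> s; rewrite -(addKb oX s) -leave_orient //.
case: (oX (+) s) => h _; first by rewrite leave_last ?size_orient in h.
move: h; rewrite -(size_orient oX) -/X'; case E: (size X'.2) => [|n] //=.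
case En: (onth X'.2 n) => [l|] //= -[el1 el2].
have o1 : onth (conn_walk X Y (a', oX, oY)).2 n = Some l by rewrite onthC E ltnSn.
have o2 : onth (conn_walk X Y (a', oX, oY)).2 n.+1 = Some (a', false).
  by rewrite onthC E ltnn eqxx.
have /and3P[_ + _] := string_stepP hC o1 o2.
by rewrite /linv el1 el2 eqxx.
Qed.

Lemma connecting_inj (T T' : connecting X Y) a u w :
  entry (connecting_cochain k T (inr a)) u w != 0 ->
  entry (connecting_cochain k T' (inr a)) u w != 0 -> T = T'.
Proof.
move=> h; have [hu hw] := entry_range h; move: h; rewrite /connecting_cochain !entry_nat_mx //.
case: T T' => -[[a1 oX] oY] /= hT [[[a2 oX'] oY'] /= hT'].
case: and3P => [[/eqP ea1 /eqP eu /eqP ew] _|_]; last by rewrite eqxx.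
case: and3P => [[/eqP ea2 /eqP eY /eqP eX] _|_]; last by rewrite eqxx.
rewrite eu in eY; rewrite ew in eX; move: hT hT'; rewrite -ea1 -ea2 => hT hT'.
 have /and5P[/= _ _ _ /implyP h1 /implyP h2] := hT.
have /and5P[/= _ _ _ /implyP h1' /implyP h2'] := hT'.
have eoX : oX = oX'.
  have [h0|h0] := eqVneq (size (string_walk X).2) 0%N.
    by move: (h1 (introT eqP h0)) (h1' (introT eqP h0)); case: (oX); case: (oX').
  by move: eX h0; rewrite /orient_pos subnn; case: (oX); case: (oX') => // e /eqP[].
have eoY : oY = oY'.
  have [h0|h0] := eqVneq (size (string_walk Y).2) 0%N.
    by move: (h2 (introT eqP h0)) (h2' (introT eqP h0)); case: (oY); case: (oY').
  by move: eY h0; rewrite /orient_pos subn0; case: (oY); case: (oY') => // e /eqP[].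
by apply: val_inj; rewrite /= eoX eoY.
Qed.

(** Of two pairs with the same orientation whose overlaps end together, the
    letters on the left of the shorter one would have to agree. *)
Lemma two_sided_end_inj (S T : fact_pair X Y) o :
  two_sided_at S o -> two_sided_at T o ->
  right_in_Y S o = right_in_Y T o -> S.1.2 = T.1.2 :> nat -> S = T.
Proof.
move=> hS hT; wlog le : S T hS hT / (S.1.2 - S.1.1 <= T.1.2 - T.1.1)%N.
  move=> W eY eX; have [le|/ltnW le] := leqP (S.1.2 - S.1.1) (T.1.2 - T.1.1); first exact: W.
  by apply/esym/W.
move=> eY eX; have [s1 s2 s3 [ovS _ glS _]] := (two_sided_atP S o).1 hS.
have [t1 t2 t3 [ovT _ _ _]] := (two_sided_atP T o).1 hT.
have eEnd : end_in_Y S o = end_in_Y T o.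
  by move: eY; rewrite /end_in_Y /right_in_Y; case: (o) => ->.
have em : (S.1.2 - S.1.1 = T.1.2 - T.1.1)%N.
  apply/eqP; rewrite eqn_leq le leqNgt /=; apply/negP=> lt.
  have [_ _ _ hw] := ovT; set n := (T.1.2 - T.1.1)%N in lt hw t3 *.
  have hn : ((n - (S.1.2 - S.1.1)).-1 < n)%N by move: lt; clear; lia.
  have := hw _ hn.
  have arith b c x y m : (b = c -> b = x + m -> c = y + n -> m < n ->
      x = (y + (n - m).-1).+1)%N by clear; lia.
  have lS : leave (orient o Y) false (start_in_Y S o) = omap (@linv Q)
      (onth (orient o Y).2 (start_in_Y T o + (n - (S.1.2 - S.1.1)).-1)).
    rewrite (_ : start_in_Y S o = (start_in_Y T o + (n - (S.1.2 - S.1.1)).-1).+1) //.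
    exact: arith eEnd s3 t3 lt.
  have lX : leave X false S.1.1 = omap (@linv Q)
      (onth (string_walk X).2 (T.1.1 + (n - (S.1.2 - S.1.1)).-1)).
    have eS : nat_of_ord S.1.1 = (T.1.1 + (n - (S.1.2 - S.1.1)).-1).+1.
      by apply: arith eX _ _ lt; rewrite ?/n subnKC.
    by rewrite [in LHS]eS.
  move=> e; rewrite e -lX in lS; move: glS; rewrite lS.
  by case/admissible_endP; case: (leave X false S.1.1) => [l|] h1 h2 [] //; have := h2 _ erefl; rewrite (h1 _ erefl).
have eStart : start_in_Y S o = start_in_Y T o.
  by move: eEnd s3 t3 em; clear; lia.
have eX1 : S.1.1 = T.1.1 :> nat by move: eX em s1 t1; clear; lia.
have bY (i : 'I_(wdim Y)) : (i <= size (string_walk Y).2)%N by rewrite -ltnS.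
have [eY1 eY2] : S.2.1 = T.2.1 :> nat /\ S.2.2 = T.2.2 :> nat.
  move: eStart eEnd; rewrite /start_in_Y /end_in_Y; case: (o) => e1 e2.
    by split; [rewrite -(orient_posK true (bY S.2.1)) e2|rewrite -(orient_posK true (bY S.2.2)) e1];
      rewrite orient_posK.
  by split.
case: S T eX eX1 eY1 eY2 {hS hT le eY s1 s2 s3 ovS glS t1 t2 t3 ovT eEnd em eStart}
  => [[S1 S2] [S3 S4]] [[T1 T2] [T3 T4]] /= e1 e2 e3 e4.
by congr (_, _, (_, _)); apply: val_inj.
Qed.

(** If the orientations differ, Y is lazy, so both middle terms are lazy. *)
Lemma two_sided_right_inj (S T : fact_pair X Y) oS oT a u w :
  two_sided_at S oS -> two_sided_at T oT ->
  corner_entry k Y X (~~ oS) true (right_in_Y S oS) S.1.2 a u w != 0 ->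
  corner_entry k Y X (~~ oT) true (right_in_Y T oT) T.1.2 a u w != 0 -> S = T.
Proof.
move=> hS hT nS nT; have [gS _] := admissible_corners hS; have [gT _] := admissible_corners hT.
have [eY eX h] := admissible_corner_uniq hQ gS gT nS nT.
have [e|ne] := eqVneq oS oT; first by subst oT; apply: two_sided_end_inj hS hT eY eX.
have hN : forall t, leave Y t (right_in_Y S oS) = None.
  by case: h => [[_ []]|[]] // /negb_inj /eqP; rewrite (negPf ne).
have hi : (right_in_Y S oS <= size (string_walk Y).2)%N.
  by rewrite /right_in_Y -ltnS; case: (oS); apply: ltn_ord.
have h0 := lazy_string hi hN.
have z (i : 'I_(wdim Y)) : i = 0%N :> nat.
  by have := ltn_ord i; rewrite {2}/wdim h0 ltnS leqn0 => /eqP.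
have e0 (R : fact_pair X Y) r : two_sided_at R r -> R.1.1 = R.1.2 :> nat.
  move=> /two_sided_atP[r1 _ r3 _]; move: r1 r3.
  by rewrite /start_in_Y /end_in_Y /orient_pos h0 !z; clear; case: r => /=; lia.
move: (e0 _ _ hS) (e0 _ _ hT) eX.
case: S T {hS hT nS nT gS gT eY h ne hN hi} => [[S1 S2] [S3 S4]] [[T1 T2] [T3 T4]] /= e1 e2 e3.
by congr (_, _, (_, _)); apply: ord_inj; rewrite ?z // ?e1 ?e3 // -e2.
Qed.

(** The sides in X differ, so X is lazy and the two pairs coincide; but the corner
    is the left one for one orientation and the right one for the other. *)
Lemma two_sided_left_right (S T : fact_pair X Y) oS oT a u w :
  two_sided_at S oS -> two_sided_at T oT ->
  corner_entry k Y X (~~ oS) true (right_in_Y S oS) S.1.2 a u w != 0 ->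
  corner_entry k Y X oT false (left_in_Y T oT) T.1.1 a u w != 0 -> S = T /\ oT = ~~ oS.
Proof.
move=> hS hT nS nT; have [gS _] := admissible_corners hS; have [_ gT] := admissible_corners hT.
have [eY _ [[]//|[eo hN]]] := admissible_corner_uniq hQ gS gT nS nT.
split=> //; have hi : (S.1.2 <= size (string_walk X).2)%N by rewrite -ltnS.
have h0 := lazy_string hi hN.
have z (i : 'I_(wdim X)) : i = 0%N :> nat.
  by have := ltn_ord i; rewrite {2}/wdim h0 ltnS leqn0 => /eqP.
have bY (i : 'I_(wdim Y)) : (i <= size (string_walk Y).2)%N by rewrite -ltnS.
have e0 (R : fact_pair X Y) r : two_sided_at R r -> R.2.1 = R.2.2 :> nat.
  move=> /two_sided_atP[_ r2 r3 _]; move: r2 r3 (bY R.2.1) (bY R.2.2).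
  by rewrite /start_in_Y /end_in_Y /orient_pos !z; clear; case: r => /=; lia.
move: (e0 _ _ hS) (e0 _ _ hT) eY; rewrite /right_in_Y /left_in_Y.
case: S T {hS hT nS nT gS gT hN hi} => [[S1 S2] [S3 S4]] [[T1 T2] [T3 T4]] /= e1 e2.
rewrite e1 e2 !if_same => e3.
by congr (_, _, (_, _)); apply: ord_inj; rewrite ?z // ?e1 ?e3 // -e2.
Qed.

Variable o : two_sided X Y -> oriented X Y.
Hypothesis ho : forall T, (sval (o T)).1 = sval T.

Definition basis_cochain (i : connecting X Y + two_sided X Y) (g : vertex Q + arrow Q) :
    'M[k]_(wdim Y, wdim X) :=
  match i with
  | inl T => connecting_cochain k T g
  | inr T => two_sided_cochain k (o T) g
  end.

Lemma basis_cochains_free (c : connecting X Y + two_sided X Y -> k) :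
  @cobound k Q (smod k Y) (smod k X) (fun g => \sum_i c i *: basis_cochain i g) ->
  forall i, c i = 0.
Proof.
case=> h hh.
have hsum a u w : \sum_i c i * entry (basis_cochain i (inr a)) u w =
    entry (h *m string_act k X (inr a)) u w - entry (string_act k Y (inr a) *m h) u w.
  by rewrite -entry_linear hh entryB.
have two_entry S a u w : entry (basis_cochain (inr S) (inr a)) u w != 0 ->
    corner_entry k Y X (~~ (sval (o S)).2) true (right_in_Y (sval S) (sval (o S)).2)
      (sval S).1.2 a u w != 0.
  move=> e; have [hu hw] := entry_range e; move: e.
  by rewrite /= /two_sided_cochain /right_in_Y ho entry_nat_mx.
have two_at S : two_sided_at (sval S) (sval (o S)).2.
  by rewrite -ho; apply: (valP (o S)).
have conn0 S a u w : (exists u', sends Y a u u') \/ (exists w', sends X a w' w) ->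
    entry (basis_cochain (inl S) (inr a)) u w = 0.
  move=> hs; apply/eqP/negPn/negP=> /connecting_isolated[n1 n2].
  by case: hs => -[z]; [rewrite (negPf (n1 z))|rewrite (negPf (n2 z))].
have two_sends S a u w : entry (basis_cochain (inr S) (inr a)) u w != 0 ->
    (exists u', sends Y a u u') \/ (exists w', sends X a w' w).
  by move/two_entry/corner_sends.
case=> T.
  have [a [u [w nT]]] : exists a u w, entry (basis_cochain (inl T) (inr a)) u w = 1.
    case: (T) => -[[a oX] oY] hT.
    exists a, (orient_pos oY Y 0), (orient_pos oX X (size (string_walk X).2)).
    by rewrite /= /connecting_cochain entry_nat_mx ?ltnS ?orient_pos_le // !eqxx.
  have nT1 : entry (basis_cochain (inl T) (inr a)) u w != 0 by rewrite nT oner_eq0.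
  have [n1 n2] := connecting_isolated nT1.
  have := hsum a u w; rewrite mulmx_sends0 // sends_mulmx0 // subr0.
  rewrite (bigD1 (inl T)) //= big1 => [|[] S hS].
  - by rewrite addr0 -[entry _ u w]/(entry (basis_cochain (inl T) (inr a)) u w) nT mulr1.
  - case: (eqVneq (entry (basis_cochain (inl S) (inr a)) u w) 0) => [->|nS]; first exact: mulr0.
    by case/eqP: hS; rewrite (connecting_inj nS nT1).
  - case: (eqVneq (entry (basis_cochain (inr S) (inr a)) u w) 0) => [->|/two_sends]; first exact: mulr0.
    by case=> -[z]; [rewrite (negPf (n1 z))|rewrite (negPf (n2 z))].
have [gR gL] := admissible_corners (two_at T).
have sum0 a u w : (exists u', sends Y a u u') \/ (exists w', sends X a w' w) ->
    (forall S, entry (basis_cochain (inr S) (inr a)) u w = 0) ->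
    entry (h *m string_act k X (inr a)) u w = entry (string_act k Y (inr a) *m h) u w.
  move=> hs n; apply/eqP; rewrite -subr_eq0 -hsum big1 // => -[] S _.
    by rewrite (conn0 _ _ _ _ hs) mulr0.
  by rewrite n mulr0.
have inL : (left_in_Y (sval T) (sval (o T)).2 < wdim Y)%N.
  by rewrite /left_in_Y; case: (sval (o T)).2; apply: ltn_ord.
have inR : (right_in_Y (sval T) (sval (o T)).2 < wdim Y)%N.
  by rewrite /right_in_Y; case: (sval (o T)).2; apply: ltn_ord.
have [a [u [w [_ _ nL hL]]]] := admissible_corner_value k inL (ltn_ord _) gL.
have h0 : entry h (left_in_Y (sval T) (sval (o T)).2) (sval T).1.1 = 0.
  have := hL h; rewrite (@sum0 a u w).
  - by rewrite subrr => /esym/eqP; rewrite mulf_eq0 (negPf nL) => /eqP.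
  - exact: corner_sends nL.
  - move=> S; apply/eqP/negPn/negP => /two_entry nS.
    have [/val_inj eS] := two_sided_left_right (two_at S) (two_at T) nS nL.
    by rewrite eS; case: (sval (o T)).2.
have inner s s' i j b : leave Y s i = Some (b, true) -> leave X s' j = Some (b, true) ->
    entry h i j = entry h (move s i) (move s' j).
  move=> lY lX; apply/eqP; rewrite -subr_eq0 -(inner_entry h lY lX) (@sum0 b).
  - by rewrite subrr.
  - by left; exists (move s i); apply/sendsP; exists s.
  - move=> S; apply/eqP/negPn/negP => /two_entry; have [gS _] := admissible_corners (two_at S).
    by rewrite (admissible_corner_inner k gS lY lX) eqxx.
have [b [u' [w' [hu hw nR hR]]]] := admissible_corner_value k inR (ltn_ord _) gR.
have := hR h; rewrite -(walk_along (two_at T) inner) h0 mulr0 -hsum.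
rewrite (bigD1 (inr T)) //= big1 => [|[] S hS].
- rewrite addr0 /two_sided_cochain -/(right_in_Y _ _) entry_nat_mx // ho => /eqP.
  by rewrite mulf_eq0 (negPf nR) orbF => /eqP.
- by rewrite (conn0 _ _ _ _ (corner_sends nR)) mulr0.
- case: (eqVneq (entry (basis_cochain (inr S) (inr b)) u' w') 0) => [->|/two_entry nS].
    exact: mulr0.
  by case/eqP: hS; congr inr; apply/val_inj/(two_sided_right_inj (two_at S) (two_at T) nS nR).
Qed.

End Independence.

Theorem theorem8p5 (k : fieldType) (Q : bound_quiver) (gentleQ : gentle Q)
    (X Y : string Q) (o : two_sided X Y -> oriented X Y)
    (ho : forall T : two_sided X Y, (sval (o T)).1 = sval T) :
  exists eps : connecting X Y + two_sided X Y -> extension (smod k Y) (smod k X),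
    [/\ forall T : connecting X Y, ext_seq (eps (inl T)) = conn_seq k T,
        forall T : two_sided X Y, ext_seq (eps (inr T)) = two_sided_seq k (o T) &
        is_basis (fun T => ext_class (eps T))].
Proof.
have ex i : exists e : extension (smod k Y) (smod k X),
    ext_seq e = (match i with inl T => conn_seq k T | inr T => two_sided_seq k (o T) end) /\
    @represents k Q (smod k Y) (smod k X) (ext_class e) (basis_cochain k o i).
  case: i => T.
    by have [h rep] := connecting_exact k T; exists (Extension h).
  by have [h rep] := two_sided_exact k (o T); exists (Extension h).
have [eps heps] := boolp.choice ex.
exists eps; split=> [T|T|].
- by have [] := heps (inl T).
- by have [] := heps (inr T).
apply: basis_of_cocycles (fun i => (heps i).2) _ _.
  exact: basis_cochains_free.
move=> v; apply: (@in_span_all k Q gentleQ X Y o (fun T => ext_class (eps T)) ho) => T.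
- exact: (heps (inr T)).2.
- exact: (heps (inl T)).2.
Qed.
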